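(* Let $k\ge 2$ be an integer. Then $$V^\#_{E_k}(D(p-1))=V(p_k),$$ where $p_k(x_1,\ldots,x_k)=\sum_{i=1}^k (x_1\cdots\widehat{x_i}\cdots x_k)^{p-1}\in\mathbb{F}[x_1,\ldots,x_k]$.
   Context: $p$ is an odd prime and $\mathbb{F}$ is an algebraically closed field of characteristic $p$. $\mathfrak{S}_{n}$ is the symmetric group on $\{1,\dots,n\}$. For $1\le i\le k$ let $g_i$ be the $p$-cycle $((i-1)p+1,(i-1)p+2,\ldots,ip)\in\mathfrak{S}_{kp}$ and $E_k=\langle g_1,\ldots,g_k\rangle\le\mathfrak{S}_{kp}$, an elementary abelian $p$-group of rank $k$. For a $p$-regular partition $\lambda$ of $n$ (no part repeated $p$ or more times), $D^\lambda$ is the simple head of the Specht module $S^\lambda$ of $\mathbb{F}\mathfrak{S}_n$ (James's convention: $S^\lambda$ is spanned by the $\lambda$-polytabloids). Put $D(1)=D^{(kp-1,1)}$ and $D(r)=\bigwedge^r D(1)$; for $1\le r\le p-1$ one has $D(r)\cong D^{(kp-r,1^r)}$. Rank variety: put $X_i=g_i-1$, and for $\alpha=(\alpha_1,\dots,\alpha_k)\in\mathbb{F}^k$ put $u_\alpha=1+\sum_{i=1}^k\alpha_iX_i\in\mathbb{F}E_k$; for $\alpha\ne0$ this unit has order $p$. For a finite-dimensional $\mathbb{F}\mathfrak{S}_{kp}$-module $M$ (restricted to $E_k$), $V^\#_{E_k}(M)=\{0\}\cup\{\alpha\in\mathbb{F}^k\setminus\{0\}: M{\downarrow_{\langle u_\alpha\rangle}}\text{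 is not a free }\mathbb{F}\langle u_\alpha\rangle\text{-module}\}$. For $f\in\mathbb{F}[x_1,\ldots,x_k]$, $V(f)=\{\alpha\in\mathbb{F}^k:f(\alpha)=0\}$. The hat denotes omission of a factor. *)

(* Defs.v *)
From HB Require Import structures.
From mathcomp Require Import all_boot all_order all_algebra all_fingroup.
From mathcomp Require Import all_character.
From mathcomp Require Import mpoly boolp.

Set Implicit Arguments.
Unset Strict Implicit.
Unset Printing Implicit Defensive.

Import GRing.Theory.
Local Open Scope ring_scope.

(* Modules are row spaces with matrices acting on the right.  As (s * t)%g     *)
(* applies s first, a right module here is a left module for the composition   *)
(* of permutations from right to left.                                         *)

Section Specht.

Variables (F : fieldType) (lam : seq nat) (n : nat).

(* The cells of the Young diagram of lam are numbered 0, ..., n - 1 along the  *)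
(* rows: cell c lies in row [reshape_index lam c] and in column                *)
(* [reshape_offset lam c].  A tableau is a permutation t : 'S_n, where t c is  *)
(* the entry in cell c.  A tabloid is the function mapping an entry to the     *)
(* index of its row.                                                           *)

Definition tabloids : {set {ffun 'I_n -> 'I_(size lam)}} :=
  [set T : {ffun 'I_n -> 'I_(size lam)} |
     [forall r, #|[set x | T x == r]| == nth 0%N lam (val r)]].

Definition tabloid_act (T : {ffun 'I_n -> 'I_(size lam)}) (g : 'S_n) :=
  [ffun x => T ((g^-1)%g x)].

Definition tabloid_mx (g : 'S_n) : 'M[F]_#|tabloids| :=
  \matrix_(i, j) (tabloid_act (enum_val i) g == enum_val j)%:R.

Definition tabloid_of (t : 'S_n) (T : {ffun 'I_n -> 'I_(size lam)}) : bool :=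
  [forall c, T (t c) == reshape_index lam c :> nat].

Definition column_stab (t : 'S_n) : {set 'S_n} :=
  [set s : 'S_n | [forall x : 'I_n,
     reshape_offset lam ((t^-1)%g (s x)) == reshape_offset lam ((t^-1)%g x)]].

Definition polytabloid (t : 'S_n) : 'rV[F]_#|tabloids| :=
  \row_i \sum_(s in column_stab t)
     (-1) ^+ odd_perm s * (tabloid_of (t * s)%g (enum_val i))%:R.

Definition specht_mx : 'M[F]_#|tabloids| :=
  (\sum_(t : 'S_n) <<polytabloid t>>)%MS.

Lemma tabloid_act1 T : tabloid_act T 1%g = T.
Proof. by apply/ffunP=> x; rewrite ffunE invg1 perm1. Qed.

Lemma tabloid_actM T g h :
  tabloid_act T (g * h)%g = tabloid_act (tabloid_act T g) h.
Proof. by apply/ffunP=> x; rewrite !ffunE invMg permM. Qed.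

Lemma tabloid_actP T g : (tabloid_act T g \in tabloids) = (T \in tabloids).
Proof.
rewrite !inE; apply: eq_forallb => r; congr (_ == _).
rewrite -[RHS](card_imset _ (@perm_inj _ g)); apply: eq_card => x.
apply/idP/imsetP => [|[y yr ->]]; last by move: yr; rewrite !inE ffunE permK.
by rewrite inE ffunE => xr; exists ((g^-1)%g x); rewrite ?inE ?permKV.
Qed.

Lemma tabloid_actK g : cancel (tabloid_act^~ g) (tabloid_act^~ (g^-1)%g).
Proof. by move=> T; rewrite /= -tabloid_actM mulgV tabloid_act1. Qed.

Lemma tabloid_actKV g : cancel (tabloid_act^~ (g^-1)%g) (tabloid_act^~ g).
Proof. by move=> T; rewrite /= -tabloid_actM mulVg tabloid_act1. Qed.

Lemma tabloid_mx_repr : mx_repr [set: 'S_n] tabloid_mx.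
Proof.
split=> [|g h _ _].
  apply/matrixP=> i j; rewrite !mxE tabloid_act1.
  by rewrite (inj_eq enum_val_inj).
apply/matrixP=> i j; rewrite !mxE.
have igP : tabloid_act (enum_val i) g \in tabloids.
  by rewrite tabloid_actP enum_valP.
rewrite (bigD1 (enum_rank_in igP (tabloid_act (enum_val i) g))) //=.
rewrite !mxE enum_rankK_in // eqxx mul1r -tabloid_actM.
rewrite big1 ?addr0 // => l ne_l; rewrite !mxE.
case: eqP => [e|]; last by rewrite mul0r.
by case/eqP: ne_l; apply: enum_val_inj; rewrite enum_rankK_in // e.
Qed.

Canonical tabloid_repr := MxRepresentation tabloid_mx_repr.

Lemma polytabloid_act t g :
  polytabloid t *m tabloid_mx g = polytabloid (t * g)%g.
Proof.
apply/rowP=> j; rewrite !mxE.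
have jgP : tabloid_act (enum_val j) (g^-1)%g \in tabloids.
  by rewrite tabloid_actP enum_valP.
rewrite (bigD1 (enum_rank_in jgP (tabloid_act (enum_val j) (g^-1)%g))) //=.
rewrite [X in _ + X]big1 ?addr0 => [|l ne_l]; last first.
  rewrite !mxE; case: eqP => [e|]; last by rewrite mulr0.
  case/eqP: ne_l; apply: enum_val_inj; rewrite enum_rankK_in //.
  by rewrite -e tabloid_actK.
rewrite !mxE enum_rankK_in // tabloid_actKV eqxx mulr1.
rewrite [RHS](reindex_inj (conjg_inj g)) /=.
apply: eq_big => [s|s _].
  rewrite !inE; apply/forallP/forallP => H x.
    by have := H ((g^-1)%g x); rewrite conjgE invMg !permM permK.
  by have := H (g x); rewrite conjgE invMg !permM !permK.
rewrite odd_permJ; congr (_ * (nat_of_bool _)%:R); apply: eq_forallb => c.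
by rewrite ffunE invgK conjgE !permM permK.
Qed.

Lemma specht_module : mxmodule tabloid_repr specht_mx.
Proof.
apply/mxmoduleP=> g _; rewrite sumsmxMr; apply/sumsmx_subP=> t _.
rewrite (eqmxMr _ (genmxE _)) polytabloid_act.
by rewrite (sumsmx_sup (t * g)%g) // genmxE.
Qed.

Definition specht_repr := submod_repr specht_module.

End Specht.

Section Head.

Variables (F : fieldType) (gT : finGroupType) (G : {group gT}) (n : nat).
Variable rG : mx_representation F G n.

Definition is_radical (R : 'M[F]_n) : Prop :=
  mxmodule rG R /\
  forall v : 'rV[F]_n,
    (v <= R)%MS <->
    (forall U : 'M_n, mxmodule rG U -> max_submod rG U 1%:M -> (v <= U)%MS).

Lemma radical_exists : exists R, is_radical R.
Proof.
pose Q (R : 'M[F]_n) := mxmodule rG R /\ forall v : 'rV[F]_n,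
  (forall U : 'M_n, mxmodule rG U -> max_submod rG U 1%:M -> (v <= U)%MS) ->
  (v <= R)%MS.
have exQ : exists r, `[< exists R, Q R /\ \rank R = r >].
  exists (\rank (1%:M : 'M[F]_n)); apply/asboolP; exists 1%:M; split=> //.
  by split=> [|v _]; [apply: mxmodule1 | apply: submx1].
case: (ex_minnP exQ) => r /asboolP[R [[modR supR] rR]] minR.
exists R; split=> // v; split=> [sv U modU maxU|]; last exact: supR.
suff sRU : (R <= U)%MS by apply: submx_trans sRU.
have QRU : Q (R :&: U)%MS.
  split=> [|w sw]; first exact: capmx_module.
  by rewrite sub_capmx supR //= sw.
have := minR (\rank (R :&: U)%MS) (asboolT (ex_intro _ _ (conj QRU erefl))).
rewrite -rR => le_rank.
have/eqmxP e : (R :&: U == R)%MS.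
  by rewrite -(mxrank_leqif_eq (capmxSl R U)) eqn_leq mxrankS ?capmxSl.
by rewrite -e capmxSr.
Qed.

Definition radical : 'M[F]_n := sval (cid radical_exists).

Lemma radicalP : is_radical radical.
Proof. exact: svalP (cid radical_exists). Qed.

Definition head_repr := factmod_repr (proj1 radicalP).

End Head.

(* James's D^lam, for lam a p-regular partition of n *)
Definition james_repr (F : fieldType) (lam : seq nat) (n : nat) :=
  head_repr (specht_repr F lam n).

Section Exterior.

Variable F : fieldType.

Definition increasing r d : {set {ffun 'I_r -> 'I_d}} :=
  [set f : {ffun 'I_r -> 'I_d} |
     [forall i : 'I_r, forall j : 'I_r, ((i < j) ==> (f i < f j))%N]].

Definition incr_fun r d (J : 'I_#|increasing r d|) : {ffun 'I_r -> 'I_d} :=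
  enum_val J.

(* wedge A is the exterior product of the rows of A, in coordinates for the    *)
(* basis e_(f 0) /\ ... /\ e_(f (r - 1)), f increasing, of the exterior power. *)
Definition wedge r d (A : 'M[F]_(r, d)) : 'rV[F]_#|increasing r d| :=
  \row_J \det (colsub (incr_fun J) A).

(* B maps e_(f 0) /\ ... /\ e_(f (r - 1)) to the exterior product of the rows  *)
(* f 0, ..., f (r - 1) of B.                                                   *)
Definition ext_mx r d (B : 'M[F]_d) : 'M[F]_#|increasing r d| :=
  \matrix_I wedge (rowsub (incr_fun I) B).

Lemma det_mulmx_ffun r d (A : 'M[F]_(r, d)) (B : 'M[F]_(d, r)) :
  \det (A *m B) =
  \sum_(f : {ffun 'I_r -> 'I_d}) (\prod_i A i (f i)) * \det (rowsub f B).
Proof.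
rewrite /determinant; under [RHS]eq_bigr do rewrite big_distrr /=.
rewrite exchange_big /=; apply: eq_bigr => s _.
under eq_bigr do rewrite mxE.
rewrite bigA_distr_bigA /= big_distrr /=; apply: eq_bigr => f _.
rewrite mulrCA; congr (_ * _); rewrite -big_split /=.
by apply: eq_bigr => i _; rewrite mxE.
Qed.

Lemma increasingP r d (f : {ffun 'I_r -> 'I_d}) :
  reflect (forall i j : 'I_r, (i < j)%N -> (f i < f j)%N) (f \in increasing r d).
Proof.
rewrite inE; apply: (iffP forallP) => [H i j ij|H i].
  by have /forallP/(_ j)/implyP := H i; apply.
by apply/forallP=> j; apply/implyP; apply: H.
Qed.

Lemma increasing_inj r d (f : {ffun 'I_r -> 'I_d}) :
  f \in increasing r d -> injective f.
Proof.
move/increasingP=> H i j e; apply: val_inj; apply/eqP.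
by case: ltngtP => // /H; rewrite e ltnn.
Qed.

Definition permuted r d (x : {ffun 'I_r -> 'I_d} * 'S_r) : {ffun 'I_r -> 'I_d} :=
  [ffun i => x.1 (x.2 i)].

Lemma increasing_sorted r d (f : {ffun 'I_r -> 'I_d}) :
  f \in increasing r d -> sorted ltn [seq val (f i) | i <- enum 'I_r].
Proof.
move/increasingP=> H; rewrite sorted_map.
have : sorted (relpre val ltn) (enum 'I_r) by rewrite -sorted_map val_enum_ord iota_ltn_sorted.
by apply: sub_sorted => i j; apply: H.
Qed.

Lemma permuted_inj r d :
  {in [set x | x.1 \in increasing r d] &, injective (@permuted r d)}.
Proof.
move=> [f s] [g t]; rewrite in_set => /= fP.
rewrite in_set => /= gP /ffunP e.
have efg : f = g.
  have : [seq val (f i) | i <- enum 'I_r] = [seq val (g i) | i <- enum 'I_r].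
    apply: (irr_sorted_eq ltn_trans ltnn); try exact: increasing_sorted.
    move=> m; apply/mapP/mapP => -[i _ ->].
      exists (t ((s^-1)%g i)); rewrite ?mem_enum //.
      by have := e ((s^-1)%g i); rewrite !ffunE /= permKV => ->.
    exists (s ((t^-1)%g i)); rewrite ?mem_enum //.
    by have := e ((t^-1)%g i); rewrite !ffunE /= permKV => ->.
  move/eq_in_map => H; apply/ffunP => i; apply: val_inj; apply: H.
  by rewrite mem_enum.
subst g; congr (_, _); apply/permP=> i; apply: (increasing_inj fP).
by have := e i; rewrite !ffunE.
Qed.

Lemma permuted_image r d :
  @permuted r d @: [set x | x.1 \in increasing r d] =
  [set f : {ffun 'I_r -> 'I_d} | injectiveb f].
Proof.
apply/setP=> f; rewrite [RHS]in_set; apply/imsetP/injectiveP => [[[g s]]|f_inj].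
  rewrite in_set /= => gP -> i j; rewrite !ffunE /= => /(increasing_inj gP).
  exact: perm_inj.
pose leI (x y : 'I_d) := (x <= y)%N.
pose s := sort leI (codom f).
have leI_tr : transitive leI by move=> x y z; apply: leq_trans.
have s_size : size s == r by rewrite size_sort size_codom card_ord.
have c_size : size (codom f) == r by rewrite size_codom card_ord.
have perm_cs : perm_eq (Tuple c_size) (Tuple s_size).
  by rewrite /= perm_sym perm_sort.
have /tuple_permP[u eu] := perm_cs.
have s_sorted : sorted leI s by apply: sort_sorted => x y; apply: leq_total.
have s_uniq : uniq s by rewrite sort_uniq; apply/injectiveP.
pose g := [ffun i => tnth (Tuple s_size) i].
have gP : g \in increasing r d.
  apply/increasingP=> i j ij; rewrite !ffunE.
  have x0 : 'I_d := f i.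
  rewrite !(tnth_nth x0) /= ltn_neqAle; apply/andP; split.
    rewrite (inj_eq val_inj) nth_uniq ?(eqP s_size) //.
    by rewrite neq_ltn ij.
  have := sorted_ltn_nth leI_tr x0 s_sorted; apply => //;
    by rewrite inE (eqP s_size).
exists (g, u); first by rewrite in_set.
apply/ffunP=> i; rewrite !ffunE /=.
have -> : f i = nth (f i) (codom f) i.
  by rewrite codomE (nth_map i) ?size_enum_ord // nth_ord_enum.
have -> : codom f = [tuple tnth (Tuple s_size) (u j) | j < r] by [].
by rewrite -tnth_nth tnth_mktuple.
Qed.

Lemma det_mulmx_wedge r d (A : 'M[F]_(r, d)) (B : 'M[F]_(d, r)) :
  \det (A *m B) =
  \sum_I \det (colsub (@incr_fun r d I) A) * \det (rowsub (incr_fun I) B).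
Proof.
rewrite det_mulmx_ffun (bigID (fun f : {ffun 'I_r -> 'I_d} => f \in [set f : {ffun 'I_r -> 'I_d} | injectiveb f])) /=.
rewrite [X in _ + X]big1 ?addr0 => [|f]; last first.
  rewrite inE => /injectivePn[i [j ij fij]].
  rewrite (determinant_alternate ij) ?mulr0 // => l.
  by rewrite !mxE fij.
rewrite -permuted_image big_imset; last exact: permuted_inj.
rewrite (eq_bigl (fun x => (x.1 \in increasing r d) && true)); last first.
  by move=> x; rewrite in_set andbT.
rewrite -(pair_big (mem (increasing r d)) xpredT
  (fun f s => (\prod_i A i (permuted (f, s) i))
              * \det (rowsub (permuted (f, s)) B))) /=.
rewrite big_enum_val /=; apply: eq_bigr => I _.
rewrite -/(incr_fun I); set f := incr_fun I.
rewrite [\det (colsub f A)]/determinant big_distrl /=.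
apply: eq_bigr => s _.
have -> : rowsub (permuted (f, s)) B = row_perm s (rowsub f B).
  by apply/matrixP=> i j; rewrite !mxE ffunE.
rewrite row_permE det_mulmx det_perm mulrCA mulrA; congr (_ * _ * _).
by apply: eq_bigr => i _; rewrite !mxE [permuted _ _]ffunE.
Qed.

Lemma wedge_mulmx r d (A : 'M[F]_(r, d)) (B : 'M[F]_d) :
  wedge (A *m B) = wedge A *m ext_mx r B.
Proof.
apply/rowP=> J; rewrite !mxE -mulmx_colsub det_mulmx_wedge.
apply: eq_bigr => I _; rewrite !mxE; congr (_ * \det _).
by apply/matrixP=> i j; rewrite !mxE.
Qed.

Lemma ext_mx1 r d : ext_mx r (1%:M : 'M[F]_d) = 1%:M.
Proof.
apply/matrixP=> I J; rewrite !mxE /=.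
case: (I =P J) => [->|neIJ].
  rewrite -[RHS](@det1 F r); congr (\det _); apply/matrixP=> i j.
  rewrite !mxE (inj_eq (increasing_inj _)) //; exact: enum_valP.
rewrite /determinant big1 //= => s _.
have [/eqfunP e|/forallPn[i ne]] :=
  boolP [forall i, incr_fun I i == incr_fun J (s i)]; last first.
  by rewrite (bigD1 i) //= !mxE (negPf ne) mul0r mulr0.
case: neIJ; apply: enum_val_inj; rewrite -!/(incr_fun _).
suff [] : (incr_fun I, 1%g) = (incr_fun J, s) by [].
apply: permuted_inj; [rewrite in_set; exact: enum_valP .. |].
by apply/ffunP=> i; rewrite !ffunE /= perm1.
Qed.

Lemma ext_mxM r d (A B : 'M[F]_d) : ext_mx r (A *m B) = ext_mx r A *m ext_mx r B.
Proof.
apply/row_matrixP=> I; rewrite row_mul !rowK -wedge_mulmx.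
by rewrite mul_rowsub_mx.
Qed.

Variables (gT : finGroupType) (G : {group gT}) (r d : nat).
Variable rG : mx_representation F G d.

Lemma ext_mx_repr : mx_repr G (fun g => ext_mx r (rG g)).
Proof.
split=> [|g h gG hG]; first by rewrite repr_mx1 ext_mx1.
by rewrite repr_mxM // ext_mxM.
Qed.

Definition ext_repr := MxRepresentation ext_mx_repr.

End Exterior.

Section RankVariety.

Variables p k : nat.

(* Points are numbered from 0: the cycle with index i permutes the block       *)
(* i * p, ..., i * p + p - 1.                                                  *)
Definition block_shift (i : 'I_k) (x : 'I_(k * p)) : 'I_(k * p) :=
  if (x %/ p == i)%N then insubd x (i * p + x.+1 %% p)%N else x.

Lemma val_block_shift i x :
  val (block_shift i x) =
  (if x %/ p == i then i * p + x.+1 %% p else x)%N.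
Proof.
rewrite /block_shift; case: ifP => // _; rewrite val_insubd.
have p_gt0 : (0 < p)%N by case: (posnP p) x => // -> [x]; rewrite muln0.
rewrite (leq_trans (n := (i * p + p)%N)) ?ltn_add2l ?ltn_pmod //.
by rewrite addnC -mulSn leq_mul2r ltn_ord orbT.
Qed.

Lemma block_shift_inj i : injective (block_shift i).
Proof.
move=> x y /(congr1 val); rewrite !val_block_shift => e; apply: val_inj => /=.
have p_gt0 : (0 < p)%N by case: (posnP p) x {e} => // -> [x]; rewrite muln0.
have lt_mod (m : nat) : ((i * p + m %% p) %/ p = i)%N.
  by rewrite divnMDl // divn_small ?addn0 // ltn_pmod.
move: e; case: eqP => [xi|xi]; case: eqP => [yi|yi] // e.
- move/addnI/eqP: e; rewrite -addn1 -[y.+1]addn1 eqn_modDr => /eqP e.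
  by rewrite (divn_eq x p) (divn_eq y p) xi yi e.
- by case: yi; rewrite -e lt_mod.
- by case: xi; rewrite e lt_mod.
Qed.

Definition pcycle (i : 'I_k) : 'S_(k * p) := perm (@block_shift_inj i).

Definition pcycle_group : {group 'S_(k * p)} := <<[set pcycle i | i : 'I_k]>>%G.

Variable F : fieldType.

Section Module.

Variables (m : nat) (rE : mx_representation F pcycle_group m).

(* the action on the module of u_alpha = 1 + \sum_i alpha_i (g_i - 1) *)
Definition shifted_unit (alpha : 'rV[F]_k) : 'M[F]_m :=
  1%:M + \sum_(i < k) alpha 0 i *: (rE (pcycle i) - 1%:M).

(* A matrix u acts as a generator of a cyclic group of order p, whose group    *)
(* algebra has basis 1, u, ..., u ^+ (p - 1).  The module is free over this    *)
(* algebra if it has a basis over it, given here by the rows of b.             *)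
Definition cyclic_free (u : 'M[F]_m) : Prop :=
  exists s (b : 'M[F]_(s, m)), forall v : 'rV[F]_m,
    exists! c : 'M[F]_(s, p),
      v = \sum_(j < s) \sum_(i < p) c j i *: (row j b *m u ^+ i).

Definition rank_variety (alpha : 'rV[F]_k) : Prop :=
  alpha = 0 \/ (alpha != 0 /\ ~ cyclic_free (shifted_unit alpha)).

End Module.

Definition zero_locus (f : {mpoly F[k]}) (alpha : 'rV[F]_k) : Prop :=
  f.@[alpha 0] = 0.

Definition D1_repr := james_repr F [:: (k * p).-1; 1%N] (k * p).

Definition D_repr (r : nat) := ext_repr r D1_repr.

Definition p_poly : {mpoly F[k]} :=
  \sum_(i < k) (\prod_(j < k | j != i) 'X_j) ^+ p.-1.

End RankVariety.

(* Main.v *)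
Require Import Defs.
From HB Require Import structures.
From mathcomp Require Import all_boot all_order all_algebra all_fingroup.
From mathcomp Require Import all_character.
From mathcomp Require Import mpoly zify.

(** Let n = k p and let M be the natural permutation module of the symmetric
    group, of dimension n.  As p divides n, the all-one vector e lies in the
    kernel S of the coordinate sum eps, and D(1) is S / e.  Under E_k the
    module M is a sum of k blocks, the i-th being the regular module of
    <g_i> with basis w_(i,j) = X_i^j w_(i,0), j < p.  Give w_(i,j) the degree
    j: then X_i is a shift of degree 1, eps is the sum of the coordinates of
    degree 0, and e is the sum of the w_(i,p-1).  So D(1) and its exterior
    powers are graded.

    Put x = \sum_i alpha_i X_i and let y be the derivation of the exterior
    algebra that extends x.  On an exterior power, g_i acts by a ring
    morphism, not by a derivation; but g_i - 1 is the derivation extending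
    X_i plus terms that raise the degree by at least 2, so u_alpha - 1 equals
    y plus terms of degree at least 2 ([group_comb_lead]).  All that follows
    compares u_alpha - 1 with its leading term y.  An operator z with
    z ^ p = 0 makes the module free over 1 + z if and only if ker z = im
    z^(p-1), equivalently ker z^(p-1) = im z ([cyclic_free_exact],
    [cyclic_freeP_exact]).

    If p_k(alpha) <> 0, then x^(p-1) is injective from degree 0 to degree
    p - 1 of D(1) ([D_comb_injective]).  Choose a with x^(p-1) a the identity
    in degree 0. Then E = \sum_i x^(p-1-i) a x^i is an idempotent with a
    kernel of dimension less than p - 1 ([degree_idempotent]). A product of
    p - 1 independent eigenvectors of E involves at least one with
    eigenvalue 1 and at most p - 1 of them, so the derivation extending E is
    invertible on the (p - 1)-st exterior power
    ([derivation_idempotent_inj]). In characteristic p the sum defining E is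
    the iterated commutator (ad x)^(p-1) a, and extending to derivations
    preserves commutators. Hence the analogous sum for u_alpha - 1 and the
    derivation extending a is an invertible operator plus terms of positive
    degree: it is invertible, and this gives freeness as in Higman's
    criterion ([transfer_exact], [group_comb_exact]).

    If p_k(alpha) = 0 and two coordinates alpha_z, alpha_z' vanish, the vector
    (w_(z,0) - w_(z',0)) /\ w_(z,1) /\ ... /\ w_(z,p-2) is killed by
    u_alpha - 1 and is detected by a functional that vanishes on the image of
    u_alpha - 1, so the module is not free ([D_nonexact_zeros]).  A single
    vanishing coordinate contradicts p_k(alpha) = 0.  If no coordinate
    vanishes, then s = \sum_i alpha_i^(1-p) w_(i,0) lies in S and s x^(p-1)
    is e, so s, s x, ..., s x^(p-2) span an x-stable subspace of D(1), of
    dimension p - 1.  Their product v, in degree C say, is killed by y and is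
    not in the image of y.  To replace y by u_alpha - 1 one needs that
    ker y = im y^(p-1) in the degrees outside [C, C + p), so that higher
    correction terms can be removed ([nonfree_of_lead]).  This vanishing is
    proved from the r-th exterior power of M, where it holds in all degrees
    for 0 < r < p because an operator delta with [delta, x] = 1 exists, by
    descending to S and then to S / e along the Koszul complexes of eps and
    of e ([cycle_cohomology], [quotient_cohomology],
    [exterior_quotient_exact]).

    Finally the model with shifts is identified with the head of the Specht
    module: polytabloids of shape (n - 1, 1) are differences of coordinate
    vectors, so the Specht module is S and its radical is the line of e
    ([radical_specht]), and binomial coefficients express the coordinate
    vectors of a block through the w_(i,j) ([head_coord_pcycle]). *)

Set Implicit Arguments.
Unset Strict Implicit.
Unset Printing Implicit Defensive.

Import Order.TTheory GRing.Theory Num.Theory.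
Local Open Scope ring_scope.

(** * Exterior powers: functoriality and derivations *)

Section Exterior.
Variable F : fieldType.

(** The rectangular form of [ext_mx], to which it is convertible on square
    matrices: subquotients are reached through rectangular matrices. *)
Definition exterior r d d' (B : 'M[F]_(d, d')) :
    'M[F]_(#|increasing r d|, #|increasing r d'|) :=
  \matrix_I wedge (rowsub (incr_fun I) B).

Lemma wedge_exterior r d d' (A : 'M[F]_(r, d)) (B : 'M[F]_(d, d')) :
  wedge (A *m B) = wedge A *m exterior r B.
Proof.
apply/rowP=> J; rewrite !mxE -mulmx_colsub det_mulmx_wedge.
apply: eq_bigr => I _; rewrite !mxE; congr (_ * \det _).
by apply/matrixP=> i j; rewrite !mxE.
Qed.

Lemma wedge_basis r d (I : 'I_#|increasing r d|) :
  wedge (rowsub (incr_fun I) 1%:M) = delta_mx 0 I :> 'rV[F]__.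
Proof. by rewrite -(rowK (fun I => wedge (rowsub (incr_fun I) 1%:M))) -/(ext_mx r 1%:M) ext_mx1 row1. Qed.

(** Products of vectors span the exterior power; most identities between
    operators below are checked on them. *)
Lemma eq_on_wedges r d q (L L' : 'M[F]_(#|increasing r d|, q)) :
  (forall A : 'M[F]_(r, d), wedge A *m L = wedge A *m L') -> L = L'.
Proof.
move=> eqL; apply/row_matrixP=> I.
by rewrite !rowE -wedge_basis eqL.
Qed.

Lemma exteriorM r d d' d'' (A : 'M[F]_(d, d')) (B : 'M[F]_(d', d'')) :
  exterior r (A *m B) = exterior r A *m exterior r B.
Proof.
by apply: eq_on_wedges => C; rewrite -wedge_exterior !mulmxA !wedge_exterior.
Qed.

Lemma exterior1 r d : exterior r (1%:M : 'M[F]_d) = 1%:M.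
Proof. exact: ext_mx1. Qed.

(** The functional on the exterior power defined by r functionals, the
    columns of B; see [wedge_pair]. *)
Definition wedge_col d r (B : 'M[F]_(d, r)) : 'cV[F]_#|increasing r d| :=
  \col_I \det (rowsub (incr_fun I) B).

Lemma wedge_pair r d (A : 'M[F]_(r, d)) (B : 'M[F]_(d, r)) :
  wedge A *m wedge_col B = (\det (A *m B))%:M.
Proof.
apply/matrixP=> i j; rewrite !ord1 [RHS]mxE eqxx mulr1n det_mulmx_wedge mxE.
by apply: eq_bigr => I _; rewrite !mxE.
Qed.

Lemma exterior_wedge_col r d d' (A : 'M[F]_(d, d')) (B : 'M[F]_(d', r)) :
  exterior r A *m wedge_col B = wedge_col (A *m B).
Proof.
by apply: eq_on_wedges => C; rewrite mulmxA -wedge_exterior !wedge_pair mulmxA.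
Qed.

Definition subst_row r d (A : 'M[F]_(r, d)) (i : 'I_r) (v : 'rV[F]_d) : 'M[F]_(r, d) :=
  \matrix_(a, b) if a == i then v 0 b else A a b.

Definition subst_col r d (A : 'M[F]_(r, d)) (j : 'I_d) (v : 'cV[F]_r) : 'M[F]_(r, d) :=
  \matrix_(a, b) if b == j then v a 0 else A a b.

Lemma det_subst_row r (A : 'M[F]_r) i v :
  \det (subst_row A i v) = \sum_j v 0 j * cofactor A i j.
Proof.
rewrite (expand_det_row _ i); apply: eq_bigr => j _; rewrite mxE eqxx.
congr (_ * (_ * \det _)); apply/matrixP=> a b; rewrite !mxE.
by rewrite eq_sym (negPf (neq_lift _ _)).
Qed.

Lemma det_subst_col r (A : 'M[F]_r) j v :
  \det (subst_col A j v) = \sum_i v i 0 * cofactor A i j.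
Proof.
rewrite (expand_det_col _ j); apply: eq_bigr => i _; rewrite mxE eqxx.
congr (_ * (_ * \det _)); apply/matrixP=> a b; rewrite !mxE.
by rewrite [_ == j]eq_sym (negPf (neq_lift _ _)).
Qed.

(** Both sides are the sum of the B i j * cofactor A i j. This trades an
    operator acting on the rows of a matrix for one acting on its
    columns. *)
Lemma sum_det_subst r (A B : 'M[F]_r) :
  \sum_i \det (subst_row A i (row i B)) = \sum_j \det (subst_col A j (col j B)).
Proof.
under eq_bigr do rewrite det_subst_row; under [RHS]eq_bigr do rewrite det_subst_col.
by rewrite exchange_big; do 2!apply: eq_bigr => ? _; rewrite !mxE.
Qed.

(** The action of X as an element of the Lie algebra of endomorphisms, by
    the Leibniz rule of [wedge_derivation]. *)
Definition derivation r d (X : 'M[F]_d) : 'M[F]_#|increasing r d| :=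
  \matrix_(I, J) \sum_j \det (rowsub (incr_fun I)
     (subst_col (colsub (incr_fun J) 1%:M) j (col (incr_fun J j) X))).

Lemma wedge_derivation r d (A : 'M[F]_(r, d)) (X : 'M[F]_d) :
  wedge A *m derivation r X = \sum_i wedge (subst_row A i (row i A *m X)).
Proof.
apply/rowP=> J; rewrite mxE summxE.
under eq_bigr do rewrite !mxE mulr_sumr.
rewrite exchange_big /=.
transitivity (\sum_j \det (A *m subst_col (colsub (incr_fun J) 1%:M) j (col (incr_fun J j) X))).
  by apply: eq_bigr => j _; rewrite det_mulmx_wedge.
transitivity (\sum_j \det (subst_col (colsub (incr_fun J) A) j (col j (colsub (incr_fun J) (A *m X))))).
  apply: eq_bigr => j _; congr (\det _); apply/matrixP=> a b; rewrite !mxE.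
  case: (eqVneq b j) => [->|ne].
    by apply: eq_bigr => c _; rewrite !mxE eqxx.
  rewrite (bigD1 (incr_fun J b)) //= !mxE (negPf ne) eqxx mulr1 big1 ?addr0 // => c nc.
  by rewrite !mxE (negPf ne) (negPf nc) mulr0.
rewrite -sum_det_subst; apply: eq_bigr => i _; rewrite mxE; congr (\det _).
by apply/matrixP=> a b; rewrite !mxE; case: eqP => // e; apply: eq_bigr => c _; rewrite !mxE.
Qed.

Lemma subst_row_mul r d d' (A : 'M[F]_(r, d)) i v (B : 'M[F]_(d, d')) :
  subst_row A i v *m B = subst_row (A *m B) i (v *m B).
Proof.
apply/matrixP=> a b; rewrite !mxE; case: ifP => [ai|ai];
by apply: eq_bigr => c _; rewrite !mxE ai.
Qed.

(** The Leibniz rule is natural in the space, since it modifies one factor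
    at a time. *)
Lemma derivation_exterior r d d' (X : 'M[F]_d) (Y : 'M[F]_d') (B : 'M[F]_(d, d')) :
  X *m B = B *m Y -> derivation r X *m exterior r B = exterior r B *m derivation r Y.
Proof.
move=> XB; apply: eq_on_wedges => A.
rewrite !mulmxA wedge_derivation -wedge_exterior wedge_derivation mulmx_suml.
apply: eq_bigr => i _; rewrite -wedge_exterior subst_row_mul; congr (wedge (subst_row _ _ _)).
by rewrite -mulmxA XB mulmxA row_mul.
Qed.

Lemma wedge_lin r d (A : 'M[F]_(r, d)) i c (v w : 'rV[F]_d) :
  wedge (subst_row A i (c *: v + w)) = c *: wedge (subst_row A i v) + wedge (subst_row A i w).
Proof.
apply/rowP=> J; rewrite !mxE.
have colS u : colsub (incr_fun J) (subst_row A i u) = subst_row (colsub (incr_fun J) A) i (colsub (incr_fun J) u).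
  by apply/matrixP=> a b; rewrite !mxE.
rewrite !colS !det_subst_row mulr_sumr -big_split; apply: eq_bigr => j _.
by rewrite !mxE mulrDl mulrA.
Qed.

Lemma wedge_substZ r d (A : 'M[F]_(r, d)) i c (v : 'rV[F]_d) :
  wedge (subst_row A i (c *: v)) = c *: wedge (subst_row A i v).
Proof.
have w0 : wedge (subst_row A i 0) = 0.
  by have := wedge_lin A i (-1) 0 0; rewrite scaler0 addr0 scaleN1r addNr.
by have := wedge_lin A i c v 0; rewrite !addr0 w0 addr0.
Qed.

Lemma derivation_is_linear r d : linear (@derivation r d).
Proof.
move=> c X Y; apply: eq_on_wedges => A.
rewrite mulmxDr -scalemxAr !wedge_derivation scaler_sumr -big_split.
by apply: eq_bigr => i _; rewrite mulmxDr -scalemxAr wedge_lin.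
Qed.

HB.instance Definition _ r d := GRing.isLinear.Build F 'M[F]_d _ _ (@derivation r d) (@derivation_is_linear r d).

Lemma subst_row_twice r d (A : 'M[F]_(r, d)) i v w :
  subst_row (subst_row A i v) i w = subst_row A i w.
Proof. by apply/matrixP=> a b; rewrite !mxE; case: eqP. Qed.

Lemma subst_row_swap r d (A : 'M[F]_(r, d)) i j v w : i != j ->
  subst_row (subst_row A i v) j w = subst_row (subst_row A j w) i v.
Proof.
move=> ij; apply/matrixP=> a b; rewrite !mxE.
by case: eqP => // ->; rewrite eq_sym (negPf ij).
Qed.

Lemma row_subst r d (A : 'M[F]_(r, d)) i v : row i (subst_row A i v) = v.
Proof. by apply/rowP=> b; rewrite !mxE eqxx. Qed.

Lemma row_subst_ne r d (A : 'M[F]_(r, d)) i j v : j != i -> row j (subst_row A i v) = row j A.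
Proof. by move=> ij; apply/rowP=> b; rewrite !mxE (negPf ij). Qed.

Lemma subst_row_id r d (A : 'M[F]_(r, d)) i : subst_row A i (row i A) = A.
Proof. by apply/matrixP=> a b; rewrite !mxE; case: eqP => // ->. Qed.

(** The terms where X and Y act on two different factors are symmetric in X
    and Y, so they cancel in the commutator. *)
Lemma derivation_bracket r d (X Y : 'M[F]_d) :
  derivation r X *m derivation r Y - derivation r Y *m derivation r X
  = derivation r (X *m Y - Y *m X).
Proof.
have expand (U V : 'M[F]_d) (A : 'M[F]_(r, d)) : wedge A *m (derivation r U *m derivation r V) =
    wedge A *m derivation r (U *m V) +
    \sum_i \sum_(j | j != i) wedge (subst_row (subst_row A i (row i A *m U)) j (row j A *m V)).
  rewrite mulmxA !wedge_derivation mulmx_suml -big_split; apply: eq_bigr => i _ /=.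
  rewrite wedge_derivation (bigD1 i) //= row_subst subst_row_twice mulmxA; congr (_ + _).
  by apply: eq_bigr => j ji; rewrite row_subst_ne.
apply: eq_on_wedges => A; rewrite [derivation r (_ - _)]linearB /= !mulmxBr !expand opprD addrACA.
rewrite [X in _ + X](_ : _ = 0) ?addr0 //; apply/eqP; rewrite subr_eq0; apply/eqP.
rewrite (exchange_big_dep xpredT) //=; apply: eq_bigr => i _.
by apply: eq_big => [j|j ji]; rewrite 1?eq_sym // subst_row_swap // eq_sym.
Qed.

Lemma derivation1 r d : derivation r (1%:M : 'M[F]_d) = r%:R%:M.
Proof.
apply: eq_on_wedges => A; rewrite wedge_derivation.
under eq_bigr do rewrite mulmx1 subst_row_id.
by rewrite sumr_const card_ord mul_mx_scalar scaler_nat.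
Qed.

End Exterior.

(** * Multiplication by a vector and contraction with a functional *)

Section AnticommutationRelations.
Variable F : fieldType.

Definition cons_row r d (w : 'rV[F]_d) (A : 'M[F]_(r, d)) : 'M[F]_(r.+1, d) :=
  \matrix_(i, j) if unlift 0 i is Some i' then A i' j else w 0 j.

Definition cons_col d r (phi : 'cV[F]_d) (B : 'M[F]_(d, r)) : 'M[F]_(d, r.+1) :=
  \matrix_(i, j) if unlift 0 j is Some j' then B i j' else phi i 0.

Definition creation r d (w : 'rV[F]_d) :
    'M[F]_(#|increasing r d|, #|increasing r.+1 d|) :=
  \matrix_I wedge (cons_row w (rowsub (incr_fun I) 1%:M)).

(** Contraction with phi, as the determinant whose first column is the value
    of phi on each factor; its expansion along this column is
    [wedge_contraction]. *)
Definition annihilation r d (phi : 'cV[F]_d) :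
    'M[F]_(#|increasing r.+1 d|, #|increasing r d|) :=
  \matrix_(I, K) \det (rowsub (incr_fun I) (cons_col phi (colsub (incr_fun K) 1%:M))).

Lemma mul_cons_col r d (A : 'M[F]_(r.+1, d)) phi (B : 'M[F]_(d, r)) :
  A *m cons_col phi B = cons_col (A *m phi) (A *m B).
Proof.
apply/matrixP=> i j; rewrite !mxE; case: unliftP => [j' ->|->];
rewrite ?mxE; apply: eq_bigr => c _; rewrite !mxE ?liftK ?unlift_none //.
Qed.

Lemma mul_cons_row r d d' w (A : 'M[F]_(r, d)) (B : 'M[F]_(d, d')) :
  cons_row w A *m B = cons_row (w *m B) (A *m B).
Proof.
by apply/matrixP=> i j; rewrite !mxE; case E: (unlift 0 i) => [i'|];
rewrite ?mxE; apply: eq_bigr => c _; rewrite !mxE E.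
Qed.

Lemma wedge_creation r d (A : 'M[F]_(r, d)) w :
  wedge A *m creation r w = wedge (cons_row w A).
Proof.
have expand (B : 'M[F]_(r, d)) (J : 'I_#|increasing r.+1 d|) :
    wedge (cons_row w B) 0 J = \sum_b w 0 (incr_fun J b) *
      ((-1) ^+ b * \det (B *m colsub (fun c => incr_fun J (lift b c)) 1%:M)).
  rewrite mxE (expand_det_row _ 0); apply: eq_bigr => b _.
  rewrite !mxE unlift_none; congr (_ * (_ * \det _)).
  by rewrite mulmx_colsub mulmx1; apply/matrixP=> i j; rewrite !mxE liftK.
apply/rowP=> J; rewrite mxE expand.
under eq_bigr do rewrite [creation _ _ _ _]mxE [X in _ * X]expand mulr_sumr.
rewrite exchange_big /=; apply: eq_bigr => b _.
rewrite det_mulmx_wedge !mulr_sumr; apply: eq_bigr => I _.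
rewrite mxE mulrCA; congr (_ * _); rewrite mulrCA; congr (_ * (_ * \det _)).
by rewrite mul_rowsub_mx mul1mx.
Qed.

Lemma wedge_annihilation r d (A : 'M[F]_(r.+1, d)) phi :
  wedge A *m annihilation r phi =
  \row_K \det (A *m cons_col phi (colsub (incr_fun K) 1%:M)).
Proof.
apply/rowP=> K; rewrite !mxE det_mulmx_wedge.
by apply: eq_bigr => I _; rewrite !mxE.
Qed.

Lemma wedge_contraction r d (A : 'M[F]_(r.+1, d)) phi :
  wedge A *m annihilation r phi =
  \sum_(i < r.+1) ((-1) ^+ i * (A *m phi) i 0) *: wedge (row' i A).
Proof.
rewrite wedge_annihilation; apply/rowP=> K; rewrite mxE summxE (expand_det_col _ 0).
apply: eq_bigr => i _; rewrite mul_cons_col !mxE unlift_none /cofactor addn0 mulrA.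
rewrite [(-1) ^+ i * _]mulrC; congr (_ * _ * \det _).
by rewrite mulmx_colsub mulmx1; apply/matrixP=> a b; rewrite !mxE liftK !mxE.
Qed.

Lemma row'0_cons r d w (A : 'M[F]_(r, d)) : row' 0 (cons_row w A) = A.
Proof. by apply/matrixP=> i j; rewrite !mxE liftK. Qed.

Lemma row'S_cons r d w (A : 'M[F]_(r.+1, d)) i :
  row' (lift 0 i) (cons_row w A) = cons_row w (row' i A).
Proof.
apply/matrixP=> a b; rewrite !mxE; case: (unliftP 0 a) => [a' ->|->].
  have -> : lift (lift 0 i) (lift 0 a') = lift 0 (lift i a').
    by apply: val_inj; rewrite /= /bump /= !add1n ltnS addnS.
  by rewrite liftK mxE.
have -> : lift (lift 0 i) 0 = 0 by apply: val_inj.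
by rewrite unlift_none.
Qed.

(** When w phi = 1, contraction with phi is a contracting homotopy for the
    multiplication by w, and conversely. This is the source of all the exact
    sequences used below. *)
Lemma creation_annihilation r d (w : 'rV[F]_d) phi :
  creation r.+1 w *m annihilation r.+1 phi =
  ((w *m phi) 0 0)%:M - annihilation r phi *m creation r w.
Proof.
apply: eq_on_wedges => A; rewrite mulmxBr !mulmxA wedge_creation !wedge_contraction.
rewrite big_ord_recl row'0_cons expr0 mul1r mul_mx_scalar; congr (_ *: _ + _).
  rewrite !mxE; apply: eq_bigr => c _; by rewrite !mxE unlift_none.
rewrite mulmx_suml -sumrN; apply: eq_bigr => i _.
rewrite -scalemxAl wedge_creation row'S_cons -scaleNr; congr (_ *: _).
rewrite -mulNr lift0 exprS mulN1r mul_cons_row; congr (_ * _).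
by rewrite mxE liftK.
Qed.

Lemma creation0_annihilation d (w : 'rV[F]_d) phi :
  creation 0 w *m annihilation 0 phi = ((w *m phi) 0 0)%:M.
Proof.
apply: eq_on_wedges => A; rewrite !mulmxA wedge_creation !wedge_contraction.
rewrite big_ord_recl big_ord0 addr0 row'0_cons expr0 mul1r mul_mx_scalar; congr (_ *: _).
rewrite !mxE; apply: eq_bigr => c _; by rewrite !mxE unlift_none.
Qed.

Lemma det_row_eq r (A : 'M[F]_r) i j : i != j -> row i A = row j A -> \det A = 0.
Proof. by move=> ij /rowP e; apply: (determinant_alternate ij) => l; have := e l; rewrite !mxE. Qed.

Lemma creation_square r d (w : 'rV[F]_d) :
  creation r w *m creation r.+1 w = 0.
Proof.
apply: eq_on_wedges => A; rewrite mulmx0 mulmxA !wedge_creation.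
apply/rowP=> J; rewrite !mxE.
apply: (@det_row_eq _ _ 0 (lift 0 0)) => //.
by apply/rowP=> b; rewrite !mxE liftK !mxE !unlift_none.
Qed.

Lemma annihilation_comp r d (phi psi : 'cV[F]_d) (A : 'M[F]_(r.+2, d)) :
  wedge A *m (annihilation r.+1 phi *m annihilation r psi) =
  \row_K \det (A *m cons_col phi (cons_col psi (colsub (incr_fun K) 1%:M))).
Proof.
rewrite mulmxA wedge_contraction mulmx_suml; apply/rowP=> K; rewrite mxE summxE.
rewrite (expand_det_col _ 0); apply: eq_bigr => i _.
rewrite -scalemxAl wedge_annihilation mxE [(-1) ^+ i * _]mulrC -mulrA [X in _ * (_ * X)]mxE /cofactor addn0.
congr (_ * (_ * _)); first by rewrite mul_cons_col [RHS]mxE unlift_none.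
congr (\det _).
rewrite [in RHS]mul_cons_col row'Esub mul_rowsub_mx.
by apply/matrixP=> a b; rewrite !mxE liftK !mxE.
Qed.

Lemma annihilation_square r d (phi : 'cV[F]_d) :
  annihilation r.+1 phi *m annihilation r phi = 0.
Proof.
apply: eq_on_wedges => A; rewrite annihilation_comp mulmx0; apply/rowP=> K.
rewrite !mxE -det_tr; apply: (@det_row_eq _ _ 0 (lift 0 0)) => //.
apply/rowP=> b; rewrite !mxE; apply: eq_bigr => c _.
by rewrite !mxE liftK !mxE !unlift_none.
Qed.

(** Polarization of [annihilation_square]. *)
Lemma annihilation_anticomm r d (phi psi : 'cV[F]_d) :
  annihilation r.+1 phi *m annihilation r psi =
  - (annihilation r.+1 psi *m annihilation r phi).
Proof.
have ann_lin q c (u v : 'cV[F]_d) :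
    annihilation q (c *: u + v) = c *: annihilation q u + annihilation q v.
  apply: eq_on_wedges => A; rewrite mulmxDr -scalemxAr !wedge_contraction scaler_sumr -big_split.
  apply: eq_bigr => i _; rewrite /= scalerA -scalerDl; congr (_ *: _).
  by rewrite mulmxDr -scalemxAr !mxE mulrDr mulrCA.
apply/eqP; rewrite -addr_eq0; apply/eqP.
have := annihilation_square r (1 *: phi + psi).
rewrite !ann_lin !scale1r mulmxDl !mulmxDr !annihilation_square add0r addr0.
by rewrite addrC.
Qed.

(** The Leibniz rule, with the factor w set apart. *)
Lemma creation_derivation r d (w : 'rV[F]_d) X :
  creation r w *m derivation r.+1 X = derivation r X *m creation r w + creation r (w *m X).
Proof.
apply: eq_on_wedges => A; rewrite mulmxDr !mulmxA !wedge_creation !wedge_derivation.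
rewrite big_ord_recl addrC mulmx_suml; congr (_ + _).
  apply: eq_bigr => i _; rewrite wedge_creation; congr wedge.
  have -> : row (lift 0 i) (cons_row w A) = row i A by apply/rowP=> b; rewrite !mxE liftK.
  apply/matrixP=> a b; rewrite !mxE; case: (unliftP 0 a) => [a' ->|->] //.
    by rewrite (inj_eq lift_inj) !mxE.
congr wedge; have -> : row 0 (cons_row w A) = w by apply/rowP=> b; rewrite !mxE unlift_none.
apply/matrixP=> a b; rewrite !mxE; case: (unliftP 0 a) => [a' ->|->] //.
Qed.

(** A derivation is moved across a contraction at the price of its action on
    the functional: this term vanishes when X phi = 0. *)
Lemma derivation_annihilation r d (phi : 'cV[F]_d) X :
  derivation r.+1 X *m annihilation r phi = annihilation r phi *m derivation r X + annihilation r (X *m phi).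
Proof.
apply: eq_on_wedges => A; rewrite mulmxDr !mulmxA !wedge_contraction !wedge_derivation !mulmx_suml.
under eq_bigr do rewrite wedge_contraction.
rewrite exchange_big /= -big_split; apply: eq_bigr => i _ /=.
rewrite (bigD1_ord i) //= addrC -scalemxAl wedge_derivation scaler_sumr; congr (_ + _).
  apply: eq_bigr => j _; congr (_ *: wedge _).
    congr (_ * _); rewrite !mxE; apply: eq_bigr => c _; rewrite !mxE.
    by rewrite (negPf (neq_lift _ _)).
  have -> : row (lift i j) A = row j (row' i A) by apply/rowP=> b; rewrite !mxE.
  by apply/matrixP=> a b; rewrite !mxE (inj_eq lift_inj).
congr (_ *: wedge _); last first.
  by apply/matrixP=> a b; rewrite !mxE eq_sym (negPf (neq_lift _ _)).
congr (_ * _); rewrite mulmxA -[LHS]mulr1.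
have -> B : (B *m phi) i 0 = (row i B *m phi) 0 0 :> F by rewrite -row_mul !mxE.
by rewrite row_subst mulr1 -!row_mul mxE.
Qed.

End AnticommutationRelations.

(** * Gradings on exterior powers *)

Section Degree.
Variable F : fieldType.

Definition graded m n (dr : 'I_m -> int) (dc : 'I_n -> int) (c : int) (A : 'M[F]_(m, n)) :=
  forall i j, A i j != 0 -> dc j = dr i + c.

Definition raises m n (dr : 'I_m -> int) (dc : 'I_n -> int) (c : int) (A : 'M[F]_(m, n)) :=
  forall i j, A i j != 0 -> dr i + c <= dc j.

Lemma sum_neq0 (I : finType) (P : pred I) (f : I -> F) : \sum_(i | P i) f i != 0 -> exists2 i, P i & f i != 0.
Proof.
move=> nz; apply/exists_inP; apply: contraNT nz => /exists_inPn no.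
by rewrite big1 // => i /no; rewrite negbK => /eqP.
Qed.

Lemma graded_raises m n dr dc c (A : 'M[F]_(m, n)) : graded dr dc c A -> raises dr dc c A.
Proof. by move=> h i j /h ->. Qed.

Lemma raisesW m n dr dc c c' (A : 'M[F]_(m, n)) : c' <= c -> raises dr dc c A -> raises dr dc c' A.
Proof. by move=> le h i j /h; apply: le_trans; rewrite lerD2l. Qed.

Lemma graded_eq c m n dr dc c' (A : 'M[F]_(m, n)) : c = c' -> graded dr dc c A -> graded dr dc c' A.
Proof. by move=> ->. Qed.

Lemma gradedM m n q dr dc de c c' (A : 'M[F]_(m, n)) (B : 'M[F]_(n, q)) :
  graded dr dc c A -> graded dc de c' B -> graded dr de (c + c') (A *m B).
Proof.
move=> hA hB i j; rewrite mxE => /sum_neq0[l _]; rewrite mulf_eq0 negb_or => /andP[/hA e /hB ->].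
by rewrite e addrA.
Qed.

Lemma raisesM m n q dr dc de c c' (A : 'M[F]_(m, n)) (B : 'M[F]_(n, q)) :
  raises dr dc c A -> raises dc de c' B -> raises dr de (c + c') (A *m B).
Proof.
move=> hA hB i j; rewrite mxE => /sum_neq0[l _]; rewrite mulf_eq0 negb_or => /andP[/hA e /hB].
by apply: le_trans; rewrite addrA lerD2r.
Qed.

Lemma add_neq0 (x y : F) : x + y != 0 -> x != 0 \/ y != 0.
Proof. by case: (eqVneq x 0) => [->|]; [rewrite add0r; right | left]. Qed.

Lemma gradedD m n dr dc c (A B : 'M[F]_(m, n)) :
  graded dr dc c A -> graded dr dc c B -> graded dr dc c (A + B).
Proof. by move=> hA hB i j; rewrite mxE => /add_neq0[/hA|/hB]. Qed.

Lemma raisesD m n dr dc c (A B : 'M[F]_(m, n)) :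
  raises dr dc c A -> raises dr dc c B -> raises dr dc c (A + B).
Proof. by move=> hA hB i j; rewrite mxE => /add_neq0[/hA|/hB]. Qed.

Lemma graded0 m n dr dc c : graded dr dc c (0 : 'M[F]_(m, n)).
Proof. by move=> i j; rewrite mxE eqxx. Qed.

Lemma raises0 m n dr dc c : raises dr dc c (0 : 'M[F]_(m, n)).
Proof. by move=> i j; rewrite mxE eqxx. Qed.

Lemma gradedZ m n dr dc c a (A : 'M[F]_(m, n)) : graded dr dc c A -> graded dr dc c (a *: A).
Proof. by move=> hA i j; rewrite mxE mulf_eq0 negb_or => /andP[_ /hA]. Qed.

Lemma raisesZ m n dr dc c a (A : 'M[F]_(m, n)) : raises dr dc c A -> raises dr dc c (a *: A).
Proof. by move=> hA i j; rewrite mxE mulf_eq0 negb_or => /andP[_ /hA]. Qed.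

Lemma graded1 m dr : graded dr dr 0 (1%:M : 'M[F]_m).
Proof. by move=> i j; rewrite mxE; case: (eqVneq i j) => [->|]; rewrite ?addr0 // eqxx. Qed.

Lemma graded_sum m n dr dc c (I : finType) (P : pred I) (f : I -> 'M[F]_(m, n)) :
  (forall i, P i -> graded dr dc c (f i)) -> graded dr dc c (\sum_(i | P i) f i).
Proof. by move=> h; apply: big_ind => //; [apply: graded0 | move=> A B; apply: gradedD]. Qed.

Lemma raises_sum m n dr dc c (I : finType) (P : pred I) (f : I -> 'M[F]_(m, n)) :
  (forall i, P i -> raises dr dc c (f i)) -> raises dr dc c (\sum_(i | P i) f i).
Proof. by move=> h; apply: big_ind => //; [apply: raises0 | move=> A B; apply: raisesD]. Qed.

Lemma gradedX m dr c j (A : 'M[F]_m) : graded dr dr c A -> graded dr dr (c *+ j) (A ^+ j).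
Proof.
move=> h; elim: j => [|j IH]; first by rewrite mulr0n expr0; apply: graded1.
by rewrite mulrS exprS; apply: (gradedM h IH).
Qed.

Lemma det_support r (Q : 'M[F]_r) : \det Q != 0 -> exists s : 'S_r, forall i, Q i (s i) != 0.
Proof.
case/sum_neq0 => s _; rewrite mulf_eq0 negb_or => /andP[_ /prodf_neq0 h].
by exists s => i; apply: h.
Qed.

(** A nonzero term of the Leibniz formula matches the rows with columns of
    the same degrees. *)
Lemma det_graded r (Q : 'M[F]_r) (e f : 'I_r -> int) :
  graded e f 0 Q -> \det Q != 0 -> \sum_i f i = \sum_i e i.
Proof.
move=> h /det_support[s nz]; rewrite (reindex_inj (@perm_inj _ s)) /=.
by apply: eq_bigr => i _; rewrite (h _ _ (nz i)) addr0.
Qed.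

Lemma det_raises r (Q : 'M[F]_r) (e f : 'I_r -> int) :
  raises e f 0 Q -> \det Q != 0 -> \sum_i e i <= \sum_i f i.
Proof.
move=> h /det_support[s nz]; rewrite [leRHS](reindex_inj (@perm_inj _ s)) /=.
by apply: ler_sum => i _; have := h _ _ (nz i); rewrite addr0.
Qed.

Definition incr_deg r d (deg : 'I_d -> int) (I : 'I_#|increasing r d|) : int :=
  \sum_i deg (incr_fun I i).

Lemma wedge_graded r d (deg : 'I_d -> int) (A : 'M[F]_(r, d)) (e : 'I_r -> int) J :
  graded e deg 0 A -> wedge A 0 J != 0 -> incr_deg deg J = \sum_i e i.
Proof.
move=> h; rewrite mxE => /(det_graded (e := e) (f := fun j => deg (incr_fun J j))); apply.
by move=> i j; rewrite mxE; apply: h.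
Qed.

Lemma wedge_raises r d (deg : 'I_d -> int) (A : 'M[F]_(r, d)) (e : 'I_r -> int) J :
  raises e deg 0 A -> wedge A 0 J != 0 -> \sum_i e i <= incr_deg deg J.
Proof.
move=> h; rewrite mxE => /(det_raises (e := e) (f := fun j => deg (incr_fun J j))); apply.
by move=> i j; rewrite mxE; apply: h.
Qed.

Lemma exterior_graded r d d' (dr : 'I_d -> int) (dc : 'I_d' -> int) (B : 'M[F]_(d, d')) :
  graded dr dc 0 B -> graded (incr_deg dr) (incr_deg dc) 0 (exterior r B).
Proof.
move=> h I J; rewrite mxE addr0; apply: wedge_graded => i j.
by rewrite mxE => /h ->.
Qed.

Lemma wedge_subst_graded r d (deg : 'I_d -> int) (A : 'M[F]_(r, d)) (e : 'I_r -> int) i c (v : 'rV[F]_d) J :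
  graded e deg 0 A -> (forall b, v 0 b != 0 -> deg b = e i + c) ->
  wedge (subst_row A i v) 0 J != 0 -> incr_deg deg J = \sum_i e i + c.
Proof.
move=> hA hv /(wedge_graded (e := fun a => e a + (if a == i then c else 0))) ->; last first.
  by move=> a b; rewrite mxE !addr0; case: (a =P i) => [-> /hv|_ /hA ->] //; rewrite !addr0.
by rewrite big_split /= -big_mkcond big_pred1_eq.
Qed.

Lemma derivation_graded r d (deg : 'I_d -> int) c (X : 'M[F]_d) :
  graded deg deg c X -> graded (@incr_deg r _ deg) (incr_deg deg) c (derivation r X).
Proof.
move=> h I J; have -> : derivation r X I J = (wedge (rowsub (incr_fun I) 1%:M) *m derivation r X) 0 J.
  by rewrite wedge_basis -rowE [RHS]mxE.
rewrite wedge_derivation summxE => /sum_neq0[i _].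
apply: wedge_subst_graded => [a b|b].
  by rewrite !mxE addr0; case: (eqVneq (incr_fun I a) b) => [->|]; rewrite ?eqxx.
by rewrite -row_mul mul_rowsub_mx mul1mx !mxE; apply: h.
Qed.

Lemma creation_graded r d (deg : 'I_d -> int) c (w : 'rV[F]_d) :
  (forall b, w 0 b != 0 -> deg b = c) ->
  graded (incr_deg deg) (incr_deg deg) c (creation r w).
Proof.
move=> h I J; rewrite mxE.
move/(wedge_graded (e := fun a => if unlift 0 a is Some a' then deg (incr_fun I a') else c)) => ->.
  rewrite big_ord_recl unlift_none addrC; congr (_ + _).
  by apply: eq_bigr => a _; rewrite liftK.
move=> a b; rewrite mxE; case: (unliftP 0 a) => [a' _|_]; rewrite ?addr0; last exact: h.
by rewrite !mxE; case: (eqVneq (incr_fun I a') b) => [->|]; rewrite ?eqxx.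
Qed.

Lemma annihilation_graded r d (deg : 'I_d -> int) c (phi : 'cV[F]_d) :
  (forall b, phi b 0 != 0 -> deg b = c) ->
  graded (incr_deg deg) (incr_deg deg) (- c) (annihilation r phi).
Proof.
move=> h I K; rewrite mxE => /(det_graded (e := fun i => deg (incr_fun I i))
   (f := fun a => if unlift 0 a is Some a' then deg (incr_fun K a') else c)) e.
apply/eqP; rewrite -subr_eq opprK addrC; apply/eqP; rewrite -[RHS]e.
  rewrite big_ord_recl unlift_none; congr (_ + _).
  by apply: eq_bigr => a _; rewrite liftK.
move=> a b; rewrite !mxE addr0; case: (unliftP 0 b) => [b' _|_]; last by move/h.
by rewrite !mxE; case: (eqVneq (incr_fun I a) (incr_fun K b')) => [->|]; rewrite ?eqxx.
Qed.

(** Multilinearity in all the rows at once: K is the set of the rows taken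
    from B. *)
Lemma wedgeD r d (A B : 'M[F]_(r, d)) :
  wedge (A + B) = \sum_(K : {set 'I_r}) wedge (\matrix_(i, j) if i \in K then B i j else A i j).
Proof.
apply/rowP=> J; rewrite summxE mxE.
under [RHS]eq_bigr do rewrite mxE.
rewrite exchange_big /=; apply: eq_bigr => s _.
rewrite -big_distrr /=; congr (_ * _).
under eq_bigr do rewrite !mxE addrC.
rewrite bigA_distr; apply: eq_bigr => K _.
by apply: eq_bigr => i _; rewrite !mxE.
Qed.

(** The product of the vectors v_i (1 + X) expands over the sets K of
    factors on which X acts. The empty set gives the identity, the
    singletons give the derivation, and any other K raises the degree by
    #|K|, which is at least 2. *)
Lemma exterior_unipotent r d (deg : 'I_d -> int) (X : 'M[F]_d) : graded deg deg 1 X ->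
  exists2 R, raises (@incr_deg r _ deg) (incr_deg deg) 2 R &
    exterior r (1%:M + X) = 1%:M + derivation r X + R.
Proof.
move=> hX.
pose W I (K : {set 'I_r}) : 'rV[F]_#|increasing r d| :=
  wedge (\matrix_(i, j) if i \in K then rowsub (incr_fun I) X i j else rowsub (incr_fun I) 1%:M i j).
exists (\matrix_I \sum_(K : {set 'I_r} | (1 < #|K|)%N) W I K).
  move=> I J; rewrite mxE summxE => /sum_neq0[K K1].
  move/(wedge_raises (deg := deg) (e := fun i => deg (incr_fun I i) + (i \in K)%:Z)) => le.
  apply: (le_trans _ (le _)) => [|a b]; rewrite ?big_split /= ?lerD2l.
    rewrite -(big_morph _ PoszD (erefl _)) lez_nat -[leqRHS]big_mkcond.
    by rewrite sum1_card.
  rewrite mxE addr0; case: (a \in K); rewrite !mxE.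
    by move/hX => ->.
  by case: (eqVneq (incr_fun I a) b) => [->|]; rewrite ?eqxx // addr0.
apply/row_matrixP=> I; rewrite !linearD /= !rowK row1 linearD /= wedgeD -/(W I _).
rewrite (bigID (fun K : {set 'I_r} => (1 < #|K|)%N)) /= addrC; congr (_ + _).
rewrite (bigD1 set0) ?cards0 //=; congr (_ + _).
  rewrite -wedge_basis; congr wedge; apply/matrixP=> a b; by rewrite !mxE inE.
have -> : row I (derivation r X) = wedge (rowsub (incr_fun I) 1%:M) *m derivation r X.
  by rewrite wedge_basis -rowE.
rewrite wedge_derivation.
transitivity (\sum_(K : {set 'I_r} | #|K| == 1%N) W I K).
  apply: eq_bigl => K; rewrite -leqNgt -cards_eq0.
  by case: #|K| => [|[]].
rewrite big_cards1; apply: eq_bigr => i _; congr wedge; rewrite -row_mul mul_rowsub_mx mul1mx.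
by apply/matrixP=> a b; rewrite !mxE inE; case: (a =P i) => [->|].
Qed.

End Degree.

(** * Freeness over a cyclic group of order p as an exactness condition *)

Section Nilpotent.
Variable F : fieldType.

(** The change of basis between the powers of 1 + x and those of x, in terms
    of which freeness is tested. *)
Definition pascal q : 'M[F]_q := \matrix_(i, l) 'C(i, l)%:R.

Lemma pascal_unit q : pascal q \in unitmx.
Proof.
rewrite unitmxE det_trig; last by apply/is_trig_mxP => i j ij; rewrite mxE bin_small.
by rewrite big1 ?unitr1 // => i _; rewrite mxE binn.
Qed.

Lemma exprD1_pascal m q (x : 'M[F]_m) (i : 'I_q) :
  (1%:M + x) ^+ i = \sum_(l < q) pascal q i l *: x ^+ l.
Proof.
rewrite addrC exprD1n (big_ord_widen q (fun l => x ^+ l *+ 'C(i, l))) // big_mkcond.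
apply: eq_bigr => l _ /=; rewrite mxE scaler_nat.
by case: ifP => // /negbT; rewrite -leqNgt => il; rewrite bin_small.
Qed.

Lemma expmxS m (x : 'M[F]_m) i : x *m x ^+ i = x ^+ i.+1.
Proof. by rewrite exprS. Qed.

Lemma expmxSr m (x : 'M[F]_m) i : x ^+ i *m x = x ^+ i.+1.
Proof. by rewrite exprSr. Qed.

Lemma mul_expmxD m q (A : 'M[F]_(q, m)) (x : 'M[F]_m) i j :
  A *m x ^+ i *m x ^+ j = A *m x ^+ (i + j).
Proof. by rewrite exprD -mulmxA. Qed.

Variables (m p : nat) (x : 'M[F]_m).
Hypothesis (p_gt0 : (0 < p)%N) (xp0 : x ^+ p = 0).

Let powE s (b : 'M[F]_(s, m)) (c : 'M[F]_(s, p)) :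
  \sum_(j < s) \sum_(i < p) c j i *: (row j b *m (1%:M + x) ^+ i) =
  \sum_(l < p) (col l (c *m pascal p))^T *m b *m x ^+ l.
Proof.
transitivity (\sum_(j < s) \sum_(l < p) (c *m pascal p) j l *: (row j b *m x ^+ l)).
  apply: eq_bigr => j _.
  under eq_bigr do rewrite exprD1_pascal mulmx_sumr scaler_sumr.
  rewrite exchange_big /=; apply: eq_bigr => l _; rewrite mxE scaler_suml.
  by apply: eq_bigr => i _; rewrite -scalemxAr scalerA.
rewrite exchange_big /=; apply: eq_bigr => l _.
rewrite (mulmx_sum_row _ b) mulmx_suml; apply: eq_bigr => j _.
by rewrite -scalemxAl !mxE.
Qed.

(** Expand v in powers of x over a basis of the free module: x^(p-1) sees
    only the coefficients of x^0, which must therefore vanish. *)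
Lemma cyclic_freeP_exact : cyclic_free p (1%:M + x) ->
  forall v : 'rV_m, v *m x ^+ p.-1 = 0 -> exists w, v = w *m x.
Proof.
case=> s [b uniqb] v vx; have [c [vc _]] := uniqb v.
move: vc; rewrite powE; set d := c *m pascal p => vc.
have d0 : col (Ordinal p_gt0) d = 0.
  have := uniqb 0; case=> c0 [e0 un0].
  (* The coefficients of v x^(p-1) = 0, so that d' = 0 by uniqueness of the
     expansion of the zero vector. *)
  pose d' : 'M[F]_(s, p) := \matrix_(j, i) if i == p.-1 :> nat then d j (Ordinal p_gt0) else 0.
  have eqc : c0 = d' *m invmx (pascal p).
    apply: un0; rewrite powE mulmxKV ?pascal_unit //.
    transitivity (v *m x ^+ p.-1); first by rewrite vx.
    rewrite vc mulmx_suml.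
    have p1 : (p.-1 < p)%N by rewrite prednK.
    rewrite (bigD1 (Ordinal p_gt0)) //= big1 ?addr0.
      rewrite [RHS](bigD1 (Ordinal p1)) //= big1 ?addr0.
        rewrite expr0 mulmx1; congr (_^T *m _ *m _).
        by apply/colP=> j; rewrite !mxE eqxx.
      move=> i ip; have -> : col i d' = 0 by apply/colP=> j; rewrite !mxE ifN.
      by rewrite trmx0 !mul0mx.
    move=> i i0; rewrite mul_expmxD.
    have le : (p <= i + p.-1)%N by move: i0; rewrite -val_eqE /=; lia.
    by rewrite -(subnK le) exprD xp0 mulr0 mulmx0.
  have eqc' : c0 = 0.
    by apply: un0; rewrite powE mul0mx big1 // => l _; rewrite col0 trmx0 !mul0mx.
  have d'0 : d' = 0.
    by rewrite -[d'](mulmxKV (pascal_unit p)) -eqc eqc' mul0mx.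
  apply/colP=> j; have p1 : (p.-1 < p)%N by rewrite prednK.
  by have := congr1 (fun M : 'M_(s, p) => M j (Ordinal p1)) d'0; rewrite !mxE eqxx.
exists (\sum_(l < p) (col l d)^T *m b *m (if l == 0%N :> nat then 0 else x ^+ l.-1)).
rewrite vc mulmx_suml; apply: eq_bigr => l _; case: eqP => [l0|/eqP l0].
  by have -> : l = Ordinal p_gt0 by [apply: val_inj]; rewrite d0 trmx0 !mul0mx.
by rewrite -[RHS]mulmxA; congr (_ *m _); rewrite mulmxE -exprSr prednK ?lt0n.
Qed.

(** Lift through x^(p-1) a linear basis of the image of x^(p-1), which is
    ker x. These lifts span, by induction on the power of x that kills a
    vector; they are independent, since multiplying a relation by decreasing
    powers of x isolates its coefficients one after the other. *)
Lemma cyclic_free_exact :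
  (forall v : 'rV_m, v *m x = 0 -> exists w, v = w *m x ^+ p.-1) ->
  cyclic_free p (1%:M + x).
Proof.
move=> ex; pose s := \rank (x ^+ p.-1); exists s.
pose b := row_base (x ^+ p.-1) *m pinvmx (x ^+ p.-1); exists b.
have bx : b *m x ^+ p.-1 = row_base (x ^+ p.-1) by rewrite mulmxKpV // eq_row_base.
have spans v t : (t <= p)%N -> v *m x ^+ t = 0 ->
    exists d : 'M[F]_(s, p), v = \sum_(l < p) (col l d)^T *m b *m x ^+ l.
  elim: t v => [|t IH] v tp vt.
    exists 0; rewrite big1; last by move=> l _; rewrite col0 trmx0 !mul0mx.
    by move: vt; rewrite expr0 mulmx1.
  have [] := ex (v *m x ^+ t); first by rewrite -mulmxA mulmxE -exprSr.
  move=> w vw; have : (v *m x ^+ t <= row_base (x ^+ p.-1))%MS by rewrite vw eq_row_base submxMl.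
  case/submxP => c; rewrite -bx => vc.
  have pt : (p - t.+1 < p)%N by lia.
  have [] := IH (v - c *m b *m x ^+ (p - t.+1)).
  - exact: ltnW.
  - rewrite mulmxBl vc mul_expmxD mulmxA.
    by rewrite (_ : (p - t.+1 + t = p.-1)%N) ?subrr //; lia.
  move=> d /eqP; rewrite subr_eq => /eqP ->.
  exists (d + \matrix_(j, l) if l == Ordinal pt then c 0 j else 0).
  rewrite (bigD1 (Ordinal pt)) //= [RHS](bigD1 (Ordinal pt)) //= addrAC.
  congr (_ + _).
    rewrite -!mulmxDl; congr (_ *m _ *m _).
    by apply/rowP=> j; rewrite !mxE eqxx.
  apply: eq_bigr => l ne; congr (_ *m _ *m _); apply/rowP=> j.
  by rewrite !mxE (negPf ne) addr0.
have indep (d : 'M[F]_(s, p)) : \sum_(l < p) (col l d)^T *m b *m x ^+ l = 0 -> d = 0.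
  move=> d0; suff col0 t : (t <= p)%N -> forall l : 'I_p, (l < t)%N -> col l d = 0.
    apply/matrixP=> j l; have := col0 p (leqnn p) l (ltn_ord l).
    by move/colP/(_ j); rewrite !mxE.
  elim: t => // t IH tp l; rewrite ltnS leq_eqVlt => /orP[/eqP lt|lt]; last by apply: IH => //; apply: ltnW.
  have := congr1 (fun v => v *m x ^+ (p.-1 - t)) d0; rewrite mul0mx mulmx_suml (bigD1 l) //= big1 ?addr0.
    rewrite mul_expmxD (_ : _ + _ = p.-1)%N; last by lia.
    rewrite -mulmxA bx => /eqP; rewrite (mulmx_free_eq0) ?row_base_free //.
    by move/eqP/(congr1 trmx); rewrite trmxK trmx0.
  move=> i il; have [lti|lei] := ltnP i t; first by rewrite IH ?trmx0 ?mul0mx // ltnW.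
  rewrite mul_expmxD.
  have le : (p <= i + (p.-1 - t))%N by move: il; rewrite -val_eqE /=; lia.
  by rewrite -(subnK le) exprD xp0 mulr0 mulmx0.
move=> v; have [|d vd] := spans v p (leqnn p); first by rewrite xp0 mulmx0.
exists (d *m invmx (pascal p)); split; first by rewrite powE mulmxKV ?pascal_unit.
move=> c'; rewrite powE vd => e; apply/eqP; rewrite -subr_eq0; apply/eqP.
suff : d - c' *m pascal p = 0.
  move=> /(congr1 (mulmx^~ (invmx (pascal p)))).
  by rewrite mul0mx mulmxBl mulmxK ?pascal_unit.
apply: indep; rewrite -[RHS](subrr (\sum_(l < p) (col l d)^T *m b *m x ^+ l)) {2}e -sumrB.
by apply: eq_bigr => l _; rewrite linearB linearB /= !mulmxBl.
Qed.

End Nilpotent.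

(** * Transfer and iterated commutators *)

Section Trace.
Variable F : fieldType.
Variable p : nat.
Hypothesis p_prime : prime p.

(** In characteristic p this is (ad x)^(p-1) h by [transfer_ad], hence, up
    to the factor u^(p-1), the sum of the conjugates of h under the powers
    of u = 1 + x. *)
Definition transfer m (x h : 'M[F]_m) : 'M[F]_m := \sum_(i < p) x ^+ (p.-1 - i) *m h *m x ^+ i.

(** Higman's criterion. On ker x only the last term of the transfer
    survives, so the transfer maps ker x into the image of x^(p-1). As it is
    injective and this image lies in ker x, the two have the same
    dimension. *)
Lemma transfer_exact m (x h : 'M[F]_m) : x ^+ p = 0 ->
  (forall v : 'rV_m, v *m transfer x h = 0 -> v = 0) ->
  forall v : 'rV_m, v *m x = 0 -> exists w, v = w *m x ^+ p.-1.
Proof.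
move=> xp0 inj; set T := transfer x h in inj.
have p_gt0 := prime_gt0 p_prime.
have kerT : kermx x *m T = kermx x *m h *m x ^+ p.-1.
  have p1 : (p.-1 < p)%N by rewrite prednK.
  rewrite mulmx_sumr (bigD1 (Ordinal p1)) //= big1 ?addr0.
    by rewrite subnn expr0 mul1mx mulmxA.
  move=> i ne; have [j ej] : exists j, (p.-1 - i = j.+1)%N.
    by exists (p.-1 - i).-1; move: ne; rewrite -val_eqE /=; have := ltn_ord i; lia.
  by rewrite ej -expmxS !mulmxA mulmx_ker !mul0mx.
have le1 : (kermx x *m T <= x ^+ p.-1)%MS by rewrite kerT submxMl.
have le2 : (x ^+ p.-1 <= kermx x)%MS.
  by apply/sub_kermxP; rewrite expmxSr prednK.
have Tfree : row_free T.
  by apply/row_freeP; exists (invmx T); rewrite mulmxV // -row_free_unit; apply/inj_row_free.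
have rk : \rank (kermx x *m T) = \rank (kermx x) by rewrite mxrankMfree.
move=> v /sub_kermxP vk; apply/submxP; apply: submx_trans vk _.
by rewrite -(geq_leqif (mxrank_leqif_sup le2)) -rk mxrankS.
Qed.

Hypothesis p_char : p \in [pchar F].

Lemma bin_predp (i : nat) : (i < p)%N -> 'C(p.-1, i)%:R = (-1) ^+ i :> F.
Proof.
have p_gt0 := prime_gt0 p_prime.
elim: i => [|i IH] ip; first by rewrite bin0 expr0.
have /eqP : 'C(p, i.+1)%:R = 0 :> F.
  by apply/eqP; rewrite -(dvdn_pcharf p_char) prime_dvd_bin.
rewrite -{1}(prednK p_gt0) binS natrD IH ?(ltnW ip) //.
by rewrite addr_eq0 => /eqP ->; rewrite exprS mulN1r.
Qed.

Definition ad m (x h : 'M[F]_m) := x *m h - h *m x.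

Lemma iter_ad m (x h : 'M[F]_m) n : iter n (ad x) h =
  \sum_(i < n.+1) ((-1) ^+ i *+ 'C(n, i)) *: (x ^+ (n - i) *m h *m x ^+ i).
Proof.
elim: n => [|n IH] /=.
  by rewrite big_ord1 bin0 !expr0 scale1r mulmx1 mul1mx.
rewrite IH /ad mulmx_sumr mulmx_suml big_ord_recl [X in _ - X]big_ord_recr.
rewrite [RHS]big_ord_recl [X in _ = _ + X]big_ord_recr /=.
rewrite /bump /= !bin0 !subn0 !expr0 !scale1r !mulmx1 mulmxA expmxS.
rewrite !add1n !binn !subnn !expr0 !mul1mx -scalemxAl -mulmxA expmxSr.
rewrite opprD !addrA; congr (_ + _); last first.
  by rewrite -scaleNr [(-1) ^+ _.+1]exprS !mulr1n mulN1r.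
rewrite -addrA; congr (_ + _); rewrite -sumrN -big_split; apply: eq_bigr => i _ /=.
rewrite !add1n -scalemxAr -scalemxAl -scaleNr !subSS binS mulrnDr scalerDl.
congr (_ + _).
  congr (_ *: _); rewrite !mulmxA; congr (_ *m _ *m _).
  by rewrite expmxS; congr (_ ^+ _); have := ltn_ord i; lia.
by rewrite -mulmxA expmxSr [(-1) ^+ _.+1]exprS mulN1r mulNrn.
Qed.

(** The binomial coefficients C(p - 1, i) are (-1)^i modulo p. *)
Lemma transfer_ad m (x h : 'M[F]_m) : transfer x h = iter p.-1 (ad x) h.
Proof.
have p_gt0 := prime_gt0 p_prime.
rewrite iter_ad (prednK p_gt0); apply: eq_bigr => i _.
by rewrite -mulr_natr bin_predp // -expr2 sqrr_sign scale1r.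
Qed.

(** Taking derivations preserves commutators, hence iterated ones. *)
Lemma derivation_transfer r d (x a : 'M[F]_d) :
  transfer (derivation r x) (derivation r a) = derivation r (transfer x a).
Proof.
rewrite !transfer_ad; elim: p.-1 => //= n ->.
by rewrite /ad derivation_bracket.
Qed.

End Trace.

(** * Leading terms with respect to the degree *)

Section Leading.
Variable F : fieldType.
Variables (m : nat) (deg : 'I_m -> int).
Implicit Types v w : 'rV[F]_m.

Definition pure c v := forall j, v 0 j != 0 -> deg j = c.
Definition above c v := forall j, v 0 j != 0 -> c <= deg j.
Definition component c v : 'rV[F]_m := \row_j if deg j == c then v 0 j else 0.

Lemma component_pure c v : pure c (component c v).
Proof. by move=> j; rewrite mxE; case: (deg j =P c) => // _; rewrite eqxx. Qed.

Lemma pure_component c v : pure c v -> component c v = v.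
Proof.
move=> h; apply/rowP=> j; rewrite mxE; case: eqP => // ne.
by case: (eqVneq (v 0 j) 0) => // /h.
Qed.

Lemma componentB c v w : component c (v - w) = component c v - component c w.
Proof. by apply/rowP=> j; rewrite !mxE; case: eqP => _ //; rewrite subr0. Qed.

Lemma componentD c v w : component c (v + w) = component c v + component c w.
Proof. by apply/rowP=> j; rewrite !mxE; case: eqP => _ //; rewrite addr0. Qed.

Lemma component_above0 c v : above (c + 1) v -> component c v = 0.
Proof.
move=> h; apply/rowP=> j; rewrite !mxE; case: eqP => // e.
by case: (eqVneq (v 0 j) 0) => // /h; rewrite e; lia.
Qed.

Lemma above_step c v : above c v -> component c v = 0 -> above (c + 1) v.
Proof.
move=> h h0 j nz; have := h j nz; rewrite le_eqVlt => /orP[/eqP e|]; last by lia.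
by have := congr1 (fun u : 'rV_m => u 0 j) h0; rewrite !mxE -e eqxx => z; rewrite z eqxx in nz.
Qed.

Lemma aboveW c c' v : c' <= c -> above c v -> above c' v.
Proof. by move=> le h j /h; apply: le_trans. Qed.

Lemma pure_above c v : pure c v -> above c v.
Proof. by move=> h j /h ->. Qed.

Lemma above0 c : above c (0 : 'rV[F]_m). Proof. by move=> j; rewrite mxE eqxx. Qed.

Lemma aboveD c v w : above c v -> above c w -> above c (v + w).
Proof. by move=> hv hw j; rewrite mxE => /add_neq0[/hv|/hw]. Qed.

Lemma aboveN c v : above c v -> above c (- v).
Proof. by move=> hv j; rewrite mxE oppr_eq0 => /hv. Qed.

Lemma aboveB c v w : above c v -> above c w -> above c (v - w).
Proof. by move=> hv /aboveN; apply: aboveD. Qed.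

Lemma above_raises c c' v (A : 'M[F]_m) : above c v -> raises deg deg c' A -> above (c + c') (v *m A).
Proof.
move=> hv hA j; rewrite mxE => /sum_neq0[i _]; rewrite mulf_eq0 negb_or => /andP[/hv le /hA].
by apply: le_trans; rewrite lerD2r.
Qed.

Lemma component_mul c c' v (A : 'M[F]_m) : graded deg deg c' A ->
  component (c + c') (v *m A) = component c v *m A.
Proof.
move=> hA; apply/rowP=> j; rewrite !mxE; case: ifP => [/eqP e|/negP ne].
  apply: eq_bigr => i _; rewrite !mxE; case: (eqVneq (A i j) 0) => [->|/hA]; first by rewrite !mulr0.
  by rewrite e => /addIr ->; rewrite eqxx.
rewrite big1 // => i _; rewrite !mxE; case: eqP => [e|]; last by rewrite mul0r.
case: (eqVneq (A i j) 0) => [->|/hA]; first by rewrite mulr0.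
by rewrite e => ej; case: ne; apply/eqP.
Qed.

Lemma deg_bounds : exists B : nat, forall j, - B%:Z < deg j < B%:Z.
Proof.
exists (\max_j `|deg j|%N).+1 => j.
have : (`|deg j| <= \max_j `|deg j|)%N by apply: leq_bigmax.
by lia.
Qed.

(** The lowest part of a vector of ker T lies in ker T0, so it vanishes:
    vectors of ker T have arbitrarily large degree. *)
Lemma leading_injective (T T0 T' : 'M[F]_m) :
  T = T0 + T' -> graded deg deg 0 T0 -> raises deg deg 1 T' ->
  (forall v, v *m T0 = 0 -> v = 0) -> forall v, v *m T = 0 -> v = 0.
Proof.
move=> -> h0 h' inj v vT; have [B bB] := deg_bounds.
have up n : above (- B%:Z + n%:Z) v.
  elim: n => [|n IH]; first by move=> j _; have := bB j; lia.
  rewrite -addn1 PoszD addrA; apply: above_step => //; apply: inj.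
  rewrite -(component_mul _ _ h0) addr0; move/eqP: vT; rewrite mulmxDr addr_eq0 => /eqP ->.
  by apply: component_above0; apply/aboveN/above_raises.
apply/rowP=> j; rewrite mxE; apply: contraTeq isT => /(up (B + B)%N).
by have := bB j; lia.
Qed.

Variables (x y R : 'M[F]_m).
Hypotheses (xE : x = y + R) (y1 : graded deg deg 1 y) (R2 : raises deg deg 2 R).

Lemma lead_power n : exists2 Q, raises deg deg (n.+1)%:Z Q & x ^+ n = y ^+ n + Q.
Proof.
elim: n => [|n [Q hQ eQ]]; first by exists 0; rewrite ?addr0 //; apply: raises0.
have hy := graded_raises (gradedX (j := n) y1).
exists (y ^+ n *m R + Q *m x).
  apply: raisesD.
    by apply: raisesW (raisesM hy R2); rewrite natz; lia.
  have hx : raises deg deg 1 x.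
    by rewrite xE; apply: raisesD; [apply: graded_raises | apply: raisesW R2].
  by apply: raisesW (raisesM hQ hx); lia.
by rewrite exprSr eQ mulrDl {1}xE mulrDr -exprSr addrA.
Qed.

Variable p : nat.
Hypotheses (p_gt1 : (1 < p)%N) (xp0 : x ^+ p = 0).

(** y^p is the part of degree p of x^p = 0. *)
Lemma lead_pth_power : y ^+ p = 0.
Proof.
have [Q hQ eQ] := lead_power p; apply/matrixP=> i j; rewrite mxE.
apply/eqP; apply: contraT => nz.
have e := gradedX (j := p) y1 nz; rewrite natz in e.
have : Q i j != 0.
  move/matrixP/(_ i j): eQ; rewrite xp0 !mxE => /esym/eqP; rewrite addr_eq0 => /eqP yQ.
  by rewrite yQ oppr_eq0 in nz.
by move/hQ; rewrite e; lia.
Qed.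

Let p1E : (p.-1%:Z = p%:Z - 1)%R. Proof. by lia. Qed.

Let top : graded deg deg (p%:Z - 1) (y ^+ p.-1).
Proof. by apply: graded_eq (gradedX (j := _) y1); rewrite natz p1E. Qed.

(** A nonzero class of ker y^(p-1) / im y in degree C is lifted to ker
    x^(p-1) / im x. As v y = 0, the vector v x^(p-1) starts in degree C + p,
    where exactness for y allows removing one leading term after the other:
    v x^(p-1) = z x^(p-1) with z of degrees larger than C, and v - z is the
    lift. If v - z = w x, the same reduction below C allows w to start in
    degree C - 1, and the part of degree C of the equation exhibits v as an
    image of y. *)
Lemma nonfree_of_lead (C : int) v :
  (forall c w, c < C \/ C + p%:Z <= c -> pure c w -> w *m y = 0 -> exists u, w = u *m y ^+ p.-1) ->
  pure C v -> v *m y = 0 -> (forall w, v <> w *m y) ->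
  exists2 v', v' *m x ^+ p.-1 = 0 & forall w, v' <> w *m x.
Proof.
move=> H0 pv vy nv; have [B bB] := deg_bounds.
have [Q] := lead_power p.-1; rewrite prednK ?(ltnW p_gt1) // => hQ eQ.
have xtop : raises deg deg (p%:Z - 1) (x ^+ p.-1).
  rewrite eQ; apply: raisesD; first exact: graded_raises top.
  by apply: raisesW hQ; lia.
have x1 : raises deg deg 1 x.
  by rewrite xE; apply: raisesD; [apply: graded_raises | apply: raisesW R2].
have xx u : u *m x ^+ p.-1 *m x = 0.
  by rewrite -mulmxA expmxSr prednK ?(ltnW p_gt1) // xp0 mulmx0.
have H0' c w : c < C \/ C + p%:Z <= c -> pure c w -> w *m y = 0 ->
    exists2 u, pure (c - (p%:Z - 1)) u & w = u *m y ^+ p.-1.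
  move=> hc pw wy; have [u eu] := H0 c w hc pw wy.
  exists (component (c - (p%:Z - 1)) u); first exact: component_pure.
  by rewrite -(component_mul _ _ top) subrK -eu pure_component.
(* When z x has no part of degree c + 1, the lowest part of z is in ker y,
   so that subtracting an element of im x^(p-1) makes z start one degree
   higher. *)
have reduce c z : c < C \/ C + p%:Z <= c -> above c z -> component (c + 1) (z *m x) = 0 ->
    exists2 u, above (c - (p%:Z - 1)) u & above (c + 1) (z - u *m x ^+ p.-1).
  move=> hc az; rewrite {1}xE mulmxDr componentD (component_mul _ _ y1).
  rewrite [X in _ + X]component_above0 ?addr0; last first.
    by apply: aboveW (above_raises az R2); lia.
  move=> /(H0' c _ hc (@component_pure c z))[u pu eu]; exists u; first exact: pure_above.
  apply: above_step.
    apply: aboveB => //; apply: aboveW (above_raises (pure_above pu) xtop); lia.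
  rewrite componentB eQ mulmxDr componentD -[X in component X (u *m y ^+ _)](subrK (p%:Z - 1)).
  rewrite (component_mul _ _ top) (pure_component pu) -eu [component c (u *m Q)]component_above0 ?addr0 ?subrr //.
  by apply: aboveW (above_raises (pure_above pu) hQ); lia.
(* Induction on the number of degrees above M, which is finite. *)
have upper n : forall M z, B%:Z <= M + n%:Z -> C + p%:Z <= M -> above M z -> z *m x = 0 ->
    exists2 u, above (M - (p%:Z - 1)) u & z = u *m x ^+ p.-1.
  elim: n => [|n IH] M z hB hM az zx.
    exists 0; first exact: above0.
    rewrite mul0mx; apply/rowP=> j; rewrite mxE; apply: contraTeq isT => /az.
    by have := bB j; lia.
  have [] := reduce M z _ az; rewrite ?zx.
  - by right.
  - by apply: component_above0 => j; rewrite mxE eqxx.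
  move=> u au au'; have [||//||u' au2 eu'] := IH (M + 1) (z - u *m x ^+ p.-1); try lia.
    by rewrite mulmxBl zx xx subrr.
  exists (u + u'); first by apply: aboveD => //; apply: aboveW au2; lia.
  by rewrite mulmxDl -eu' addrC subrK.
(* Since x^p = 0, the corrections do not change w x. *)
have lower n : forall w, above (C - 1 - n%:Z) w -> above C (w *m x) ->
    exists2 w', above (C - 1) w' & w *m x = w' *m x.
  elim: n => [|n IH] w aw awx; first by exists w => //; rewrite subr0 in aw.
  have [] := reduce (C - 1 - n.+1%:Z) w _ aw; first by left; lia.
    by apply: component_above0; apply: aboveW awx; lia.
  move=> u _ au; have [|| w' aw' ew'] := IH (w - u *m x ^+ p.-1).
  - by apply: aboveW au; lia.
  - by rewrite mulmxBl xx subr0.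
  by exists w' => //; rewrite -ew' mulmxBl xx subr0.
have vtop : v *m y ^+ p.-1 = 0.
  have -> : p.-1 = p.-2.+1 by lia.
  by rewrite -expmxS mulmxA vy mul0mx.
have [||||z az ez] := upper (absz (B%:Z - (C + p%:Z))%R) (C + p%:Z) (v *m x ^+ p.-1); rewrite ?xx //; try lia.
  by rewrite eQ mulmxDr vtop add0r; apply: above_raises (pure_above pv) hQ.
exists (v - z); first by rewrite mulmxBl -ez subrr.
move=> w ew.
have aw : above (C - 1 - (absz (B%:Z + C)%R)%:Z) w by move=> j _; have := bB j; lia.
have awx : above C (w *m x).
  rewrite -ew; apply: aboveB; first exact: pure_above.
  by apply: aboveW az; lia.
have [w' aw' ew'] := lower _ w aw awx.
apply: (nv (component (C - 1) w')).
rewrite -(component_mul _ _ y1) subrK -[v in LHS](pure_component pv).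
have -> : w' *m y = v - z - w' *m R.
  by rewrite ew ew' xE mulmxDr addrK.
rewrite !componentB [component C z]component_above0 ?subr0; last by apply: aboveW az; lia.
rewrite [component C (w' *m R)]component_above0 ?subr0 //.
by apply: aboveW (above_raises aw' R2); lia.
Qed.

End Leading.

Lemma pure_mul (F : fieldType) m n (dr : 'I_m -> int) (dc : 'I_n -> int) c c'
    (v : 'rV[F]_m) (A : 'M[F]_(m, n)) :
  pure dr c v -> graded dr dc c' A -> pure dc (c + c') (v *m A).
Proof.
move=> hv hA j; rewrite mxE => /sum_neq0[i _].
by rewrite mulf_eq0 negb_or => /andP[/hv <- /hA ->].
Qed.

(** * Koszul complexes *)

Section RankOnePerturbation.
Variable F : fieldType.

Lemma creation_is_linear r d : linear (@creation F r d).
Proof.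
move=> c u v; apply: eq_on_wedges => A; rewrite mulmxDr -scalemxAr !wedge_creation.
have E (w : 'rV_d) : cons_row w A = subst_row (cons_row 0 A) 0 w.
  apply/matrixP=> a b; rewrite !mxE; case: (unliftP 0 a) => [a' ->|->] //.
by rewrite (E (_ + _)) (E u) (E v) wedge_lin.
Qed.

HB.instance Definition _ r d := GRing.isLinear.Build F 'rV[F]_d _ _ (@creation F r d) (@creation_is_linear r d).

Lemma creation_anticomm r d (u v : 'rV[F]_d) :
  creation r u *m creation r.+1 v = - (creation r v *m creation r.+1 u).
Proof.
apply/eqP; rewrite -addr_eq0; apply/eqP.
have := creation_square r (u + v).
by rewrite ![creation _ (u + v)]linearD /= mulmxDl !mulmxDr !creation_square add0r addr0.
Qed.

Lemma cons_row_eta r d (A : 'M[F]_(r.+1, d)) : cons_row (row 0 A) (row' 0 A) = A.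
Proof.
by apply/matrixP=> i j; rewrite !mxE; case: (unliftP 0 i) => [i'|] ->; rewrite ?mxE.
Qed.

Lemma creation_exterior r d d' (w : 'rV[F]_d) (B : 'M[F]_(d, d')) :
  creation r w *m exterior r.+1 B = exterior r B *m creation r (w *m B).
Proof.
apply: eq_on_wedges => A; rewrite !mulmxA -wedge_exterior !wedge_creation -wedge_exterior.
by rewrite mul_cons_row.
Qed.

Lemma exterior0 d (B : 'M[F]_d) : exterior 0 B = 1%:M.
Proof.
rewrite -exterior1; apply/matrixP=> I J; rewrite !mxE; congr (\det _).
by apply/matrixP=> [[]].
Qed.

(** A rank one perturbation acts on at most one factor, because w /\ w = 0.
    Induction on r, by the anticommutation relation. *)
Lemma exterior_rank1 r d (phi : 'cV[F]_d) (w : 'rV[F]_d) :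
  exterior r.+1 (1%:M + phi *m w) = 1%:M + annihilation r phi *m creation r w.
Proof.
have expand q (a : 'rV[F]_d) : creation q (a *m (1%:M + phi *m w)) =
    creation q a + (a *m phi) 0 0 *: creation q w.
  by rewrite mulmxDr mulmx1 mulmxA {1}[a *m phi]mx11_scalar mul_scalar_mx linearD linearZ.
elim: r => [|r IH]; apply: eq_on_wedges => A; rewrite -[A]cons_row_eta;
  set a := row 0 A; rewrite -wedge_creation -!mulmxA; congr (_ *m _);
  rewrite creation_exterior expand.
  by rewrite exterior0 mul1mx mulmxDr mulmx1 mulmxA creation0_annihilation mul_scalar_mx.
rewrite [RHS]mulmxDr mulmx1 mulmxA creation_annihilation mulmxBl mul_scalar_mx.
rewrite IH mulmxDl mul1mx -!mulmxA [creation r w *m _]mulmxDr creation_anticomm.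
by rewrite -scalemxAr creation_square scaler0 addr0 mulmxN addrA.
Qed.

End RankOnePerturbation.

(** Let x be an operator of degree 1 on a graded space M and delta an
    operator with [delta, x] = 1. The functional eps is killed by x; its
    kernel S contains the vector e, which is also killed by x, and w0, phi
    are dual to eps, e. Let y be the derivation extending x. The aim is that
    ker y = im y^(p-1) on the exterior powers of S / e, outside a window of
    degrees. Write M_r, S_r, D_r for the r-th exterior powers of M, S,
    S / e. *)
Section Koszul.
Variables (F : fieldType) (p n : nat).
Hypotheses (p_prime : prime p) (p_char : p \in [pchar F]).
Variable deg : 'I_n -> int.
Variables (x delta : 'M[F]_n) (eps phi : 'cV[F]_n) (e w0 : 'rV[F]_n).
Hypotheses (x1 : graded deg deg 1 x) (bracket : delta *m x - x *m delta = 1%:M).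
Hypotheses (x_eps : x *m eps = 0) (e_x : e *m x = 0) (e_eps : e *m eps = 0).
Hypotheses (w0_eps : w0 *m eps = 1%:M) (e_phi : e *m phi = 1%:M) (w0_phi : w0 *m phi = 0).
Hypotheses (eps_deg : forall b, eps b 0 != 0 -> deg b = 0)
  (phi_deg : forall b, phi b 0 != 0 -> deg b = p%:Z - 1)
  (w0_deg : forall b, w0 0 b != 0 -> deg b = 0)
  (e_deg : forall b, e 0 b != 0 -> deg b = p%:Z - 1).

Local Notation P r := 'rV[F]_#|increasing r n|.
Local Notation y := (derivation _ x).
Hypothesis yp0 : forall r, (r < p)%N -> (y : 'M[F]_#|increasing r n|) ^+ p = 0.

Let pureP r (c : int) (v : P r) := pure (incr_deg deg) c v.

Let p_gt0 : (0 < p)%N := prime_gt0 p_prime.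

Let y1 r : graded (@incr_deg r _ deg) (incr_deg deg) 1 y.
Proof. exact: derivation_graded. Qed.

Let yp1 r : graded (@incr_deg r _ deg) (incr_deg deg) (p%:Z - 1) (y ^+ p.-1).
Proof. by apply: graded_eq (gradedX (j := _) (@y1 r)); rewrite natz; lia. Qed.

Let commute_bracket r : (derivation r delta *m y = y *m derivation r delta + r%:R%:M :> 'M[F]__).
Proof.
by apply/eqP; rewrite addrC -subr_eq derivation_bracket bracket derivation1.
Qed.

(** The commutator of D, the derivation extending delta, with y is the
    scalar r. Hence v D^j y^j = r^j j! v on ker y, and the scalar r^(p-1)
    (p-1)! is invertible. *)
Lemma wedge_ker_exact r c (v : P r) : (0 < r < p)%N -> pureP c v -> v *m y = 0 ->
  exists2 u, pureP (c - (p%:Z - 1)) u & v = u *m y ^+ p.-1.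
Proof.
move=> /andP[r_gt0 rp] pv vy; set D := derivation r delta.
have step j : v *m D ^+ j.+1 *m y = (r%:R *+ j.+1) *: (v *m D ^+ j).
  elim: j => [|j IH].
    by rewrite expr1 expr0 mulmx1 -mulmxA commute_bracket mulmxDr mulmxA vy mul0mx add0r mul_mx_scalar.
  rewrite -[D ^+ j.+2]expmxSr mulmxA -(mulmxA _ D) commute_bracket mulmxDr mulmxA IH.
  by rewrite -scalemxAl -mulmxA expmxSr mul_mx_scalar -scalerDl -mulrSr.
have powers j : v *m D ^+ j *m y ^+ j = (r%:R ^+ j *+ j`!) *: v.
  elim: j => [|j IH]; first by rewrite !expr0 !mulmx1 fact0 scale1r.
  rewrite -[y ^+ j.+1]expmxS mulmxA step -scalemxAl IH scalerA; congr (_ *: _).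
  by rewrite factS exprS mulrnAl mulrnAr -mulrnA mulnC.
have nz : r%:R ^+ p.-1 *+ (p.-1)`! != 0 :> F.
  rewrite -mulr_natr mulf_neq0 ?expf_neq0 // -(dvdn_pcharf p_char).
    by rewrite gtnNdvd.
  have : (p.-1 < p)%N by rewrite prednK.
  elim: p.-1 => [_|j IH jp]; first by rewrite gtnNdvd // prime_gt1.
  by rewrite factS Euclid_dvdM // negb_or IH ?(ltnW jp) // gtnNdvd.
pose u := (r%:R ^+ p.-1 *+ (p.-1)`!)^-1 *: (v *m D ^+ p.-1).
have eu : v = u *m y ^+ p.-1 by rewrite -scalemxAl powers scalerA mulVf // scale1r.
exists (component (incr_deg deg) (c - (p%:Z - 1)) u); first exact: component_pure.
by rewrite -(component_mul _ _ (@yp1 r)) subrK -eu pure_component.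
Qed.

(** The relation y^(j+1) D = D y^(j+1) - r (j+1) y^j shows, by induction on
    j, that ker y^(j+1) lies in im y: the divisions by r, 2 r, ..., (p-1) r
    are legitimate. *)
Lemma wedge_kerX_exact r c (v : P r) : (0 < r < p)%N -> pureP c v -> v *m y ^+ p.-1 = 0 ->
  exists2 u, pureP (c - 1) u & v = u *m y.
Proof.
move=> /andP[r_gt0 rp] pv vy; set D := derivation r delta.
have r_nz : r%:R != 0 :> F by rewrite -(dvdn_pcharf p_char) gtnNdvd.
have step j : y ^+ j.+1 *m D = D *m y ^+ j.+1 - (r%:R *+ j.+1) *: y ^+ j.
  elim: j => [|j IH].
    rewrite !expr1 expr0 commute_bracket mulr1n scale_scalar_mx mulr1.
    by rewrite addrK.
  rewrite -[y ^+ j.+2]expmxSr -mulmxA.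
  have -> : y *m D = D *m y - r%:R%:M by rewrite commute_bracket addrK.
  rewrite mulmxBr (mulmxA (y ^+ _)) IH mulmxBl -scalemxAl expmxSr mul_mx_scalar.
  rewrite -expmxSr mulmxA -addrA -opprD -scalerDl -mulrSr.
  by rewrite -!(mulmxA D) !expmxSr.
have im j : (j < p.-1)%N -> forall u : P r, u *m y ^+ j.+1 = 0 -> exists w, u = w *m y.
  elim: j => [|j IH] jp u uy.
    exists (r%:R^-1 *: (u *m D)); rewrite expr1 in uy.
    rewrite -scalemxAl -mulmxA commute_bracket mulmxDr mulmxA uy mul0mx add0r mul_mx_scalar.
    by rewrite scalerA mulVf // scale1r.
  have nz : r%:R *+ j.+2 != 0 :> F.
    rewrite -mulr_natr mulf_neq0 // -(dvdn_pcharf p_char) gtnNdvd //.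
    by move: jp; lia.
  have [||w ew] := IH _ (u *m D *m y - (r%:R *+ j.+2) *: u).
  - exact: ltnW.
  - rewrite mulmxBl -(mulmxA (u *m D)) expmxS -(mulmxA u) -scalemxAl scalemxAr -mulmxBr -step.
    by rewrite mulmxA uy mul0mx.
  exists ((r%:R *+ j.+2)^-1 *: (u *m D - w)).
  rewrite -scalemxAl mulmxBl -ew opprB addrC subrK scalerA mulVf //.
  by rewrite scale1r.
have [||w ew] := im p.-2 _ v.
- by have := prime_gt1 p_prime; lia.
- by rewrite (_ : p.-2.+1 = p.-1) //; have := prime_gt1 p_prime; lia.
exists (component (incr_deg deg) (c - 1) w); first exact: component_pure.
by rewrite -(component_mul _ _ (@y1 r)) subrK -ew pure_component.
Qed.

(** The subspace S_r of M_r, as the kernel of the contraction with eps. *)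
Definition cycle r : P r -> Prop :=
  match r with 0 => fun=> True | r'.+1 => fun v => v *m annihilation r' eps = 0 end.

(** The products of e with a homogeneous element of S_(r-1): the kernel of
    the projection from S_r to D_r. *)
Definition boundary r c : P r -> Prop :=
  match r with
  | 0 => fun v => v = 0
  | r'.+1 => fun v => exists u, [/\ cycle u, pureP (c - (p%:Z - 1)) u & v = u *m creation r' e]
  end.

Lemma cycleB r (u v : P r) : cycle u -> cycle v -> cycle (u - v).
Proof. by case: r u v => //= r u v eu ev; rewrite mulmxBl eu ev subrr. Qed.

Lemma y_annihilation r : (y : 'M[F]_#|increasing r.+1 n|) *m annihilation r eps = annihilation r eps *m y.
Proof.
rewrite derivation_annihilation x_eps (_ : annihilation r 0 = 0) ?addr0 //.
apply: eq_on_wedges => A; rewrite mulmx0 wedge_contraction big1 // => i _.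
by rewrite mulmx0 mxE mulr0 scale0r.
Qed.

Lemma y_creation r : creation r e *m y = y *m creation r e.
Proof. by rewrite creation_derivation e_x [creation _ 0]linear0 addr0. Qed.

Lemma cycle_y r (v : P r) : cycle v -> cycle (v *m y).
Proof. by case: r v => //= r v vS; rewrite -mulmxA y_annihilation mulmxA vS mul0mx. Qed.

Lemma cycle_yX r (v : P r) j : cycle v -> cycle (v *m y ^+ j).
Proof.
move=> vS; elim: j => [|j IH]; first by rewrite expr0 mulmx1.
by rewrite -expmxSr mulmxA; apply: cycle_y.
Qed.

Lemma creation_yX r (v : P r) j : v *m creation r e *m y ^+ j = v *m y ^+ j *m creation r e.
Proof.
elim: j => [|j IH]; first by rewrite !expr0 !mulmx1.
by rewrite -!expmxSr !mulmxA IH -!mulmxA y_creation.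
Qed.

Lemma annihilation_yX r (v : P r.+1) j :
  v *m y ^+ j *m annihilation r eps = v *m annihilation r eps *m y ^+ j.
Proof.
elim: j => [|j IH]; first by rewrite !expr0 !mulmx1.
by rewrite -!expmxSr !mulmxA -IH -!mulmxA y_annihilation.
Qed.

Lemma cycle_creation r (v : P r) : cycle v -> cycle (v *m creation r e).
Proof.
case: r v => [|r] v vS /=; rewrite -mulmxA.
  by rewrite creation0_annihilation e_eps mxE mul_mx_scalar scale0r.
rewrite creation_annihilation e_eps mxE mulmxBr mul_mx_scalar scale0r.
by rewrite mulmxA vS mul0mx subrr.
Qed.

Lemma cycle_annihilation r (v : P r.+1) : cycle (v *m annihilation r eps).
Proof. by case: r v => //= r v; rewrite -mulmxA annihilation_square mulmx0. Qed.

(** As w0 eps = 1, the multiplication by w0 is a section of the contraction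
    with eps from M_(r+1) onto S_r. *)
Lemma cycle_lift r c (v : P r) : cycle v -> pureP c v ->
  exists2 u, pureP c u & u *m annihilation r eps = v.
Proof.
move=> vS pv; exists (v *m creation r w0).
  by rewrite -[c]addr0; apply: pure_mul pv _; apply: creation_graded.
case: r v vS pv => [|r] v vS pv; rewrite -mulmxA.
  by rewrite creation0_annihilation w0_eps mxE mulmx1.
by rewrite creation_annihilation w0_eps mxE mulmxBr mulmx1 mulmxA vS mul0mx subr0.
Qed.

Lemma pure_annihilation r c (v : P r.+1) : pureP c v -> pureP c (v *m annihilation r eps).
Proof.
move=> pv; rewrite -[c]addr0 -oppr0; apply: pure_mul pv _; exact: annihilation_graded.
Qed.

Lemma pure_creation r c (v : P r) : pureP (c - (p%:Z - 1)) v -> pureP c (v *m creation r e).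
Proof. by move=> pv; rewrite -[c](subrK (p%:Z - 1)); apply: pure_mul pv _; apply: creation_graded. Qed.

Lemma pure_y r c (v : P r) : pureP c v -> pureP (c + 1) (v *m y).
Proof. by move=> pv; apply: pure_mul pv (@y1 r). Qed.

Lemma pure_yp r c (v : P r) : pureP c v -> pureP (c + (p%:Z - 1)) (v *m y ^+ p.-1).
Proof. by move=> pv; apply: pure_mul pv (@yp1 r). Qed.

Lemma pureB r c (u v : P r) : pureP c u -> pureP c v -> pureP c (u - v).
Proof. by move=> hu hv j; rewrite !mxE => /add_neq0[/hu|] //; rewrite oppr_eq0 => /hv. Qed.

Lemma pure0 r c : pureP c (0 : P r).
Proof. by move=> j; rewrite mxE eqxx. Qed.

(** The only degrees in which ker y / im y^(p-1) and ker y^(p-1) / im y may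
    be nonzero on S_r. The connecting maps of the sequence 0 -> S_(r+1) ->
    M_(r+1) -> S_r -> 0 exchange the two cohomology groups; one of them has
    degree p - 1 and the other has degree 1. *)
Fixpoint cohom_deg (r : nat) : int * int :=
  if r is r'.+1 then ((cohom_deg r').2 + (p%:Z - 1), (cohom_deg r').1 + 1) else (0, 0).

Lemma mul_y_yX r (u : P r) : (r < p)%N -> u *m y *m y ^+ p.-1 = 0.
Proof. by move=> rp; rewrite -mulmxA expmxS prednK // yp0 // mulmx0. Qed.

Lemma mul_yX_y r (u : P r) : (r < p)%N -> u *m y ^+ p.-1 *m y = 0.
Proof. by move=> rp; rewrite -mulmxA expmxSr prednK // yp0 // mulmx0. Qed.

(** A diagram chase in the sequence 0 -> S_(r+1) -> M_(r+1) -> S_r -> 0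
    given by the contraction with eps, whose middle term has no cohomology
    by [wedge_ker_exact] and [wedge_kerX_exact]. *)
Lemma cycle_cohomology r : (r < p)%N ->
  (forall c (v : P r), cycle v -> pureP c v -> v *m y = 0 -> c <> (cohom_deg r).1 ->
     exists u, [/\ cycle u, pureP (c - (p%:Z - 1)) u & v = u *m y ^+ p.-1]) /\
  (forall c (v : P r), cycle v -> pureP c v -> v *m y ^+ p.-1 = 0 -> c <> (cohom_deg r).2 ->
     exists u, [/\ cycle u, pureP (c - 1) u & v = u *m y]).
Proof.
elim: r => [|r IH] rp.
  have v0 c (v : P 0) : pureP c v -> c <> 0 -> v = 0.
    move=> pv c0; apply/rowP=> j; rewrite mxE; case: (eqVneq (v 0 j) 0) => // /pv.
    by rewrite /incr_deg big_ord0 => /esym.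
  by split=> c v _ pv _ /(v0 c v pv) ->; exists 0; split; rewrite ?mul0mx //; apply: pure0.
have [IH0 IH1] := IH (ltnW rp); split=> c v vS pv vy hc.
  have [|u pu eu] := wedge_ker_exact _ pv vy; first by rewrite rp.
  have uy : u *m annihilation r eps *m y ^+ p.-1 = 0.
    by rewrite -annihilation_yX -eu.
  have [|u' [u'S pu' eu']] := IH1 _ _ (cycle_annihilation u) (pure_annihilation pu) uy.
    by move=> e1; apply: hc; rewrite /= -e1 subrK.
  have [u2 pu2 eu2] := cycle_lift u'S pu'.
  exists (u - u2 *m y); split.
  - by rewrite /= mulmxBl -mulmxA y_annihilation mulmxA eu2 -eu' subrr.
  - by apply: pureB => //; rewrite -[_ - _](subrK 1); apply: pure_y.
  by rewrite mulmxBl mul_y_yX ?subr0.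
have [|u pu eu] := wedge_kerX_exact _ pv vy; first by rewrite rp.
have uy : u *m annihilation r eps *m y = 0.
  by rewrite -mulmxA -y_annihilation mulmxA -eu.
have [|u' [u'S pu' eu']] := IH0 _ _ (cycle_annihilation u) (pure_annihilation pu) uy.
  by move=> e1; apply: hc; rewrite /= -e1 subrK.
have [u2 pu2 eu2] := cycle_lift u'S pu'.
exists (u - u2 *m y ^+ p.-1); split.
- by rewrite /= mulmxBl annihilation_yX eu2 -eu' subrr.
- by apply: pureB => //; rewrite -[_ - 1](subrK (p%:Z - 1)); apply: pure_yp.
by rewrite mulmxBl mul_yX_y ?subr0.
Qed.

(** As e phi = 1, the contraction with phi is a homotopy, and it preserves
    S_r because contractions anticommute. *)
Lemma creation_exact r c (v : P r) : cycle v -> pureP c v -> v *m creation r e = 0 -> boundary c v.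
Proof.
case: r v => [|r] v vS pv ve /=.
  rewrite -[v]mulmx1 (_ : 1%:M = ((e *m phi) 0 0)%:M); last by rewrite e_phi mxE eqxx.
  by rewrite -creation0_annihilation mulmxA ve mul0mx.
exists (v *m annihilation r phi); split.
- case: r v vS pv ve => //= r v vS pv ve.
  by rewrite -mulmxA annihilation_anticomm mulmxN mulmxA vS mul0mx oppr0.
- by apply: pure_mul pv _; apply: annihilation_graded.
have : v *m (creation r.+1 e *m annihilation r.+1 phi) = 0 by rewrite mulmxA ve mul0mx.
by rewrite creation_annihilation e_phi mxE eqxx mulmxBr mulmx1 mulmxA => /eqP; rewrite subr_eq0 => /eqP.
Qed.

(** A diagram chase in the sequence 0 -> D_r -> S_(r+1) -> D_(r+1) -> 0,
    whose first map is the multiplication by e, of degree p - 1. The window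
    of degrees is extended by one at each step. *)
Lemma quotient_cohomology r : (r < p)%N ->
  (forall c (v : P r), cycle v -> pureP c v -> boundary (c + 1) (v *m y) ->
     c < (cohom_deg r).1 - r%:Z \/ (cohom_deg r).1 < c ->
     exists u, [/\ cycle u, pureP (c - (p%:Z - 1)) u & boundary c (v - u *m y ^+ p.-1)]) /\
  (forall c (v : P r), cycle v -> pureP c v -> boundary (c + (p%:Z - 1)) (v *m y ^+ p.-1) ->
     c < (cohom_deg r).2 - r%:Z \/ (cohom_deg r).2 < c ->
     exists u, [/\ cycle u, pureP (c - 1) u & boundary c (v - u *m y)]).
Proof.
elim: r => [|r IH] rp.
  have [H0 H1] := cycle_cohomology rp.
  split=> c v vS pv /= vy hc.
    have [|u [uS pu ->]] := H0 c v vS pv vy; first by move=> c0; rewrite c0 /= in hc; lia.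
    by exists u; rewrite subrr.
  have [|u [uS pu ->]] := H1 c v vS pv vy; first by move=> c0; rewrite c0 /= in hc; lia.
  by exists u; rewrite subrr.
have [H0 H1] := cycle_cohomology rp; have [IH0 IH1] := IH (ltnW rp).
have killed c (u : P r) : boundary c u -> u *m creation r e = 0.
  case: r u {IH IH0 IH1 H0 H1 rp} => [|r] u /=; first by move=> ->; rewrite mul0mx.
  by case=> w [_ _ ->]; rewrite -mulmxA creation_square mulmx0.
split=> c v vS pv [u [uS pu eu]] hc.
  have uy : boundary (c + 1 - (p%:Z - 1) + (p%:Z - 1)) (u *m y ^+ p.-1).
    apply: creation_exact; [exact: cycle_yX | exact: pure_yp |].
    by rewrite -creation_yX -eu mul_y_yX.
  have [|u' [u'S pu' bu']] := IH1 _ u uS pu uy; first by move: hc => /=; lia.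
  have u'e : v *m y = u' *m creation r e *m y.
    apply/eqP; rewrite eu -subr_eq0 -mulmxA y_creation mulmxA -mulmxBl.
    by apply/eqP/(killed _ _ bu').
  have pu'e : pureP c (u' *m creation r e).
    by apply: pure_creation; move: pu'; congr (pureP _ _); lia.
  have [||||z [zS pz ez]] := H0 c (v - u' *m creation r e).
  - by apply: cycleB => //; apply: cycle_creation.
  - exact: pureB.
  - by rewrite mulmxBl u'e subrr.
  - by move=> c0; rewrite c0 /= in hc; lia.
  exists z; split=> //; exists u'; split=> //.
    by move: pu'; congr (pureP _ _); lia.
  by rewrite -ez opprB addrC subrK.
have uy : boundary (c + 1) (u *m y).
  apply: creation_exact; [exact: cycle_y | |].
    by move: pu => /pure_y; congr (pureP _ _); lia.
  by rewrite -mulmxA -y_creation mulmxA -eu mul_yX_y.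
have pu2 : pureP c u by move: pu; congr (pureP _ _); lia.
have [|u' [u'S pu' bu']] := IH0 _ u uS pu2 uy; first by move: hc => /=; lia.
have u'e : v *m y ^+ p.-1 = u' *m creation r e *m y ^+ p.-1.
  apply/eqP; rewrite eu -subr_eq0 creation_yX -mulmxBl.
  by apply/eqP/(killed _ _ bu').
have [||||z [zS pz ez]] := H1 c (v - u' *m creation r e).
- by apply: cycleB => //; apply: cycle_creation.
- by apply: pureB => //; apply: pure_creation.
- by rewrite mulmxBl u'e subrr.
- by move=> c0; rewrite c0 /= in hc; lia.
exists z; split=> //; exists u'; split=> //.
by rewrite -ez opprB addrC subrK.
Qed.

Variables (d : nat) (degD : 'I_d -> int) (U : 'M[F]_(d, n)) (R : 'M[F]_(n, d)).
Hypotheses (UR : U *m R = 1%:M) (U_eps : U *m eps = 0) (e_R : e *m R = 0).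
Hypothesis (RU : R *m U = 1%:M - phi *m e - eps *m w0).
Hypothesis (U_deg : graded degD deg 0 U).

Local Notation yD := (derivation _ (U *m x *m R)).

Lemma exterior_cycle r (v : 'rV[F]_#|increasing r d|) : cycle (v *m exterior r U).
Proof.
case: r v => //= r v; rewrite -mulmxA [X in v *m X](_ : _ = 0) ?mulmx0 //.
apply: eq_on_wedges => A; rewrite mulmx0 mulmxA -wedge_exterior wedge_contraction big1 // => i _.
by rewrite -mulmxA U_eps mulmx0 mxE mulr0 scale0r.
Qed.

Lemma boundary_exterior r c (v : P r) : boundary c v -> v *m exterior r R = 0.
Proof.
case: r v => [|r] v /=; first by move->; rewrite mul0mx.
case=> u [_ _ ->]; rewrite -mulmxA creation_exterior e_R [creation _ 0]linear0.
by rewrite !mulmx0.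
Qed.

Lemma derivation_compress r : exterior r U *m y *m exterior r R = yD.
Proof.
apply: eq_on_wedges => A; rewrite !mulmxA -wedge_exterior !wedge_derivation mulmx_suml.
apply: eq_bigr => i _; rewrite -wedge_exterior subst_row_mul -mulmxA UR mulmx1.
by rewrite row_mul !mulmxA.
Qed.

(** By the formula for R U, passing to the quotient and back modifies v by
    contractions with eps, which vanish on S_r, and by a multiple of e. *)
Lemma cycle_compress r c (v : P r) : cycle v -> pureP c v ->
  boundary c (v - v *m exterior r R *m exterior r U).
Proof.
rewrite -mulmxA -exteriorM.
have -> : R *m U = (1%:M + (- eps) *m w0) *m (1%:M + (- phi) *m e).
  rewrite RU mulmxDl !mul1mx mulmxDr mulmx1 mulmxA -(mulmxA (- eps)) mulmxN w0_phi oppr0 mulmx0 mul0mx addr0.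
  by rewrite !mulNmx.
case: r v => [|r] v vS pv; first by rewrite exterior0 mulmx1 subrr.
rewrite exteriorM mulmxA exterior_rank1 mulmxDr mulmx1.
have annN q (u : 'cV[F]_n) : annihilation q (- u) = - annihilation q u.
  apply: eq_on_wedges => A; rewrite mulmxN !wedge_contraction -sumrN.
  by apply: eq_bigr => i _; rewrite mulmxN mxE mulrN scaleNr.
rewrite annN mulNmx mulmxN mulmxA vS mul0mx subr0 exterior_rank1 annN mulNmx mulmxDr mulmx1.
rewrite mulmxN opprB addrC subrK; exists (v *m annihilation r phi); split.
- case: r v vS {pv} => //= r v vS.
  by rewrite -mulmxA annihilation_anticomm mulmxN mulmxA vS mul0mx oppr0.
- by apply: pure_mul pv _; apply: annihilation_graded.
by rewrite mulmxA.
Qed.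

Lemma cycle_commute r (v : P r) : cycle v ->
  (forall c, pureP c v -> v *m y *m exterior r R = v *m exterior r R *m yD).
Proof.
move=> vS c pv; have b := cycle_compress vS pv.
have : (v - v *m exterior r R *m exterior r U) *m y *m exterior r R = 0.
  case: r v vS pv b => [|r] v vS pv /=; first by move=> ->; rewrite !mul0mx.
  case=> u [_ _ ->]; rewrite -(mulmxA u) y_creation -!mulmxA creation_exterior e_R.
  by rewrite [creation _ 0]linear0 !mulmx0.
rewrite !mulmxBl => /eqP; rewrite subr_eq0 => /eqP ->.
by rewrite -derivation_compress !mulmxA.
Qed.

Lemma cycle_commuteX r c (v : P r) j : cycle v -> pureP c v ->
  v *m y ^+ j *m exterior r R = v *m exterior r R *m yD ^+ j.
Proof.
move=> vS pv; elim: j => [|j IH]; first by rewrite !expr0 !mulmx1.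
have pj : pureP (c + 1 *+ j) (v *m y ^+ j) by apply: pure_mul pv (gradedX (@y1 r)).
rewrite -expmxSr mulmxA (cycle_commute (cycle_yX j vS) pj) IH.
by rewrite -mulmxA expmxSr.
Qed.

(** [quotient_cohomology] in coordinates: the rows of U represent in S a
    basis of S / e, and R is the projection. *)
Lemma exterior_quotient_exact r c (v : 'rV[F]_#|increasing r d|) : (r < p)%N ->
  pure (incr_deg degD) c v -> v *m yD = 0 ->
  c < (cohom_deg r).1 - r%:Z \/ (cohom_deg r).1 < c ->
  exists u, v = u *m yD ^+ p.-1.
Proof.
move=> rp pv vy hc; have [H _] := quotient_cohomology rp.
have pU : pureP c (v *m exterior r U).
  by rewrite -[c]addr0; apply: pure_mul pv (exterior_graded U_deg).
have EUR : exterior r U *m exterior r R = 1%:M by rewrite -exteriorM UR exterior1.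
have [|u [uS pu bu]] := H c _ (exterior_cycle v) pU _ hc.
  rewrite -[v *m _ *m y]subr0 -[X in _ - X](mul0mx _ (exterior r U)) -vy -derivation_compress !mulmxA.
  by apply: cycle_compress; [apply/cycle_y/exterior_cycle | apply: pure_y].
exists (u *m exterior r R); rewrite -(cycle_commuteX _ uS pu).
have /eqP := boundary_exterior bu.
by rewrite mulmxBl subr_eq0 -(mulmxA v) EUR mulmx1 => /eqP.
Qed.

End Koszul.

(** * Operators of order p and derivations extending idempotents *)

Section Frobenius.
Variables (F : fieldType) (p : nat).
Hypotheses (p_prime : prime p) (p_char : p \in [pchar F]).

Lemma mulrn_mx_pchar m n (A : 'M[F]_(m, n)) j : (p %| j)%N -> A *+ j = 0.
Proof. by move=> pj; rewrite -scaler_nat; move: pj; rewrite (dvdn_pcharf p_char) => /eqP ->; rewrite scale0r. Qed.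

Lemma mx_frobeniusD m (x y : 'M[F]_m) : x *m y = y *m x -> (x + y) ^+ p = x ^+ p + y ^+ p.
Proof.
move=> cxy; have p_gt0 := prime_gt0 p_prime.
rewrite exprDn_comm // big_ord_recr subnn expr0 mul1r binn mulr1n /=.
congr (_ + _); rewrite (bigD1 (Ordinal p_gt0)) //= subn0 bin0 expr0 mulr1 mulr1n.
rewrite big1 ?addr0 // => i i0; apply: mulrn_mx_pchar.
by rewrite prime_dvd_bin // ltn_ord lt0n andbT.
Qed.

Lemma mx_exprZn m c (x : 'M[F]_m) j : (c *: x) ^+ j = c ^+ j *: x ^+ j.
Proof.
elim: j => [|j IH]; first by rewrite !expr0 scale1r.
by rewrite -expmxS IH -scalemxAl -scalemxAr scalerA exprS expmxS.
Qed.

Lemma mx_frobenius_sum m (I : finType) (P : pred I) (Z : I -> 'M[F]_m) :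
  (forall i j, Z i *m Z j = Z j *m Z i) -> (forall i, Z i ^+ p = 0) ->
  (\sum_(i | P i) Z i) ^+ p = 0.
Proof.
move=> comZ Zp; have p_gt0 := prime_gt0 p_prime.
suff [] : (\sum_(i | P i) Z i) ^+ p = 0 /\ forall j, (\sum_(i | P i) Z i) *m Z j = Z j *m (\sum_(i | P i) Z i) by [].
split; last by move=> j; rewrite mulmx_suml mulmx_sumr; apply: eq_bigr.
rewrite -big_filter; elim: (filter _ _) => [|i s IH]; first by rewrite big_nil expr0n eqn0Ngt p_gt0.
rewrite big_cons mx_frobeniusD; first by rewrite Zp IH addr0.
by rewrite mulmx_suml mulmx_sumr; apply: eq_bigr.
Qed.

(** On commuting matrices the p-th power is additive, and (g - 1)^p =
    g^p - 1. *)
Lemma unipotent_comb_nilpotent m (I : finType) (G : I -> 'M[F]_m) (alpha : I -> F) :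
  (forall i j, G i *m G j = G j *m G i) -> (forall i, G i ^+ p = 1%:M) ->
  (\sum_i alpha i *: (G i - 1%:M)) ^+ p = 0.
Proof.
move=> comG Gp; apply: mx_frobenius_sum => [i j|i].
  rewrite -!scalemxAl -!scalemxAr !scalerA [alpha i * _]mulrC; congr (_ *: _).
  rewrite !mulmxBl !mulmxBr !mulmx1 !mul1mx comG !opprB ![1%:M - _]addrC !addrA.
  by congr (_ + _); rewrite addrAC.
rewrite mx_exprZn; have : (G i - 1%:M + 1%:M) ^+ p = (G i - 1%:M) ^+ p + 1%:M ^+ p.
  by apply: mx_frobeniusD; rewrite mulmx1 mul1mx.
by rewrite subrK Gp expr1n => /eqP; rewrite eq_sym -subr_eq0 addrK => /eqP ->; rewrite scaler0.
Qed.

(** In a basis of eigenvectors of E the derivation is diagonal, and its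
    eigenvalue on a product of r of them is the number of factors fixed by
    E. This number is at most r < p, and it is not 0 because fewer than r
    vectors of the basis are killed by E. *)
Lemma derivation_idempotent_inj r d (E : 'M[F]_d) : (r < p)%N ->
  E *m E = E -> (\rank (1%:M - E)%R < r)%N ->
  forall v : 'rV_#|increasing r d|, v *m derivation r E = 0 -> v = 0.
Proof.
move=> rp EE rk.
pose B := col_mx (row_base E) (row_base (1%:M - E)%R).
pose D : 'M[F]_(\rank E + \rank (1%:M - E)%R) := block_mx 1%:M 0 0 0.
have BE : D *m B = B *m E.
  rewrite mul_block_col !mul0mx mul1mx !addr0 mul_col_mx; congr col_mx.
    have /submxP[c ->] : (row_base E <= E)%MS by rewrite eq_row_base.
    by rewrite -mulmxA EE.
  have /submxP[c ->] : (row_base (1%:M - E)%R <= (1%:M - E)%R)%MS by rewrite eq_row_base.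
  by rewrite -mulmxA mulmxBl mul1mx EE subrr mulmx0.
have Bfull : row_full B.
  rewrite -sub1mx -[X in (X <= _)%MS](subrK E) /B -addsmxE addmx_sub //.
    by apply: submx_trans (addsmxSr _ _); rewrite eq_row_base.
  by apply: submx_trans (addsmxSl _ _); rewrite eq_row_base.
have BB : exterior r (pinvmx B) *m exterior r B = 1%:M by rewrite -exteriorM mulVpmx // exterior1.
pose c (I : 'I_#|increasing r (\rank E + \rank (1%:M - E)%R)|) : F := (\sum_(i < r) (incr_fun I i < \rank E)%N)%:R.
have rD : derivation r D = diag_mx (\row_I c I).
  apply/row_matrixP=> I; rewrite rowE -wedge_basis wedge_derivation.
  have -> : row I (diag_mx (\row_I c I)) = c I *: wedge (rowsub (incr_fun I) 1%:M).
    by rewrite wedge_basis row_diag_mx mxE.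
  rewrite /c natr_sum scaler_suml; apply: eq_bigr => i _.
  have -> : row i (rowsub (incr_fun I) 1%:M) *m D = (incr_fun I i < \rank E)%N%:R *: row i (rowsub (incr_fun I) 1%:M).
    rewrite -row_mul mul_rowsub_mx mul1mx; apply/rowP=> b; rewrite !mxE.
    case: (splitP (incr_fun I i)) => [a ea|a ea]; rewrite !mxE.
      case: (splitP b) => [b' eb|b' eb]; rewrite ?mxE.
        have -> : (incr_fun I i == b) = (a == b') by rewrite -!val_eqE /= ea eb.
        by rewrite mul1r.
      have -> : (incr_fun I i == b) = false.
        by apply/negP => /eqP e; have := ltn_ord a; move: ea eb; rewrite e => <- ->; lia.
      by rewrite mulr0.
    rewrite mul0r.
    by case: (splitP b) => b' _; rewrite mxE.
  by rewrite wedge_substZ subst_row_id.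
have c_nz I : c I != 0.
  rewrite -(dvdn_pcharf p_char); set s := (\sum_(i < r) _)%N.
  have sr : (s <= r)%N.
    rewrite -[leqRHS]card_ord -sum1_card; apply: leq_sum => i _; by case: (_ < _)%N.
  have s_gt0 : (0 < s)%N.
    rewrite lt0n; apply/negP => /eqP s0.
    have big i : (\rank E <= incr_fun I i)%N.
      move/eqP: s0; rewrite sum_nat_eq0 => /forallP/(_ i) /=.
      by rewrite eqb0 -leqNgt.
    have lt i : (incr_fun I i - \rank E < \rank (1%:M - E)%R)%N.
      by have := ltn_ord (incr_fun I i); have := big i; lia.
    have : injective (fun i => Ordinal (lt i)).
      move=> i j /(congr1 val) /= e; apply: (increasing_inj (enum_valP I)).
      by apply: val_inj; have := big i; have := big j; rewrite /incr_fun in e *; rewrite /=; lia.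
    by move/leq_card; rewrite !card_ord leqNgt rk.
  by rewrite gtnNdvd // (leq_ltn_trans sr).
have Dunit : derivation r D \in unitmx.
  rewrite rD unitmxE det_diag unitfE; apply/prodf_neq0 => I _; by rewrite mxE.
have Efull : row_full (derivation r E).
  apply/row_fullP; exists (exterior r (pinvmx B) *m invmx (derivation r D) *m exterior r B).
  rewrite -mulmxA -(derivation_exterior r BE) !mulmxA mulmxKV //.
move=> v ve; apply/eqP; rewrite -(mulmx_free_eq0 v (B := derivation r E)) ?ve //.
Qed.

End Frobenius.

Section DegreeIdempotent.
Variables (F : fieldType) (p : nat).
Hypothesis p_prime : prime p.
Variables (d : nat) (deg : 'I_d -> int) (x : 'M[F]_d).
Hypothesis deg_range : forall s, 0 <= deg s < p%:Z.
Hypothesis x1 : graded deg deg 1 x.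
Hypothesis x_inj : forall v : 'rV_d, pure deg 0 v -> v *m x ^+ p.-1 = 0 -> v = 0.

Let mask (c : int) : 'M[F]_d := \matrix_(s, t) ((s == t) && (deg s == c))%:R.
Let p_gt0 : (0 < p)%N := prime_gt0 p_prime.

Let maskE c m (A : 'M[F]_(d, m)) s t : (mask c *m A) s t = if deg s == c then A s t else 0.
Proof.
rewrite mxE (bigD1 s) //= mxE eqxx /= big1 ?addr0 => [|i ne].
  by case: eqP => _; rewrite ?mul1r ?mul0r.
by rewrite mxE eq_sym (negPf ne) mul0r.
Qed.

Let Emask c m (A : 'M[F]_(m, d)) s t : (A *m mask c) s t = if deg t == c then A s t else 0.
Proof.
rewrite mxE (bigD1 t) //= mxE eqxx /= big1 ?addr0 => [|i ne].
  by case: eqP => _; rewrite ?mulr1 ?mulr0.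
by rewrite mxE (negPf ne) mulr0.
Qed.

Let mask_x c j : mask c *m x ^+ j = x ^+ j *m mask (c + j%:Z).
Proof.
apply/matrixP=> s t; rewrite maskE Emask.
case: (eqVneq ((x ^+ j) s t) 0) => [->|/(gradedX x1)]; first by case: ifP; case: ifP.
by rewrite natz => ->; rewrite (inj_eq (addIr _)).
Qed.

Let maskM c c' : mask c *m mask c' = if c == c' then mask c else 0.
Proof.
apply/matrixP=> s t; rewrite maskE [mask _ _ _]mxE; case: (eqVneq c c') => [<-|ne]; rewrite ?mxE.
  by case: (eqVneq (deg s) c); rewrite ?andbF.
case: (eqVneq (deg s) c) => // e; case: (deg s =P c'); rewrite ?andbF // => e'.
by case/eqP: ne; rewrite -e -e'.
Qed.

(** When x^(p-1) is injective on degree 0, the degree 0 part generates under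
    x a free module, with a copy of itself in each of the p degrees. If a
    inverts x^(p-1) on that part, then E is an idempotent that is the
    identity on this free module, which bounds the rank of 1 - E. *)
Lemma degree_idempotent : exists a : 'M[F]_d, let E := transfer p x a in
  [/\ graded deg deg (1 - p%:Z) a, E *m E = E &
      (\rank (1%:M - E)%R + p * #|[pred s | deg s == 0]| <= d)%N].
Proof.
pose Y := x ^+ p.-1.
have xp0 j : (p <= j)%N -> x ^+ j = 0.
  move=> pj; apply/matrixP=> s t; rewrite [RHS]mxE; apply/eqP; apply: contraT => /(gradedX x1).
  by rewrite natz; have := deg_range s; have := deg_range t; lia.
have mY c : c != 0 -> mask c *m Y = 0.
  move=> c0; apply/matrixP=> s t; rewrite maskE mxE; case: eqP => // e.
  apply/eqP; apply: contraT => /(gradedX x1).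
  by rewrite natz; have := deg_range s; have := deg_range t; lia.
have kerY (B : 'M[F]_d) : B *m Y = 0 -> B *m mask 0 = 0.
  move=> BY; apply/row_matrixP=> i; rewrite row_mul row0; apply: x_inj.
    move=> j; rewrite Emask; case: (deg j =P 0) => //; by rewrite eqxx.
  have -> : row i B *m mask 0 *m Y = row i B *m Y.
    apply/rowP=> t; rewrite -mulmxA !mxE; apply: eq_bigr => s _; rewrite maskE.
    case: (eqVneq (deg s) 0) => // ne; have := mY _ ne.
    by move/matrixP/(_ s t); rewrite maskE eqxx mxE => ->.
  by rewrite -row_mul BY row0.
pose a := mask (p%:Z - 1) *m pinvmx Y *m mask 0.
have Ya : x ^+ p.-1 *m a = mask 0.
  rewrite -/Y.
  rewrite /a mulmxA (mulmxA Y); have -> : Y *m mask (p%:Z - 1) = Y.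
    apply/matrixP=> s t; rewrite Emask; case: eqP => // ne; apply/esym/eqP; apply: contraT.
    by move=> /(gradedX x1); rewrite natz; have := deg_range s; have := deg_range t; lia.
  apply/eqP; rewrite -subr_eq0 -[X in _ - X]mul1mx -mulmxBl; apply/eqP/kerY.
  by rewrite mulmxBl mulmxKpV // mul1mx subrr.
have a_deg : graded deg deg (1 - p%:Z) a.
  move=> s t; rewrite /a Emask maskE; case: (deg t =P 0) => [->|]; last by rewrite eqxx.
  case: (deg s =P _) => [->|]; last by rewrite eqxx.
  by move=> _; lia.
have am : a *m mask 0 = a by rewrite /a -mulmxA maskM eqxx.
have ma : mask (p%:Z - 1) *m a = a by rewrite /a mulmxA (mulmxA (mask _)) maskM eqxx.
clearbody a; exists a => /=; set E := transfer p x a.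
(* E fixes v x^j for v of degree 0: in the sum, only the term of index j has
   the right degrees to be nonzero. *)
have mxE0 (j : 'I_p) : mask 0 *m x ^+ j *m E = mask 0 *m x ^+ j.
  rewrite mulmx_sumr (bigD1 j) //= big1 ?addr0 => [|i ij].
    rewrite !mulmxA mul_expmxD (_ : (j + (p.-1 - j))%N = p.-1); last by have := ltn_ord j; lia.
    by rewrite -(mulmxA (mask 0)) Ya maskM eqxx.
  rewrite !mulmxA mul_expmxD; have [lt|le] := ltnP i j.
    rewrite xp0 ?mulmx0 ?mul0mx //; have := ltn_ord j; lia.
  rewrite -ma !mulmxA mask_x -(mulmxA (x ^+ _)) maskM ifN ?mulmx0 ?mul0mx //.
  move: ij; rewrite -val_eqE /= => ij.
  by apply/eqP; have := ltn_ord i; lia.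
have EE : E *m E = E.
  rewrite {1}/E /transfer mulmx_suml; apply: eq_bigr => i _.
  by rewrite -{1}am -!mulmxA !(mulmxA (mask 0)) mxE0 !mulmxA -(mulmxA _ a) am.
split=> //.
have sum_mask : \sum_(c < p) mask c%:Z = 1%:M.
  apply/matrixP=> s t; rewrite summxE [RHS]mxE.
  have c_lt : (absz (deg s) < p)%N by have := deg_range s; lia.
  rewrite (bigD1 (Ordinal c_lt)) //= big1 ?addr0 => [|c ne]; rewrite mxE.
    by rewrite (_ : (_ == _ :> int)) ?andbT //; apply/eqP; have := deg_range s; lia.
  rewrite (_ : (deg s == _) = false) ?andbF //; apply/negP => /eqP e.
  by move: ne; rewrite -val_eqE /= e /= eqxx.
pose N c := #|[pred s | deg s == c]|.
have rank_le c : (\rank (mask c) <= N c)%N.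
  have -> : mask c = \sum_(s | deg s == c) delta_mx s s.
    apply/matrixP=> s t; rewrite summxE mxE; case: (eqVneq (deg s) c) => [e|ne].
      rewrite (bigD1 s) ?e //= big1 ?addr0 => [|u /andP[_ ne]].
        by rewrite mxE eqxx andbT eq_sym.
      by rewrite mxE eq_sym (negPf ne).
    rewrite andbF big1 // => u /eqP eu; rewrite mxE; case: (eqVneq s u) => // e.
    by rewrite e eu eqxx in ne.
  rewrite /N -sum1_card; elim/big_rec2: _ => [|s b M _ le]; first by rewrite mxrank0.
  by apply: leq_trans (mxrank_add _ _) _; rewrite mxrank_delta leq_add2l.
have sumN : (\sum_(c < p) N c%:Z = d)%N.
  rewrite /N -[RHS]card_ord -[RHS]sum1_card.
  have part (s : 'I_d) : (absz (deg s) < p)%N by have := deg_range s; lia.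
  rewrite (partition_big (fun s => Ordinal (part s)) xpredT) //=.
  apply: eq_bigr => c _; rewrite -sum1_card; apply: eq_bigl => s; rewrite inE -val_eqE /=.
  by apply/eqP/eqP => [->|<-] //; have := deg_range s; lia.
have sub_sum (B : 'I_p -> 'M[F]_d) : (\rank (\sum_c B c)%R <= \sum_c \rank (B c))%N.
  elim/big_rec2: _ => [|c M b _ le]; first by rewrite mxrank0.
  by apply: (leq_trans (mxrank_add (B c) M)); rewrite leq_add2l.
have rankN (c : 'I_p) : \rank (mask c%:Z) = N c%:Z.
  apply/eqP; rewrite eqn_leq rank_le /=.
  have : (\sum_(i < p) N i%:Z <= \sum_(i < p) \rank (mask i%:Z))%N.
    by rewrite sumN -[leqLHS](mxrank1 F d) -sum_mask; apply: sub_sum.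
  rewrite (bigD1 c) //= [leqRHS](bigD1 c) //= => le.
  have le2 : (\sum_(i < p | i != c) \rank (mask i%:Z) <= \sum_(i < p | i != c) N i%:Z)%N by apply: leq_sum.
  by rewrite -(leq_add2r (\sum_(i < p | i != c) N i%:Z)) (leq_trans le) // leq_add2l.
(* In degree c, 1 - E kills the image of x^c from degree 0, which has the
   dimension of the degree 0 part because a inverts x^(p-1) there. *)
have rank1E (c : 'I_p) : (\rank (mask c%:Z *m (1%:M - E))%R + N 0 <= N c%:Z)%N.
  rewrite -rankN -(mxrank_mul_ker (mask c%:Z) (1%:M - E)) leq_add2l.
  have -> : N 0 = \rank (mask 0) by rewrite -[0]/((Ordinal p_gt0 : 'I_p)%:Z) rankN.
  apply: (@leq_trans (\rank (mask 0 *m x ^+ c))).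
    have {1}-> : mask 0 = mask 0 *m x ^+ c *m (x ^+ (p.-1 - c) *m a).
      rewrite mulmxA mul_expmxD (_ : (c + (p.-1 - c))%N = p.-1); last by have := ltn_ord c; lia.
      by rewrite -mulmxA Ya maskM eqxx.
    by rewrite mxrankM_maxl.
  apply: mxrankS; rewrite sub_capmx; apply/andP; split.
    by rewrite mask_x add0r submxMl.
  by apply/sub_kermxP; rewrite mulmxBr mulmx1 mxE0 subrr.
have le1 : (\rank (1%:M - E)%R <= \sum_(c < p) \rank (mask c%:Z *m (1%:M - E))%R)%N.
  by rewrite -[X in \rank X](mul1mx (1%:M - E)) -sum_mask mulmx_suml; apply: sub_sum.
have le2 : (\sum_(c < p) (\rank (mask c%:Z *m (1%:M - E))%R + N 0) <= \sum_(c < p) N c%:Z)%N.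
  by apply: leq_sum.
rewrite sumN big_split /= sum_nat_const card_ord in le2.
by apply: leq_trans le2; rewrite leq_add2r.
Qed.

End DegreeIdempotent.

(** * Combinations of group elements on exterior powers *)

Section GroupAction.
Variables (F : fieldType) (p : nat).
Hypotheses (p_prime : prime p) (p_char : p \in [pchar F]).
Variables (I : finType) (d : nat) (deg : 'I_d -> int) (X : I -> 'M[F]_d) (alpha : I -> F).
Hypothesis X1 : forall i, graded deg deg 1 (X i).
Local Notation x := (\sum_i alpha i *: X i).

(** The operator u_alpha - 1, when the generator g_i acts by 1 + X_i. *)
Definition group_comb r : 'M[F]_#|increasing r d| :=
  \sum_i alpha i *: (exterior r (1%:M + X i) - 1%:M).

(** Each g_i - 1 has as leading term the derivation extending X_i. *)
Lemma group_comb_lead r : exists2 R, raises (@incr_deg r _ deg) (incr_deg deg) 2 R &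
  group_comb r = derivation r x + R.
Proof.
have [R hR eR] := fin_all_exists2 (fun i => exterior_unipotent r (@X1 i)).
exists (\sum_i alpha i *: R i); first by apply: raises_sum => i _; apply: raisesZ.
rewrite linear_sum -big_split; apply: eq_bigr => i _ /=.
by rewrite linearZ -scalerDr eR -(addrA 1%:M) [1%:M + _]addrC addrK.
Qed.

Lemma comb_graded : graded deg deg 1 x.
Proof. by apply: graded_sum => i _; apply: gradedZ. Qed.

(** Take a and E as in [degree_idempotent]. The transfer for u_alpha - 1 of
    the derivation extending a has as leading term the derivation extending
    E. The inequality on the dimension makes the rank of 1 - E less than r,
    so this leading term is injective, and so is the transfer. *)
Lemma group_comb_exact r : (r < p)%N -> (forall s, 0 <= deg s < p%:Z) ->
  (forall v : 'rV_d, pure deg 0 v -> v *m x ^+ p.-1 = 0 -> v = 0) ->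
  (d < p * #|[pred s | deg s == 0]| + r)%N -> group_comb r ^+ p = 0 ->
  forall v : 'rV_#|increasing r d|, v *m group_comb r = 0 -> exists w, v = w *m group_comb r ^+ p.-1.
Proof.
move=> rp deg_range x_inj dN xp0; have p_gt0 := prime_gt0 p_prime.
have [a [a_deg EE rk]] := degree_idempotent p_prime deg_range comb_graded x_inj.
have [R hR eR] := group_comb_lead r.
apply: (transfer_exact p_prime (h := derivation r a)) => //.
have y1 := derivation_graded (r := r) comb_graded.
have a1 := derivation_graded (r := r) a_deg.
set y := derivation r x in eR y1 *; set h := derivation r a in a1 *.
have [T' hT' eT'] : exists2 T', raises (@incr_deg r _ deg) (incr_deg deg) 1 T' &
    transfer p (group_comb r) h = transfer p y h + T'.
  exists (transfer p (group_comb r) h - transfer p y h); last by rewrite addrC subrK.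
  rewrite -sumrB; apply: raises_sum => i _.
  have [Q hQ ->] := lead_power eR y1 hR (p.-1 - i).
  have [Q' hQ' ->] := lead_power eR y1 hR i.
  have hy j := graded_raises (gradedX (j := j) y1).
  have ha := graded_raises a1.
  have -> : (y ^+ (p.-1 - i) + Q) *m h *m (y ^+ i + Q') - y ^+ (p.-1 - i) *m h *m y ^+ i =
     y ^+ (p.-1 - i) *m h *m Q' + Q *m h *m (y ^+ i + Q').
    by rewrite 2!mulmxDl [y ^+ _ *m h *m _]mulmxDr addrC !addrA addNr add0r.
  have := ltn_ord i => ip.
  apply: raisesD.
    by apply: raisesW (raisesM (raisesM (hy _) ha) hQ'); rewrite natz; lia.
  apply: raisesW (raisesM (raisesM hQ ha) (raisesD (hy i) (raisesW _ hQ'))); rewrite natz; lia.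
apply: (leading_injective eT') hT' _.
  apply: graded_sum => i _; apply: graded_eq (gradedM (gradedM (gradedX y1) a1) (gradedX y1)).
  by rewrite !natz; have := ltn_ord i; lia.
rewrite derivation_transfer //; apply: (derivation_idempotent_inj p_prime p_char rp EE).
by rewrite -(ltn_add2r (p * #|[pred s | deg s == 0]|)) [ltnRHS]addnC; apply: leq_ltn_trans rk dN.
Qed.

End GroupAction.

(** * The natural module and D(1) as sums of shifts *)

(** The point i p + j stands for the vector w_(i,j) = X_i^j w_(i,0): its
    quotient by p is the block and its residue is the degree. *)
Section Blocks.
Variables (F : fieldType) (p k : nat).
Hypotheses (p_prime : prime p) (p_gt2 : (2 < p)%N) (k_ge2 : (1 < k)%N).
Local Notation n := (k * p)%N.

Let p_gt0 : (0 < p)%N := prime_gt0 p_prime.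

Lemma blk_proof (a : 'I_n) : (a %/ p < k)%N.
Proof. by rewrite ltn_divLR. Qed.

Definition blk (a : 'I_n) : 'I_k := Ordinal (blk_proof a).
Definition degM (a : 'I_n) : int := (a %% p)%N%:Z.

Lemma point_proof (i : 'I_k) (j : 'I_p) : (i * p + j < n)%N.
Proof. by rewrite -ltn_divLR // divnMDl // divn_small // addn0. Qed.

Definition point (i : 'I_k) (j : 'I_p) : 'I_n := Ordinal (point_proof i j).

Lemma point_div i j : (point i j %/ p = i)%N.
Proof. by rewrite divnMDl // divn_small // addn0. Qed.

Lemma point_mod i j : (point i j %% p = j)%N.
Proof. by rewrite modnMDl modn_small. Qed.

Lemma blk_point i j : blk (point i j) = i.
Proof. by apply: val_inj; rewrite /= divnMDl // divn_small // addn0. Qed.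

Lemma sum_points (V : nmodType) (f : 'I_n -> V) : \sum_a f a = \sum_i \sum_j f (point i j).
Proof.
rewrite pair_big /= (reindex (fun ij : 'I_k * 'I_p => point ij.1 ij.2)) //=.
exists (fun a => (blk a, Ordinal (ltn_pmod a p_gt0))) => [[i j]|a] _ /=.
  by congr (_, _); [rewrite blk_point | apply: val_inj; rewrite /= modnMDl modn_small].
by apply: val_inj; rewrite /= -divn_eq.
Qed.

Definition block_nilp (i : 'I_k) : 'M[F]_n :=
  \matrix_(a, b) [&& (a %/ p == i)%N, (b == a.+1 :> nat)%N & ((a %% p).+1 < p)%N]%:R.

Lemma modn_succ (a : nat) : ((a %% p).+1 < p)%N -> (a.+1 %% p = (a %% p).+1)%N.
Proof. by move=> lt; rewrite -[in LHS]addn1 -modnDml addn1 modn_small. Qed.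

Lemma divn_succ (a : nat) : ((a %% p).+1 < p)%N -> (a.+1 %/ p = a %/ p)%N.
Proof.
by move=> lt; rewrite {1}(divn_eq a p) -addnS divnMDl // [X in (_ + X)%N]divn_small ?addn0.
Qed.

Lemma block_nilp_graded i : graded degM degM 1 (block_nilp i).
Proof.
move=> a b; rewrite mxE; case: and3P => [[_ /eqP eb lt] _|]; last by rewrite eqxx.
by rewrite /degM eb modn_succ //; lia.
Qed.

Variable alpha : 'I_k -> F.
Local Notation x := (\sum_i alpha i *: block_nilp i).

Lemma comb_entry a b : x a b = if (b == a.+1 :> nat) && ((a %% p).+1 < p)%N then alpha (blk a) else 0.
Proof.
rewrite summxE (bigD1 (blk a)) //= big1 ?addr0 => [|i ne]; rewrite !mxE.
  by rewrite eqxx /=; case: ifP => _; rewrite ?mulr1 ?mulr0.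
by rewrite -val_eqE /= eq_sym in ne; rewrite (negPf ne) /= mulr0.
Qed.

Definition back (m : nat) (b : 'I_n) : 'I_n := Ordinal (leq_ltn_trans (leq_subr m b) (ltn_ord b)).

Lemma back_mod m (b : 'I_n) : (m <= b %% p)%N -> (back m b %% p = b %% p - m)%N.
Proof.
move=> le; rewrite /= {1}(divn_eq b p) -addnBA // modnMDl modn_small //.
by rewrite (leq_ltn_trans (leq_subr _ _)) // ltn_pmod.
Qed.

Lemma back_blk m (b : 'I_n) : (m <= b %% p)%N -> blk (back m b) = blk b.
Proof.
move=> le; apply: val_inj; rewrite /= {1}(divn_eq b p) -addnBA // divnMDl //.
rewrite [X in (_ + X)%N]divn_small ?addn0 //.
by rewrite (leq_ltn_trans (leq_subr _ _)) // ltn_pmod.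
Qed.

Lemma mul_comb_entry (u : 'rV[F]_n) b : (u *m x) 0 b =
  if (0 < b %% p)%N then alpha (blk b) * u 0 (back 1 b) else 0.
Proof.
rewrite mxE; case: ltnP => [b_gt0|b0].
  have b1 : (0 < b)%N by apply: leq_trans b_gt0 (leq_mod _ _).
  rewrite (bigD1 (back 1 b)) //= [X in _ + X]big1 ?addr0 => [|a ne]; rewrite comb_entry.
    rewrite [(back 1 b).+1]/= subn1 prednK // eqxx back_mod // subn1 prednK // ltn_pmod //.
    by rewrite back_blk // mulrC.
  case: eqP => [eb|]; last by rewrite mulr0.
  by case/eqP: ne; apply: val_inj; rewrite /= eb subn1.
rewrite big1 // => a _; rewrite comb_entry; case: andP => [[/eqP eb lt]|]; last by rewrite mulr0.
by move: b0; rewrite eb modn_succ.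
Qed.

Lemma mul_combX_entry (u : 'rV[F]_n) m b : (u *m x ^+ m) 0 b =
  if (m <= b %% p)%N then alpha (blk b) ^+ m * u 0 (back m b) else 0.
Proof.
elim: m b => [|m IH] b.
  rewrite expr0 mulmx1 leq0n mul1r; congr (u 0 _); apply: val_inj; by rewrite /= subn0.
rewrite -expmxSr mulmxA mul_comb_entry; case: ltnP => [b_gt0|b0]; last first.
  by rewrite leqn0 in b0; rewrite (eqP b0).
rewrite IH back_mod // subn1 back_blk // -ltnS prednK //.
case: ifP => _; last by rewrite mulr0.
rewrite mulrA -exprS; congr (_ * u 0 _); apply: val_inj; by rewrite /= -subnDA add1n.
Qed.

(** The sum of the coordinates in the permutation basis, written in the
    basis of the w_(i,j). *)
Definition eps : 'cV[F]_n := \col_a (a %% p == 0)%N%:R.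

(** The all-one vector of the permutation basis, written in the basis of the
    w_(i,j). *)
Definition erow : 'rV[F]_n := \row_a (a %% p == p.-1)%N%:R.

Lemma k_gt0 : (0 < k)%N. Proof. exact: ltnW. Qed.

Definition a0 : 'I_n := point (Ordinal k_gt0) (Ordinal p_gt0).
Lemma predp_proof : (p.-1 < p)%N. Proof. by rewrite prednK. Qed.
Definition a1 : 'I_n := point (Ordinal k_gt0) (Ordinal predp_proof).

(** The vector w0 and the functional phi are dual to eps and to erow; they
    split off the two lines by which S / e differs from the natural
    module. *)
Definition w0 : 'rV[F]_n := delta_mx 0 a0.
Definition phi : 'cV[F]_n := delta_mx a1 0.

Lemma block_nilp_eps i : block_nilp i *m eps = 0.
Proof.
apply/colP=> a; rewrite !mxE big1 // => b _; rewrite !mxE.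
case: and3P => [[_ /eqP -> lt]|]; last by rewrite mul0r.
by rewrite modn_succ // mulr0.
Qed.

Lemma erow_block_nilp i : erow *m block_nilp i = 0.
Proof.
apply/rowP=> b; rewrite !mxE big1 // => a _; rewrite !mxE.
case: eqP => [->|]; last by rewrite mul0r.
by rewrite prednK // ltnn !andbF mulr0.
Qed.

Lemma erow_eps : erow *m eps = 0.
Proof.
apply/rowP=> b; rewrite ord1 !mxE big1 // => a _; rewrite !mxE.
case: eqP => [->|]; last by rewrite mul0r.
by rewrite (_ : (p.-1 == 0)%N = false) ?mulr0 //; lia.
Qed.

Lemma w0_eps : w0 *m eps = 1%:M.
Proof. by rewrite -rowE; apply/rowP=> b; rewrite ord1 !mxE point_mod eqxx. Qed.

Lemma erow_phi : erow *m phi = 1%:M.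
Proof. by rewrite -colE; apply/rowP=> b; rewrite ord1 !mxE point_mod /= !eqxx. Qed.

Lemma w0_phi : w0 *m phi = 0.
Proof.
rewrite -rowE; apply/rowP=> b; rewrite ord1 !mxE -val_eqE /= andbT.
by rewrite (_ : _ == _ = false) //; lia.
Qed.

Lemma comb_eps : x *m eps = 0.
Proof. by rewrite mulmx_suml big1 // => i _; rewrite -scalemxAl block_nilp_eps scaler0. Qed.

Lemma erow_comb : erow *m x = 0.
Proof. by rewrite mulmx_sumr big1 // => i _; rewrite -scalemxAr erow_block_nilp scaler0. Qed.

Definition D_index : {set 'I_n} := [set a | (a != a0) && (a != a1)].
Local Notation d := #|D_index|.
Definition idx (s : 'I_d) : 'I_n := enum_val s.
Definition degD (s : 'I_d) : int := degM (idx s).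

(** D(1) = S / e has a basis indexed by the points other than a0 and a1: the
    class of w_(i,j), with w_(0,0) subtracted in degree 0. The rows of
    [lift_D] are these representatives in S, and [proj_D] is a projection
    that kills e. *)
Definition lift_D : 'M[F]_(d, n) := rowsub idx (1%:M - eps *m w0).
Definition proj_D : 'M[F]_(n, d) := colsub idx (1%:M - phi *m erow).

Lemma a0_a1 : a0 != a1.
Proof. by rewrite -val_eqE /=; lia. Qed.

Lemma eps_w0 a b : (eps *m w0) a b = ((a %% p == 0) && (b == a0))%N%:R.
Proof. by rewrite mxE big_ord1 !mxE -natrM mulnb. Qed.

Lemma phi_erow a b : (phi *m erow) a b = ((a == a1) && (b %% p == p.-1))%N%:R.
Proof. by rewrite mxE big_ord1 !mxE andbT -natrM mulnb. Qed.

Let subE m1 m2 (A B : 'M[F]_(m1, m2)) a b : (A - B) a b = A a b - B a b.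
Proof. by rewrite !mxE. Qed.

Lemma D_card : d = (n - 2)%N.
Proof.
rewrite -[n in RHS]card_ord -(cardC [set a0; a1]) cards2 a0_a1 addKn.
by apply: eq_card => a; rewrite !inE negb_or.
Qed.

Lemma idx_ne s : (idx s != a0) /\ (idx s != a1).
Proof. by have := enum_valP s; rewrite inE => /andP. Qed.

Lemma lift_proj : lift_D *m proj_D = 1%:M.
Proof.
have -> : lift_D *m proj_D = mxsub idx idx ((1%:M - eps *m w0) *m (1%:M - phi *m erow)).
  by apply/matrixP=> s t; rewrite !mxE; apply: eq_bigr => c _; rewrite !mxE.
rewrite mulmxBl mul1mx mulmxBr mulmx1 -(mulmxA eps) (mulmxA w0) w0_phi mul0mx mulmx0 subr0.
apply/matrixP=> s t; rewrite [LHS]mxE !subE phi_erow eps_w0.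
have [ns0 ns1] := idx_ne s; have [nt0 nt1] := idx_ne t.
by rewrite (negPf ns1) (negPf nt0) !mxE !andbF /= !subr0 (inj_eq enum_val_inj).
Qed.

Lemma proj_lift : proj_D *m lift_D = 1%:M - phi *m erow - eps *m w0.
Proof.
have -> : proj_D *m lift_D = (1%:M - phi *m erow) *m (1%:M - eps *m w0).
  apply/matrixP=> a b; rewrite mxE [RHS]mxE.
  rewrite [RHS](bigID (mem D_index)) /= [X in _ + X]big1 ?addr0 => [|c].
    rewrite [RHS]big_enum_val; apply: eq_bigr => s _.
    by rewrite /proj_D /lift_D [colsub _ _ _ _]mxE [rowsub _ _ _ _]mxE.
  rewrite inE negb_and !negbK => /orP[] /eqP ->.
    by rewrite [X in _ * X]subE eps_w0 point_mod eqxx [X in _ * (X - _)]mxE eq_sym subrr mulr0.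
  by rewrite [X in X * _]subE phi_erow point_mod /= eqxx andbT [X in (X - _) * _]mxE subrr mul0r.
rewrite mulmxBl mul1mx mulmxBr mulmx1 -(mulmxA phi) (mulmxA erow) erow_eps mul0mx mulmx0 subr0.
by rewrite addrAC.
Qed.

Lemma lift_eps : lift_D *m eps = 0.
Proof.
by rewrite mul_rowsub_mx mulmxBl mul1mx -mulmxA w0_eps mulmx1 subrr; apply/matrixP=> i j; rewrite !mxE.
Qed.

Lemma erow_proj : erow *m proj_D = 0.
Proof.
by rewrite mulmx_colsub mulmxBr mulmx1 mulmxA erow_phi mul1mx subrr; apply/matrixP=> i j; rewrite !mxE.
Qed.

(** Passing through D(1) changes nothing between vectors of S and
    functionals that kill e. *)
Lemma mul_proj_lift m1 m2 (A : 'M[F]_(m1, n)) (B : 'M[F]_(n, m2)) :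
  A *m eps = 0 -> erow *m B = 0 -> A *m proj_D *m (lift_D *m B) = A *m B.
Proof.
move=> A_eps eB; rewrite mulmxA -(mulmxA A) proj_lift 2!mulmxBr 2!mulmxBl mulmx1.
rewrite (mulmxA _ eps) A_eps !mul0mx subr0.
by rewrite -(mulmxA A) -(mulmxA phi) eB !mulmx0 subr0.
Qed.

Lemma lift_graded : graded degD degM 0 lift_D.
Proof.
move=> s b; rewrite mxE subE eps_w0 mxE addr0.
case: (eqVneq (idx s) b) => [<- //|ne]; rewrite add0r.
case: andP => [[/eqP e /eqP ->] _|_]; last by rewrite oppr0 eqxx.
by rewrite /degD /degM e point_mod.
Qed.

Lemma proj_graded : graded degM degD 0 proj_D.
Proof.
move=> a s; rewrite mxE subE phi_erow mxE addr0.
case: (eqVneq a (idx s)) => [-> //|ne]; rewrite add0r.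
case: andP => [[/eqP -> /eqP e] _|_]; last by rewrite oppr0 eqxx.
by rewrite /degD /degM e point_mod.
Qed.

Definition D_nilp i := lift_D *m block_nilp i *m proj_D.

Lemma D_nilp_graded i : graded degD degD 1 (D_nilp i).
Proof.
have := gradedM (gradedM lift_graded (@block_nilp_graded i)) proj_graded.
by rewrite add0r addr0.
Qed.

Local Notation xD := (\sum_i alpha i *: D_nilp i).

Lemma D_comb_compress : xD = lift_D *m x *m proj_D.
Proof.
rewrite mulmx_sumr mulmx_suml; apply: eq_bigr => i _.
by rewrite -scalemxAr -scalemxAl.
Qed.

Lemma D_combX j : xD ^+ j.+1 = lift_D *m x ^+ j.+1 *m proj_D.
Proof.
elim: j => [|j IH]; first by rewrite !expr1 D_comb_compress.
rewrite -expmxSr IH D_comb_compress -(mulmxA lift_D x) mul_proj_lift.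
- by rewrite -[in RHS]expmxSr !mulmxA.
- by rewrite -mulmxA -expmxSr -(mulmxA (x ^+ j)) comb_eps !mulmx0.
- by rewrite mulmxA erow_comb mul0mx.
Qed.

Lemma graded_nilpotent m (deg : 'I_m -> int) (y : 'M[F]_m) :
  (forall s, 0 <= deg s < p%:Z) -> graded deg deg 1 y -> y ^+ p = 0.
Proof.
move=> deg_range y1; apply/matrixP=> s t; rewrite [RHS]mxE; apply/eqP; apply: contraT => /(gradedX y1).
by rewrite natz; have := deg_range s; have := deg_range t; lia.
Qed.

Lemma degM_range a : 0 <= degM a < p%:Z.
Proof. by rewrite /degM; have := ltn_pmod a p_gt0; lia. Qed.

Lemma degD_range s : 0 <= degD s < p%:Z.
Proof. exact: degM_range. Qed.

Lemma block_nilpM i j : i != j -> block_nilp i *m block_nilp j = 0.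
Proof.
move=> ij; apply/matrixP=> a b; rewrite !mxE big1 // => c _; rewrite !mxE.
case: and3P => [[/eqP ai /eqP ca lt]|]; last by rewrite mul0r.
case: and3P => [[/eqP cj _ _]|]; last by rewrite mulr0.
case/eqP: ij; apply: val_inj; rewrite /= -ai -cj ca.
by rewrite divn_succ.
Qed.

Lemma block_nilp_comm i j : block_nilp i *m block_nilp j = block_nilp j *m block_nilp i.
Proof. by case: (eqVneq i j) => [->//|ij]; rewrite !block_nilpM // eq_sym. Qed.

Lemma D_nilpM i j : D_nilp i *m D_nilp j = lift_D *m (block_nilp i *m block_nilp j) *m proj_D.
Proof.
rewrite /D_nilp -(mulmxA lift_D (block_nilp j)) mul_proj_lift ?mulmxA //.
- by rewrite -mulmxA block_nilp_eps mulmx0.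
- by rewrite erow_block_nilp mul0mx.
Qed.

Lemma D_nilp_comm i j : D_nilp i *m D_nilp j = D_nilp j *m D_nilp i.
Proof. by rewrite !D_nilpM block_nilp_comm. Qed.

Hypothesis p_char : p \in [pchar F].

Lemma exterior_expr r m (A : 'M[F]_m) j : exterior r A ^+ j = exterior r (A ^+ j).
Proof.
elim: j => [|j IH]; first by rewrite !expr0 exterior1.
by rewrite -expmxS IH -exteriorM expmxS.
Qed.

Lemma comb_nilpotent m (deg : 'I_m -> int) (X : 'I_k -> 'M[F]_m) r :
  (forall s, 0 <= deg s < p%:Z) -> (forall i, graded deg deg 1 (X i)) ->
  (forall i j, X i *m X j = X j *m X i) -> group_comb X alpha r ^+ p = 0.
Proof.
move=> deg_range X1 XC; apply: (unipotent_comb_nilpotent p_prime p_char) => [i j|i].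
  rewrite -!exteriorM; congr exterior.
  by rewrite !mulmxDl !mulmxDr !mulmx1 !mul1mx XC addrACA.
rewrite exterior_expr mx_frobeniusD ?mul1mx ?mulmx1 // (graded_nilpotent deg_range (X1 i)) addr0.
by rewrite expr1n exterior1.
Qed.

Lemma D_comb_nilpotent r : group_comb D_nilp alpha r ^+ p = 0.
Proof. exact: comb_nilpotent degD_range D_nilp_graded D_nilp_comm. Qed.

(** It is the leading term of an element of the group algebra whose p-th
    power is zero; the range of degrees on an exterior power would not
    suffice. *)
Lemma derivation_x_nilpotent r : (derivation r x : 'M_#|increasing r n|) ^+ p = 0.
Proof.
have [R hR eR] := group_comb_lead alpha block_nilp_graded r.
have y1 := derivation_graded (r := r) (comb_graded (alpha := alpha) block_nilp_graded).
apply: (lead_pth_power eR y1 hR (ltnW p_gt2)).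
exact: comb_nilpotent degM_range block_nilp_graded block_nilp_comm.
Qed.

(** * Freeness when p_k does not vanish *)

(** The value of p_k at alpha. *)
Definition psum : F := \sum_i (\prod_(j | j != i) alpha j) ^+ p.-1.

(** Let u in S be the sum of the t_i w_(i,0). Then u x^(p-1) is the sum of
    the t_i alpha_i^(p-1) w_(i,p-1), and it vanishes in S / e exactly when
    all the t_i alpha_i^(p-1) have a common value kap. Multiplying the sum
    of the t_i, which is zero, by the product of the alpha_i^(p-1) gives kap
    p_k(alpha) = 0, so that kap = 0. As p_k(alpha) <> 0, at most one alpha_i
    is zero; hence at most one t_i is nonzero, and none is. *)
Lemma D_comb_injective : psum != 0 ->
  forall v : 'rV_d, pure degD 0 v -> v *m xD ^+ p.-1 = 0 -> v = 0.
Proof.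
move=> psum_nz v pv vx.
pose A i := alpha i ^+ p.-1.
have [u [pu u_eps ux vu]] : exists u : 'rV_n,
    [/\ pure degM 0 u, u *m eps = 0, u *m x ^+ p.-1 *m proj_D = 0 & v = u *m proj_D].
  exists (v *m lift_D); split.
  - by rewrite -[0]addr0; apply: pure_mul pv lift_graded.
  - by rewrite -mulmxA lift_eps mulmx0.
  - by rewrite -[RHS]vx (_ : p.-1 = p.-2.+1) ?D_combX ?mulmxA //; lia.
  - by rewrite -mulmxA lift_proj mulmx1.
pose t i := u 0 (point i (Ordinal p_gt0)).
have t_sum : \sum_i t i = 0.
  have : (u *m eps) 0 0 = 0 by rewrite u_eps mxE.
  rewrite mxE sum_points => e; rewrite -[RHS]e; apply: eq_bigr => i _.
  rewrite (bigD1 (Ordinal p_gt0)) //= big1 ?addr0 => [|j j0]; rewrite !mxE point_mod.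
    by rewrite eqxx mulr1.
  by rewrite -val_eqE /= in j0; rewrite (negPf j0) mulr0.
pose z := u *m x ^+ p.-1.
have [kap zk] : exists kap, z = kap *: erow.
  exists ((z *m phi) 0 0).
  have z_proj : z *m proj_D = 0 by [].
  have z_eps : z *m eps = 0.
    by rewrite /z (_ : p.-1 = p.-2.+1) -?expmxSr; [rewrite -!mulmxA comb_eps !mulmx0 | lia].
  have : z *m (proj_D *m lift_D) = 0 by rewrite mulmxA z_proj mul0mx.
  rewrite proj_lift !mulmxBr mulmx1 !mulmxA z_eps mul0mx subr0 => /eqP.
  rewrite subr_eq0 => /eqP {1}->; rewrite {1}[z *m phi]mx11_scalar mul_scalar_mx.
  by [].
have At i : A i * t i = kap.
  have := congr1 (fun w : 'rV_n => w 0 (point i (Ordinal predp_proof))) zk.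
  rewrite /z mul_combX_entry !mxE point_mod leqnn blk_point eqxx mulr1 => <-.
  congr (_ * u 0 _); apply: val_inj; rewrite /= addn0; lia.
have AE i : (\prod_(j | j != i) alpha j) ^+ p.-1 = \prod_(j | j != i) A j by rewrite prodrXl.
have kap0 : kap = 0.
  have : kap * psum = 0.
    have e : (\prod_i A i) * (\sum_i t i) = 0 by rewrite t_sum mulr0.
    rewrite /psum mulr_sumr -[RHS]e mulr_sumr.
    apply: eq_bigr => i _; rewrite AE -(At i) [in RHS](bigD1 i) //=.
    by rewrite mulrAC.
  by move/eqP; rewrite mulf_eq0 (negPf psum_nz) orbF => /eqP.
have t0 i : t i = 0.
  apply/eqP; apply: contraT => ti.
  have Ai : A i = 0.
    by have /eqP := At i; rewrite kap0 mulf_eq0 (negPf ti) orbF => /eqP.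
  have tj j : j != i -> t j = 0.
    move=> ji; apply/eqP; have /eqP := At j; rewrite kap0 mulf_eq0 => /orP[/eqP Aj|//].
    case/eqP: psum_nz; rewrite /psum big1 // => l _; rewrite AE.
    case: (eqVneq l i) => [->|li]; first by rewrite (bigD1 j) //= Aj mul0r.
    by rewrite (bigD1 i) //= ?Ai ?mul0r // eq_sym.
  by move: t_sum; rewrite (bigD1 i) //= big1 ?addr0 // => /eqP; rewrite (negPf ti).
have u0 : u = 0.
  apply/rowP=> b; rewrite mxE; apply/eqP; apply: contraT => nz.
  have := pu _ nz; rewrite /degM => /eqP; rewrite eqz_nat => /eqP b0.
  have eb : b = point (blk b) (Ordinal p_gt0).
    by apply: val_inj; rewrite /= addn0 [LHS](divn_eq b p) b0 addn0.
  by move: nz; rewrite eb -/(t (blk b)) t0 eqxx.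
by rewrite vu u0 mul0mx.
Qed.

Lemma D_degree0_card : (k.-1 <= #|[pred s | degD s == 0]|)%N.
Proof.
have -> : k.-1 = #|[set~ (Ordinal k_gt0 : 'I_k)]| by rewrite cardsC1 card_ord.
pose f i := point i (Ordinal p_gt0).
have f_inj : injective f by move=> i j /(congr1 blk); rewrite !blk_point.
rewrite -(card_imset _ f_inj) -(card_imset _ (@enum_val_inj _ (mem D_index))).
apply: subset_leq_card; apply/subsetP => a /imsetP[i]; rewrite !inE => i0 ->.
have fD : f i \in D_index.
  rewrite inE -!val_eqE /=; apply/andP; split.
    by rewrite !addn0 mul0n muln_eq0 negb_or -[p == 0%N]leqn0 -ltnNge p_gt0 andbT.
  rewrite addn0 mul0n add0n; apply/negP => /eqP e.
  by have := modnMl i p; rewrite e modn_small ?predp_proof //; lia.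
apply/imsetP; exists (enum_rank_in fD (f i)); last by rewrite enum_rankK_in.
by rewrite inE /degD /idx enum_rankK_in // /degM point_mod.
Qed.

(** D(1) has dimension k p - 2 and its degree 0 part has dimension at least
    k - 1, so the part of D(1) on which the idempotent vanishes has
    dimension at most p - 2. *)
Theorem D_exact : psum != 0 ->
  forall v : 'rV_#|increasing p.-1 d|, v *m group_comb D_nilp alpha p.-1 = 0 ->
  exists w, v = w *m group_comb D_nilp alpha p.-1 ^+ p.-1.
Proof.
move=> psum_nz; apply: (group_comb_exact p_prime p_char D_nilp_graded) => //.
- by rewrite predp_proof.
- exact: degD_range.
- exact: D_comb_injective.
- have := D_degree0_card; move: #|[pred s | _]| => N le; rewrite D_card.
  have : (p * k.-1 <= p * N)%N by rewrite leq_mul2l le orbT.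
  have -> : (k * p = p * k.-1 + p)%N by rewrite -mulnSr prednK ?k_gt0 // mulnC.
  by lia.
- exact: D_comb_nilpotent.
Qed.

(** * Failure of freeness when p_k vanishes *)

(** The vector is the product of w_(z1,0) - w_(z2,0) and of the w_(z1,j)
    with 0 < j < p - 1. Every X_i with alpha_i <> 0 kills its factors, and
    also kills the dual functionals, which therefore separate it from the
    image. *)
Lemma D_nonexact_zeros z1 z2 : z1 != z2 -> alpha z1 = 0 -> alpha z2 = 0 ->
  exists2 v : 'rV_#|increasing p.-1 d|, v *m group_comb D_nilp alpha p.-1 ^+ p.-1 = 0 &
    forall w, v <> w *m group_comb D_nilp alpha p.-1.
Proof.
move=> z12 az1 az2.
have lt_p (j : 'I_p.-1) : (j < p)%N by have := ltn_ord j; lia.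
pose pt z (j : 'I_p.-1) := point z (Ordinal (lt_p j)).
(* The factors of the vector and the functionals dual to them. *)
pose AM : 'M[F]_(p.-1, n) := \matrix_(j, b) ((b == pt z1 j)%:R - ((j == 0%N :> nat) && (b == pt z2 j))%:R).
pose CM : 'M[F]_(n, p.-1) := \matrix_(a, j) (a == pt z1 j)%:R.
have AM_nilp i : i != z1 -> i != z2 -> AM *m block_nilp i = 0.
  move=> i1 i2; apply/matrixP=> j b; rewrite !mxE big1 // => a _; rewrite !mxE.
  case: and3P => [[ai _ _]|_]; last by rewrite mulr0.
  have blk_a : blk a = i by apply/val_inj/eqP.
  have -> : (a == pt z1 j) = false by apply/negP => /eqP e; case/eqP: i1; rewrite -blk_a e blk_point.
  have -> : (a == pt z2 j) = false by apply/negP => /eqP e; case/eqP: i2; rewrite -blk_a e blk_point.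
  by rewrite andbF subr0 mul0r.
have nilp_CM i : i != z1 -> block_nilp i *m CM = 0.
  move=> i1; apply/matrixP=> a j; rewrite !mxE big1 // => b _; rewrite !mxE.
  case: and3P => [[/eqP ai /eqP eb lt]|_]; last by rewrite mul0r.
  rewrite mul1r; case: eqP => // e; case/eqP: i1; apply: val_inj.
  rewrite /= -ai -(point_div z1 (Ordinal (lt_p j))) -/(pt z1 j) -e eb.
  by rewrite divn_succ.
have AM_eps : AM *m eps = 0.
  apply/colP=> j; rewrite !mxE.
  under eq_bigr => a _ do rewrite !mxE mulrBl.
  rewrite sumrB (bigD1 (pt z1 j)) // eqxx mul1r point_mod /= big1 ?addr0 => [|a ne]; last by rewrite (negPf ne) mul0r.
  case: eqP => /= [j0|j0]; last by rewrite big1 ?subr0 // => a _; rewrite mul0r.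
  rewrite (bigD1 (pt z2 j)) // eqxx mul1r point_mod /= j0 eqxx big1 ?addr0 ?subrr // => a ne.
  by rewrite (negPf ne) mul0r.
have e_CM : erow *m CM = 0.
  apply/rowP=> j; rewrite !mxE big1 // => a _; rewrite !mxE.
  case: (eqVneq a (pt z1 j)) => [->|]; last by rewrite mulr0.
  by rewrite point_mod /= (_ : (_ == _) = false) ?mul0r //; have := ltn_ord j; lia.
have AM_CM : AM *m CM = 1%:M.
  apply/matrixP=> j l; rewrite !mxE (bigD1 (pt z1 l)) //= big1 ?addr0 => [|a ne]; last first.
    by rewrite [CM _ _]mxE (negPf ne) mulr0.
  rewrite !mxE eqxx mulr1.
  have -> : (pt z1 l == pt z2 j) = false.
    by apply/negP => /eqP /(congr1 blk); rewrite !blk_point => e; case/eqP: z12.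
  rewrite andbF subr0; congr (_%:R); congr nat_of_bool.
  apply/eqP/eqP => [/(congr1 (fun a : 'I_n => a %% p)%N)|->//].
  by rewrite !point_mod => /= e; apply: val_inj.
pose A := AM *m proj_D; pose C := lift_D *m CM.
have AC : A *m C = 1%:M by rewrite mul_proj_lift.
have A_nilp i : i != z1 -> i != z2 -> A *m D_nilp i = 0.
  move=> i1 i2; rewrite /D_nilp -mulmxA mul_proj_lift //; last by rewrite mulmxA erow_block_nilp mul0mx.
  by rewrite mulmxA AM_nilp // mul0mx.
have nilp_C i : i != z1 -> D_nilp i *m C = 0.
  move=> i1; rewrite /D_nilp mul_proj_lift //; last by rewrite -mulmxA block_nilp_eps mulmx0.
  by rewrite -mulmxA nilp_CM // mulmx0.
exists (wedge A).
  have kill j : (0 < j)%N -> wedge A *m group_comb D_nilp alpha p.-1 = 0 ->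
      wedge A *m group_comb D_nilp alpha p.-1 ^+ j = 0.
    by case: j => // j _ A0; rewrite -expmxS mulmxA A0 mul0mx.
  apply: kill; first by lia.
  rewrite mulmx_sumr big1 // => i _; rewrite -scalemxAr.
  case: (eqVneq i z1) => [->|i1]; first by rewrite az1 scale0r.
  case: (eqVneq i z2) => [->|i2]; first by rewrite az2 scale0r.
  by rewrite mulmxBr mulmx1 -wedge_exterior mulmxDr mulmx1 A_nilp // addr0 subrr scaler0.
move=> w /(congr1 (fun u => u *m wedge_col C)); rewrite wedge_pair AC det1 -mulmxA.
rewrite [X in _ = w *m X](_ : _ = 0) ?mulmx0.
  by move/matrixP/(_ 0 0); rewrite !mxE eqxx => /eqP; rewrite oner_eq0.
rewrite mulmx_suml big1 // => i _; rewrite -scalemxAl.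
case: (eqVneq i z1) => [->|i1]; first by rewrite az1 scale0r.
by rewrite mulmxBl mul1mx exterior_wedge_col mulmxDl mul1mx nilp_C // addr0 subrr scaler0.
Qed.

Let entry_col m1 m2 m3 (M : 'M[F]_(m1, m2)) (N : 'M[F]_(m2, m3)) i l :
  (M *m N) i l = (M *m col l N) i 0.
Proof. by rewrite !mxE; apply: eq_bigr => c _; rewrite !mxE. Qed.

(** On each block, minus the derivative with respect to x: w_(i,j) is sent
    to - (j / alpha_i) w_(i,j-1). The truncation at j = p - 1 respects the
    commutation relation because p = 0 in F. *)
Definition lowering : 'M[F]_n :=
  \matrix_(a, b) if (0 < a %% p)%N && (b == back 1 a) then - (a %% p)%N%:R / alpha (blk a) else 0.

Hypothesis alpha_nz : forall i, alpha i != 0.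

Lemma lowering_bracket : lowering *m x - x *m lowering = 1%:M.
Proof.
apply/matrixP=> a c; rewrite subE [RHS]mxE.
have -> : (lowering *m x) a c = - (a %% p)%N%:R * (a == c)%:R.
  rewrite mxE; case: (posnP (a %% p)) => [a0|a_gt0].
    by rewrite a0 oppr0 mul0r big1 // => b _; rewrite mxE a0 mul0r.
  have a1 : (0 < a)%N by apply: leq_trans a_gt0 (leq_mod _ _).
  have pb : ((back 1 a %% p).+1 = a %% p)%N by rewrite back_mod // subn1 prednK.
  rewrite (bigD1 (back 1 a)) //= [X in _ + X]big1 ?addr0 => [|b ne].
    rewrite comb_entry mxE a_gt0 eqxx pb ltn_pmod // andbT back_blk //= subn1 prednK // -val_eqE /= eq_sym.
    by case: eqP => _; rewrite ?mulr0 // divfK // mulr1.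
  by rewrite mxE (negPf ne) andbF mul0r.
have -> : (x *m lowering) a c = - (a %% p).+1%:R * (a == c)%:R.
  rewrite mxE; have [lt|ge] := ltnP (a %% p).+1 p.
    have aS : (a.+1 < n)%N.
      have := point_proof (blk a) (Ordinal lt).
      by rewrite /= addnS -divn_eq.
    rewrite (bigD1 (Ordinal aS)) //= [X in _ + X]big1 ?addr0 => [|b ne].
      rewrite comb_entry /= eqxx lt mxE /= modn_succ //=.
      have -> : back 1 (Ordinal aS) = a by apply: val_inj; rewrite /= subn1.
      have -> : blk (Ordinal aS) = blk a by apply: val_inj; rewrite /= divn_succ.
      rewrite eq_sym; case: eqP => _; last by rewrite !mulr0.
      by rewrite mulrC divfK // mulr1.
    by rewrite comb_entry -val_eqE /= in ne *; rewrite (negPf ne) mul0r.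
  have -> : (a %% p).+1 = p by apply/eqP; rewrite eqn_leq ge ltn_pmod.
  rewrite (pcharf0 p_char) oppr0 mul0r big1 // => b _.
  by rewrite comb_entry ltnNge ge andbF mul0r.
by rewrite -mulrBl opprK -natr1 addKr mul1r.
Qed.

Lemma cohom_deg_even h : cohom_deg p h.*2 = ((h * p)%N%:Z, (h * p)%N%:Z).
Proof.
elim: h => [|h IH] //; rewrite doubleS /= IH /=.
by congr (_, _); lia.
Qed.

(** The top exterior power lies in a single degree, so no operator of
    nonzero degree acts on it. *)
Lemma lower_shift_zero r (N : 'M[F]_r) :
  graded (fun j : 'I_r => (j : nat)%:Z) (fun j : 'I_r => (j : nat)%:Z) 1 N -> derivation r N = 0.
Proof.
move=> N1; apply/matrixP=> I J; rewrite [RHS]mxE; apply/eqP; apply: contraT.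
move/(derivation_graded N1); rewrite /incr_deg.
have sum_id (K : 'I_#|increasing r r|) : \sum_i (incr_fun K i : nat)%:Z = \sum_(i < r) (i : nat)%:Z.
  by rewrite [RHS](reindex_inj (increasing_inj (enum_valP K))).
by rewrite !sum_id; lia.
Qed.

(** The vectors s x^j with j < p - 1 span an x-stable subspace of D(1), on
    whose top exterior power the trace zero operator x acts by zero; so
    their product v is killed by y. The subspace dual to the functionals x^j
    psi is treated in the same way and gives a functional that kills the
    image of y and takes the value 1 on v. Then [nonfree_of_lead] applies in
    the degree c0 of v. *)
Theorem D_nonexact : odd p -> psum = 0 ->
  exists2 v : 'rV_#|increasing p.-1 d|, v *m group_comb D_nilp alpha p.-1 ^+ p.-1 = 0 &
    forall w, v <> w *m group_comb D_nilp alpha p.-1.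
Proof.
move=> p_odd psum0; set r := p.-1.
have inv_sum : \sum_i (alpha i ^+ r)^-1 = 0.
  have : (\prod_i alpha i ^+ r) * \sum_i (alpha i ^+ r)^-1 = 0.
    rewrite mulr_sumr -[RHS]psum0; apply: eq_bigr => i _.
    by rewrite (bigD1 i) //= mulrAC mulfV ?mul1r ?prodrXl // expf_neq0.
  move/eqP; rewrite mulf_eq0 => /orP[|/eqP //].
  by rewrite prodf_seq_eq0 => /hasP[i _]; rewrite expf_eq0 (negPf (alpha_nz i)) andbF.
have lt_p (j : 'I_r) : (j < p)%N by have := ltn_ord j; rewrite /r; lia.
(* Vanishing of p_k(alpha) puts s in S, and s x^(p-1) is the all-one vector,
   which is zero in D(1). *)
pose s : 'rV[F]_n := \row_a (if (a %% p == 0)%N then (alpha (blk a) ^+ r)^-1 else 0).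
have s_eps : s *m eps = 0.
  apply/rowP=> b; rewrite ord1 !mxE sum_points -[RHS]inv_sum; apply: eq_bigr => i _.
  rewrite (bigD1 (Ordinal p_gt0)) //= big1 ?addr0 => [|j j0]; rewrite !mxE point_mod.
    by rewrite eqxx mulr1 blk_point.
  by rewrite -val_eqE /= in j0; rewrite (negPf j0) mulr0.
have sx_eps j : s *m x ^+ j *m eps = 0.
  by case: j => [|j]; rewrite ?expr0 ?mulmx1 // -expmxSr -!mulmxA comb_eps !mulmx0.
have sxr : s *m x ^+ r = erow.
  apply/rowP=> b; rewrite mul_combX_entry !mxE; case: leqP => [le|lt].
    have eb : (b %% p = r)%N by apply/eqP; rewrite eqn_leq le andbT /r -ltnS prednK // ltn_pmod.
    by rewrite back_mod // back_blk // eb subnn !eqxx mulfV // expf_neq0.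
  by rewrite (ltn_eqF lt).
pose i0 := Ordinal k_gt0.
have r1 : (r.-1 < p)%N by rewrite /r; lia.
pose b0 := point i0 (Ordinal r1).
(* The coordinate of w_(0,p-2), scaled so that s x^(p-2) psi = 1; the
   functionals x^(p-2-l) psi are then dual to the s x^l. *)
pose psi : 'cV[F]_n := alpha i0 *: delta_mx b0 0.
have e_psi : erow *m psi = 0.
  rewrite -scalemxAr -colE; apply/rowP=> b; rewrite !mxE point_mod /= (_ : (_ == _) = false) ?mulr0 //.
  by rewrite /r; lia.
have ex_psi j : erow *m (x ^+ j *m psi) = 0.
  by case: j => [|j]; rewrite ?expr0 ?mul1mx // -expmxS !mulmxA erow_comb !mul0mx.
have xr_psi : x ^+ r *m psi = 0.
  rewrite -scalemxAr -colE; apply/colP=> a; rewrite !mxE.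
  have := mul_combX_entry (delta_mx 0 a) r b0; rewrite -rowE mxE => ->.
  by rewrite point_mod /= (_ : (_ <= _)%N = false) ?mulr0 // /r; lia.
pose AM : 'M[F]_(r, n) := \matrix_(j, b) (s *m x ^+ j) 0 b.
pose CM : 'M[F]_(n, r) := \matrix_(a, l) (x ^+ (r.-1 - l) *m psi) a 0.
have rowAM (j : 'I_r) : row j AM = s *m x ^+ j by apply/rowP=> b; rewrite !mxE.
have colCM (l : 'I_r) : col l CM = x ^+ (r.-1 - l) *m psi by apply/colP=> b; rewrite !mxE.
have AM_eps : AM *m eps = 0 by apply/row_matrixP=> j; rewrite row_mul rowAM sx_eps row0.
have e_CM : erow *m CM = 0.
  by apply/rowP=> l; rewrite entry_col colCM ex_psi !mxE.
(* The matrix of x on the rows s x^j, and also on the columns x^(p-2-l)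
   psi. *)
pose N : 'M[F]_r := \matrix_(j, l) (l == j.+1 :> nat)%:R.
pose A := AM *m proj_D; pose B := lift_D *m CM.
have AN : A *m xD = N *m A.
  rewrite D_comb_compress -[lift_D *m x *m _]mulmxA mul_proj_lift //; last by rewrite mulmxA erow_comb mul0mx.
  rewrite /A !mulmxA; apply/row_matrixP=> j; rewrite !row_mul rowAM.
  have [lt|ge] := ltnP j.+1 r.
    have -> : row j N = delta_mx 0 (Ordinal lt).
      by apply/rowP=> l; rewrite !mxE eqxx /= -val_eqE.
    by rewrite -rowE rowAM -expmxSr mulmxA.
  have -> : row j N = 0.
    apply/rowP=> l; rewrite !mxE (_ : (_ == _) = false) //.
    by have := ltn_ord l; lia.
  rewrite !mul0mx -(mulmxA s) expmxSr (_ : j.+1 = r) ?sxr ?erow_proj //.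
  by have := ltn_ord j; lia.
have NB : xD *m B = B *m N.
  rewrite D_comb_compress mul_proj_lift //; last by rewrite -mulmxA comb_eps mulmx0.
  rewrite /B -!mulmxA; congr (_ *m _); apply/matrixP=> a l; rewrite entry_col [RHS]entry_col.
  rewrite colCM -[RHS]entry_col; have [l0|l_gt0] := posnP l.
    rewrite mulmxA expmxS l0 subn0 (_ : r.-1.+1 = r) ?xr_psi; last by rewrite /r; lia.
    rewrite [LHS]mxE mxE big1 // => j _; rewrite [N _ _]mxE l0 mulr0 //.
  have lt : (l.-1 < r)%N by have := ltn_ord l; lia.
  rewrite [RHS]mxE [RHS](bigD1 (Ordinal lt)) //= [X in _ = _ + X]big1 ?addr0 => [|j ne].
    rewrite [N _ _]mxE /= prednK // eqxx mulr1 [CM _ _]mxE /= mulmxA expmxS.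
    by rewrite (_ : (r.-1 - l.-1)%N = (r.-1 - l).+1) //; have := ltn_ord l; lia.
  rewrite [N _ _]mxE (_ : (_ == _) = false) ?mulr0 //; move: ne; rewrite -val_eqE /=; lia.
have AB : A *m B = 1%:M.
  rewrite mul_proj_lift //; apply/matrixP=> j l; rewrite entry_col colCM.
  have -> : (AM *m (x ^+ (r.-1 - l) *m psi)) j 0 = (s *m x ^+ (j + (r.-1 - l)) *m psi) 0 0.
    by rewrite -mul_expmxD -rowAM -mulmxA -row_mul [RHS]mxE.
  have sE c : s 0 c = if (c %% p == 0)%N then (alpha (blk c) ^+ r)^-1 else 0 by rewrite mxE.
  rewrite -scalemxAr -colE [LHS]mxE [col _ _ _ _]mxE mul_combX_entry point_mod blk_point [RHS]mxE.
  change (nat_of_ord (Ordinal r1)) with r.-1.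
  have jr := ltn_ord j; have lr := ltn_ord l.
  case: (eqVneq j l) => [->|ne].
    rewrite (_ : (l + (r.-1 - l))%N = r.-1); last by lia.
    rewrite leqnn sE back_mod ?point_mod // back_blk ?point_mod // blk_point.
    rewrite subnn eqxx mulrA -exprS (_ : r.-1.+1 = r); last by lia.
    by rewrite mulfV // expf_neq0.
  case: leqP => [le|_]; last by rewrite mulr0.
  rewrite sE back_mod ?point_mod // (_ : (_ == 0)%N = false) ?mulr0 //.
  by apply/negP => /eqP e; case/eqP: ne; apply: val_inj; rewrite /= in e *; lia.
have N0 : derivation r N = 0.
  by apply: lower_shift_zero => j l; rewrite mxE; case: (eqVneq (l : nat) j.+1) => [-> _|]; [lia | rewrite eqxx].
set y := derivation r xD.
have VY : exterior r A *m y = 0 by rewrite -(derivation_exterior r (esym AN)) N0 mul0mx.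
have YF : y *m exterior r B = 0 by rewrite (derivation_exterior r NB) N0 mulmx0.
have VF : exterior r A *m exterior r B = 1%:M by rewrite -exteriorM AB exterior1.
have id_incr : [ffun j : 'I_r => j] \in increasing r r by apply/increasingP=> i j; rewrite !ffunE.
pose I0 : 'I_#|increasing r r| := enum_rank_in id_incr [ffun j => j].
have [R hR eR] := group_comb_lead alpha D_nilp_graded r.
have y1 := derivation_graded (r := r) (comb_graded (alpha := alpha) D_nilp_graded).
have A0 : graded (fun j : 'I_r => (j : nat)%:Z) degD 0 A.
  rewrite -[0]addr0; apply: gradedM proj_graded => j b; rewrite mxE mul_combX_entry addr0.
  case: leqP => [le|_]; last by rewrite eqxx.
  rewrite mxE back_mod // subn_eq0; case: leqP => [le2 _|_]; last by rewrite mulr0 eqxx.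
  by rewrite /degM; congr Posz; apply/eqP; rewrite eqn_leq le le2.
pose c0 : int := \sum_(j < r) (j : nat)%:Z.
have pv : pure (incr_deg degD) c0 (row I0 (exterior r A)).
  move=> J; rewrite mxE => /(exterior_graded A0); rewrite addr0 => ->.
  by rewrite /incr_deg /incr_fun enum_rankK_in //; apply: eq_bigr => j _; rewrite ffunE.
(* With r = p - 1, the window of degrees left out in
   [exterior_quotient_exact] is exactly c0, ..., c0 + p - 1. Here p odd
   makes r even, which selects the closed form of [cohom_deg]. *)
have coh : (cohom_deg p r).1 = c0 + r%:Z.
  have re : r = (r./2).*2.
    by rewrite -[LHS]odd_double_half /r; move: p_odd; rewrite -[in odd p](prednK p_gt0) /= => /negPf ->.
  have c0E m : (\sum_(j < m) (j : nat)%:Z) * 2%:R = m%:Z * (m%:Z - 1).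
    elim: m => [|m IH]; first by rewrite big_ord0 mul0r.
    by rewrite big_ord_recr /= mulrDl IH; lia.
  have := c0E r; rewrite -/c0 re cohom_deg_even /= -re => e.
  have pr : p = r.+1 by rewrite /r prednK.
  have : (r./2 * p)%N%:Z * 2%:R = r%:Z * (r%:Z + 1).
    rewrite pr PoszM; have : r%:Z = r./2%:Z * 2 by rewrite {1}re; lia.
    by move=> ->; lia.
  by lia.
refine (@nonfree_of_lead F _ (incr_deg degD) _ _ _ eR y1 hR _ (ltnW p_gt2)
  (D_comb_nilpotent r) c0 (row I0 (exterior r A)) _ _ _ _).
- move=> c w hc pw wy; rewrite /y D_comb_compress in wy *.
  have eps_deg b : eps b 0 != 0 -> degM b = 0.
    by rewrite mxE /degM; case: (b %% p)%N => // m; rewrite eqxx.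
  have phi_deg b : phi b 0 != 0 -> degM b = p%:Z - 1.
    rewrite mxE andbT; case: (eqVneq b a1) => [->|]; last by rewrite eqxx.
    by rewrite /degM point_mod /=; lia.
  have w0_deg b : w0 0 b != 0 -> degM b = 0.
    rewrite mxE /=; case: (eqVneq b a0) => [->|]; last by rewrite eqxx.
    by rewrite /degM point_mod.
  have e_deg b : erow 0 b != 0 -> degM b = p%:Z - 1.
    rewrite mxE /degM; case: (eqVneq (b %% p)%N p.-1) => [->|]; last by rewrite eqxx.
    by lia.
  apply: (exterior_quotient_exact p_prime p_char (comb_graded (alpha := alpha) block_nilp_graded) lowering_bracket
    comb_eps erow_comb erow_eps w0_eps erow_phi w0_phi eps_deg phi_deg w0_deg e_deg
    (fun r _ => derivation_x_nilpotent r)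
    lift_proj lift_eps erow_proj proj_lift lift_graded _ pw wy).
    by rewrite /r prednK.
  by rewrite coh /r; case: hc => hc; [left | right]; lia.
- exact: pv.
- by rewrite -row_mul VY row0.
- move=> w /(congr1 (fun u => u *m exterior r B)).
  rewrite -row_mul VF -mulmxA YF mulmx0 => /rowP/(_ I0).
  by rewrite !mxE eqxx => /eqP; rewrite oner_eq0.
Qed.

End Blocks.

(** * The Specht module of shape (n - 1, 1) and its head *)

Section NaturalModule.
Variables (F : fieldType) (n : nat).
Hypotheses (n_gt2 : (2 < n)%N) (n_char : n%:R = 0 :> F).

Local Notation lam := [:: n.-1; 1%N].
Local Notation nt := #|tabloids lam n|.

Let n_gt0 : (0 < n)%N. Proof. exact: leq_trans n_gt2. Qed.
Let first : 'I_n := Ordinal n_gt0.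
Let last_proof : (n.-1 < n)%N. Proof. by rewrite prednK. Qed.
Let last : 'I_n := Ordinal last_proof.

(** A tabloid of shape (n - 1, 1) is determined by the entry of its second
    row, which identifies the permutation module on tabloids with the
    natural module. *)
Definition low_entry : 'M[F]_(nt, n) :=
  \matrix_(i, a) ((enum_val i : {ffun 'I_n -> 'I_2}) a == 1%N :> nat)%:R.

Lemma tabloid_entry (T : {ffun 'I_n -> 'I_2}) : T \in tabloids lam n ->
  exists a, forall x, (T x == 1%N :> nat) = (x == a).
Proof.
rewrite inE => /forallP/(_ (Ordinal (isT : (1 < 2)%N))) /= /cards1P[a ea]; exists a => x.
by move/setP/(_ x): ea; rewrite !inE -val_eqE.
Qed.

Lemma low_entry_inj : low_entry *m low_entry^T = 1%:M.
Proof.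
apply/matrixP=> i j; rewrite !mxE.
have [a ea] := tabloid_entry (enum_valP i); have [b eb] := tabloid_entry (enum_valP j).
rewrite (bigD1 a) //= !mxE ea eqxx mul1r big1 ?addr0 => [|c ne]; last first.
  by rewrite !mxE ea (negPf ne) mul0r.
rewrite eb; congr (_%:R); congr nat_of_bool; apply/eqP/eqP => [ab|e]; last first.
  by have := ea a; rewrite e eb eqxx => /eqP.
apply: enum_val_inj; apply/ffunP=> x; apply: val_inj.
have := ea x; rewrite ab -eb; move: (enum_val i x) (enum_val j x).
by case=> [[|[|]]] //= ? [[|[|]]].
Qed.

Lemma low_entry_free : row_free low_entry.
Proof. by apply/row_freeP; exists low_entry^T; rewrite low_entry_inj. Qed.

Lemma tabloid_low_entry g : tabloid_mx F lam g *m low_entry = low_entry *m perm_mx g.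
Proof.
apply/matrixP=> i a; rewrite mxE.
have igP : tabloid_act (enum_val i) g \in tabloids lam n by rewrite tabloid_actP enum_valP.
rewrite (bigD1 (enum_rank_in igP (tabloid_act (enum_val i) g))) //= !mxE enum_rankK_in // eqxx mul1r.
rewrite big1 ?addr0 => [|l ne]; last first.
  rewrite !mxE; case: eqP => [e|]; last by rewrite mul0r.
  by case/eqP: ne; apply: enum_val_inj; rewrite enum_rankK_in // e.
rewrite (bigD1 ((g^-1)%g a)) //= [X in _ = _ + X]big1 ?addr0 => [|b ne].
  by rewrite !mxE permKV eqxx mulr1 ffunE.
by rewrite !mxE; case: (g b =P a) => [e|_]; [case/eqP: ne; rewrite -e permK | rewrite mulr0].
Qed.

Lemma cell_row (c : 'I_n) : reshape_index lam c = (c == last).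
Proof.
rewrite -val_eqE /reshape_index /=; have := ltn_ord c.
case: (eqVneq (c : nat) n.-1) => [->|ne] lt.
  by rewrite (_ : (n.-1.+1 - n.-1)%N = 1%N) //; lia.
by rewrite (_ : (c.+1 - n.-1)%N = 0%N) //; move: ne lt; lia.
Qed.

Lemma cell_col (c : 'I_n) : reshape_offset lam c = (if c == last then 0 else c)%N.
Proof.
rewrite /reshape_offset cell_row; case: eqP => [->|_] /=; last by rewrite subn0.
by rewrite addn0 subnn.
Qed.

Lemma first_last : first != last.
Proof. by rewrite -val_eqE /=; lia. Qed.

Lemma column_stabE (t : 'S_n) :
  column_stab lam t = [set 1%g; tperm (t first) (t last)].
Proof.
apply/setP=> s; rewrite !inE; apply/forallP/orP => [H|[] /eqP -> x]; last 2 first.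
- by rewrite perm1.
- case: tpermP => [->|->|//]; rewrite !permK !cell_col eqxx.
    by rewrite (negPf first_last).
  by rewrite (negPf first_last).
have fixed x : x != t first -> x != t last -> s x = x.
  move=> xf xl; have := H x; rewrite !cell_col.
  have -> : ((t^-1)%g x == last) = false by apply/negP => /eqP e; case/eqP: xl; rewrite -e permKV.
  case: ifP => [_ /eqP e|_ /eqP e].
    by case/eqP: xf; rewrite -(permKV t x); congr (t _); apply: val_inj; rewrite /= -e.
  by apply: (@perm_inj _ (t^-1)%g); apply: val_inj.
have stable x : (x == t first) || (x == t last) -> (s x == t first) || (s x == t last).
  move=> hx; apply: contraT; rewrite negb_or => /andP[h1 h2].
  have := fixed _ h1 h2 => /perm_inj e.
  by rewrite e in h1 h2; rewrite (negPf h1) (negPf h2) in hx.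
have nfl : t first != t last by rewrite (inj_eq perm_inj) first_last.
case: (eqVneq (s (t first)) (t first)) => [sf|sf]; [left | right].
  apply/eqP/permP=> x; rewrite perm1.
  case: (eqVneq x (t first)) => [->//|xf]; case: (eqVneq x (t last)) => [->|xl]; last exact: fixed.
  have := stable (t last); rewrite eqxx orbT => /(_ isT)/orP[/eqP e|/eqP //].
  by move: nfl; rewrite eq_sym -(inj_eq (@perm_inj _ s)) e sf eqxx.
have sf' : s (t first) = t last.
  by have := stable (t first); rewrite eqxx => /(_ isT)/orP[|/eqP //]; rewrite (negPf sf).
apply/eqP/permP=> x; case: tpermP => [->//|->|/eqP xf /eqP xl]; last exact: fixed.
have := stable (t last); rewrite eqxx orbT => /(_ isT)/orP[/eqP //|/eqP e].
by move: nfl; rewrite -(inj_eq (@perm_inj _ s)) e sf' eqxx.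
Qed.

Lemma tabloid_of_sum (t : 'S_n) a :
  \sum_(i : 'I_nt) (@tabloid_of lam n t (enum_val i))%:R * low_entry i a = (a == t last)%:R.
Proof.
pose T : {ffun 'I_n -> 'I_2} :=
  [ffun x => if x == t last then Ordinal (isT : (1 < 2)%N) else Ordinal (isT : (0 < 2)%N)].
have TP : T \in tabloids lam n.
  have c1 : #|[set x | x == t last]| = 1%N.
    by rewrite (_ : [set x | _] = [set t last]) ?cards1 //; apply/setP=> x; rewrite !inE.
  rewrite inE; apply/forallP=> [[[|[|//]] lt]] /=.
    rewrite (_ : [set x | _] = ~: [set x | x == t last]).
      by rewrite cardsCs setCK c1 card_ord subn1.
    by apply/setP=> x; rewrite !inE ffunE; case: (x == t last).
  rewrite (_ : [set x | _] = [set x | x == t last]) ?c1 //.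
  by apply/setP=> x; rewrite !inE ffunE; case: (x == t last).
have Tof (U : {ffun 'I_n -> 'I_2}) : @tabloid_of lam n t U = (U == T).
  apply/forallP/eqP => [H|-> c].
    apply/ffunP=> x; apply: val_inj; have := H ((t^-1)%g x); rewrite permKV cell_row => /eqP e.
    apply: etrans e _; rewrite ffunE.
    have <- : (t ((t^-1)%g x) == t last) = ((t^-1)%g x == last) by rewrite (inj_eq perm_inj).
    by rewrite permKV; case: (x == t last).
  by rewrite ffunE (inj_eq perm_inj) cell_row; case: (c == last).
rewrite (bigD1 (enum_rank_in TP T)) //= Tof enum_rankK_in // eqxx mul1r mxE enum_rankK_in // big1 ?addr0.
  by rewrite ffunE; case: (a == t last).
move=> i ne; rewrite Tof (_ : (_ == T) = false) ?mul0r //.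
by apply/negP => /eqP e; case/eqP: ne; apply: enum_val_inj; rewrite enum_rankK_in.
Qed.

(** The only column of length two consists of the first and the last cell,
    so the column stabiliser has order two. *)
Lemma polytabloid_low_entry t :
  polytabloid F lam t *m low_entry = delta_mx 0 (t last) - delta_mx 0 (t first).
Proof.
apply/rowP=> a; rewrite mxE.
under eq_bigr do rewrite mxE mulr_suml.
rewrite exchange_big /=.
have E (s : 'S_n) : \sum_(i : 'I_nt) (-1) ^+ odd_perm s * (@tabloid_of lam n (t * s)%g (enum_val i))%:R * low_entry i a
    = (-1) ^+ odd_perm s * (a == s (t last))%:R :> F.
  by under eq_bigr do rewrite -mulrA; rewrite -mulr_sumr tabloid_of_sum permM.
under eq_bigr do rewrite E.
have nfl : t first != t last by rewrite (inj_eq perm_inj) first_last.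
rewrite column_stabE big_setU1 ?inE /=; last first.
  by apply/negP => /eqP/permP/(_ (t first)); rewrite perm1 tpermL => /eqP; rewrite (negPf nfl).
rewrite big_set1 odd_perm1 odd_tperm nfl expr0 expr1 mul1r mulN1r perm1 tpermR !mxE !eqxx.
by [].
Qed.

Lemma specht_low_entry_sum : specht_mx F lam n *m low_entry *m const_mx 1 = 0 :> 'cV_nt.
Proof.
apply/eqP; rewrite -submx0 -mulmxA /specht_mx sumsmxMr_gen; apply/sumsmx_subP=> t _.
rewrite genmxE (eqmxMr _ (genmxE _)) mulmxA polytabloid_low_entry mulmxBl -!rowE submx0.
by apply/eqP/matrixP=> i j; rewrite !mxE subrr.
Qed.

Lemma two_transitive (a b c d : 'I_n) : a != b -> c != d -> exists h : 'S_n, h a = c /\ h b = d.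
Proof.
move=> ab cd; have xc : tperm a c b != c.
  by rewrite -[X in _ != X](tpermL a c) (inj_eq perm_inj) eq_sym.
exists (tperm a c * tperm (tperm a c b) d)%g; rewrite !permM !tpermL; split=> //.
by rewrite (tpermD xc) // eq_sym.
Qed.

Lemma specht_low_entry_sub (a b : 'I_n) :
  (((delta_mx 0 a - delta_mx 0 b)%R : 'rV[F]_n) <= specht_mx F lam n *m low_entry)%MS.
Proof.
case: (eqVneq a b) => [->|ab]; first by rewrite subrr sub0mx.
have [t [tb ta]] : exists t : 'S_n, t first = b /\ t last = a.
  by apply: two_transitive first_last _; rewrite eq_sym.
rewrite -ta -tb -polytabloid_low_entry submxMr // (sumsmx_sup t) // genmxE //.
Qed.

Lemma sum_zero_decomp (v : 'rV[F]_n) : v *m const_mx 1 = 0 :> 'M_1 ->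
  v = \sum_a v 0 a *: (delta_mx 0 a - delta_mx 0 first).
Proof.
move=> v0; under eq_bigr do rewrite scalerBr.
rewrite sumrB -row_sum_delta -scaler_suml [X in X *: _](_ : _ = 0) ?scale0r ?subr0 //.
have := congr1 (fun M : 'M_1 => M 0 0) v0; rewrite !mxE => {2}<-.
by apply: eq_bigr => a _; rewrite mxE mulr1.
Qed.

Local Notation m := (\rank (specht_mx F lam n)).
Local Notation rS := (specht_repr F lam n).
Local Notation ones := (const_mx 1 : 'cV[F]_n).
Local Notation one_row := (const_mx 1 : 'rV[F]_n).

(** The Specht module inside the natural module; its image is the space of
    vectors of sum zero. *)
Definition specht_natural : 'M[F]_(m, n) := val_submod 1%:M *m low_entry.
Local Notation J := specht_natural.

Lemma specht_naturalJ g : rS g *m J = J *m perm_mx g.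
Proof.
rewrite /J /specht_natural mulmxA -val_submodE -[X in val_submod X]mul1mx.
rewrite (val_submodJ (specht_module F lam n)) ?inE //.
rewrite -(mulmxA (val_submod _)) -(mulmxA (val_submod _)); congr (_ *m _); exact: tabloid_low_entry.
Qed.

Lemma specht_natural_free : row_free J.
Proof.
rewrite /row_free mxrankMfree ?low_entry_free //.
by rewrite /val_submod /= mul1mx; apply: row_base_free.
Qed.

Lemma eq_specht_natural : (J :=: specht_mx F lam n *m low_entry)%MS.
Proof. exact: eqmxMr (val_submod1 _). Qed.

Lemma specht_natural_sum : J *m ones = 0.
Proof.
apply/eqP; by rewrite -submx0 (eqmxMr _ eq_specht_natural) specht_low_entry_sum sub0mx.
Qed.

Lemma sum_zero_sub q (A : 'M[F]_(q, n)) : A *m ones = 0 -> (A <= J)%MS.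
Proof.
move=> A0; apply/row_subP=> i; rewrite eq_specht_natural.
rewrite (sum_zero_decomp (v := row i A)); last by rewrite -row_mul A0 row0.
by apply: summx_sub => a _; apply/scalemx_sub/specht_low_entry_sub.
Qed.

Lemma one_row_sum : one_row *m ones = 0.
Proof.
apply/matrixP=> i j; rewrite !mxE -[RHS]n_char -[in RHS](card_ord n) -sumr_const.
by apply: eq_bigr => c _; rewrite !mxE mulr1.
Qed.

Lemma mul_perm_entry (w : 'rV[F]_n) (g : 'S_n) a : (w *m perm_mx g) 0 (g a) = w 0 a.
Proof.
rewrite mxE (bigD1 a) //= !mxE eqxx mulr1 big1 ?addr0 // => b ne.
by rewrite !mxE (inj_eq perm_inj) (negPf ne) mulr0.
Qed.

Lemma delta_perm (g : 'S_n) a : (delta_mx 0 a : 'rV[F]_n) *m perm_mx g = delta_mx 0 (g a).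
Proof. by rewrite -rowE; apply/rowP=> c; rewrite !mxE eq_sym. Qed.

(** If the coordinates a and b of a vector differ, subtracting its image
    under the transposition of a and b leaves a multiple of the difference
    of two coordinate vectors. By double transitivity all such differences
    are obtained, and they span the vectors of sum zero. *)
Lemma specht_submodule_full (U : 'M[F]_m) (u : 'rV_m) a b : mxmodule rS U -> (u <= U)%MS ->
  (u *m J) 0 a != (u *m J) 0 b -> (1%:M <= U)%MS.
Proof.
move=> modU uU; have : (u *m J <= U *m J)%MS by apply: submxMr.
move: (u *m J) => w wU wab.
have UJ g (v : 'rV_n) : (v <= U *m J)%MS -> (v *m perm_mx g <= U *m J)%MS.
  case/submxP => c ->; rewrite -(mulmxA c) -(mulmxA U) -specht_naturalJ (mulmxA U).
  by apply: mulmx_sub; apply: submxMr; apply: (mxmoduleP modU); rewrite inE.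
have ab : a != b by apply: contraNneq wab => ->.
have dab : (((delta_mx 0 a - delta_mx 0 b)%R : 'rV[F]_n) <= U *m J)%MS.
  have -> : (delta_mx 0 a - delta_mx 0 b : 'rV[F]_n) = (w 0 a - w 0 b)^-1 *: (w - w *m perm_mx (tperm a b)).
    apply: (canRL (scalerK _)); first by rewrite subr_eq0.
    apply/rowP=> c; rewrite 3!mxE.
    have -> : (w - w *m perm_mx (tperm a b)) 0 c = w 0 c - w 0 (tperm a b c).
      by have := mul_perm_entry w (tperm a b) (tperm a b c); rewrite tpermK => e; rewrite mxE [X in _ + X]mxE e.
    rewrite [X in _ * (_ + X)]mxE !mxE; case: tpermP => [->|->|/eqP ca /eqP cb].
    - by rewrite !eqxx (negPf ab) subr0 mulr1.
    - by rewrite !eqxx [b == a]eq_sym (negPf ab) sub0r mulrN1 opprB.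
    - by rewrite (negPf ca) (negPf cb) !andbF !subrr mulr0.
  by apply/scalemx_sub/addmx_sub => //; rewrite ?eqmx_opp; apply: UJ.
have dcd c d : (((delta_mx 0 c - delta_mx 0 d)%R : 'rV[F]_n) <= U *m J)%MS.
  case: (eqVneq c d) => [->|cd]; first by rewrite subrr sub0mx.
  have [h [hc hd]] := two_transitive ab cd.
  have := UJ h _ dab; by rewrite mulmxBl !delta_perm hc hd.
have JU : (J <= U *m J)%MS.
  apply/row_subP=> i; rewrite (sum_zero_decomp (v := row i J)); last first.
    by rewrite -row_mul specht_natural_sum row0.
  by apply: summx_sub => c _; apply: scalemx_sub.
case/submxP: JU => D eD; apply/submxP; exists D.
by apply: (row_free_inj specht_natural_free); rewrite mul1mx -mulmxA.
Qed.

Lemma one_row_natural : one_row *m pinvmx J *m J = one_row.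
Proof. by rewrite mulmxKpV // sum_zero_sub // one_row_sum. Qed.

Definition const_line : 'M[F]_m := <<one_row *m pinvmx J>>%MS.

Lemma const_lineP (u : 'rV_m) : reflect (exists kap, u *m J = kap *: one_row) (u <= const_line)%MS.
Proof.
rewrite genmxE; apply: (iffP submxP) => [[c ->]|[kap e]].
  exists (c 0 0); rewrite -mulmxA one_row_natural {1}[c]mx11_scalar mul_scalar_mx.
  by [].
exists kap%:M; apply: (row_free_inj specht_natural_free).
by rewrite e mul_scalar_mx -scalemxAl one_row_natural.
Qed.

Lemma const_line_module : mxmodule rS const_line.
Proof.
apply/mxmoduleP => g _; rewrite (eqmxMr _ (genmxE _)) genmxE.
rewrite [X in (X <= _)%MS](_ : _ = one_row *m pinvmx J) //.
apply: (row_free_inj specht_natural_free).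
rewrite -(mulmxA (one_row *m _)) specht_naturalJ mulmxA one_row_natural.
apply/rowP=> a; have := mul_perm_entry one_row g ((g^-1)%g a); rewrite permKV => ->.
by rewrite !mxE.
Qed.

Lemma specht_submodule_dichotomy (U : 'M[F]_m) : mxmodule rS U ->
  (U <= const_line)%MS \/ (1%:M <= U)%MS.
Proof.
move=> modU; case: (boolP (U <= const_line)%MS) => [|/row_subPn[i /negP nL]]; [by left | right].
have [/forallP eqw|/forallPn[a wa]] := boolP [forall a, (row i U *m J) 0 a == (row i U *m J) 0 first].
  case: nL; apply/const_lineP.
  exists ((row i U *m J) 0 first); apply/rowP=> a.
  by rewrite (eqP (eqw a)) [RHS]mxE [X in _ * X]mxE mulr1.
exact: specht_submodule_full (row_sub i U) wa.
Qed.

Lemma const_line_proper : ~~ (1%:M <= const_line)%MS.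
Proof.
apply/negP => full.
pose b : 'I_n := Ordinal (ltnW n_gt2); pose c : 'I_n := Ordinal n_gt2.
pose w : 'rV[F]_n := delta_mx 0 first - delta_mx 0 b.
have wJ : w *m pinvmx J *m J = w.
  by rewrite mulmxKpV // eq_specht_natural specht_low_entry_sub.
have /const_lineP[kap] : (w *m pinvmx J <= const_line)%MS by apply: submx_trans full; apply: submx1.
rewrite wJ => /rowP e; have := e c; have := e first; rewrite !mxE /= => e1 e2.
by move: e1; rewrite -e2 subr0 subrr => /eqP; rewrite oner_eq0.
Qed.

Lemma const_line_max : max_submod rS const_line 1%:M.
Proof.
split=> [|W [modW ltW /andP[_ /negP nW]]]; first by rewrite ltmxE submx1 const_line_proper.
case: (specht_submodule_dichotomy modW) => //.
by move: ltW; rewrite ltmxE => /andP[_ /negP].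
Qed.

(** A submodule that is not contained in the line of constant vectors is
    everything, and this line is proper as n > 2: it is the only maximal
    submodule. *)
Lemma radical_specht (u : 'rV_m) : (u <= radical rS)%MS = (u <= const_line)%MS.
Proof.
have [_ radP] := radicalP rS; apply/idP/idP => [/radP|uL].
  by apply; [apply: const_line_module | apply: const_line_max].
apply/radP => U modU [ltU maxU]; apply: submx_trans uL _.
case: (boolP (const_line <= U)%MS) => // nU.
case: (specht_submodule_dichotomy modU) => [UL|full].
  case: (maxU const_line); split; first exact: const_line_module.
    by rewrite ltmxE UL.
  by rewrite ltmxE submx1 const_line_proper.
by move: ltU; rewrite ltmxE full andbF.
Qed.

Local Notation rD := (james_repr F lam n).

(** Meaningful on vectors of sum zero only, where the pseudo-inverse inverts
    the inclusion of the Specht module. *)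
Definition head_proj := pinvmx J *m in_factmod (radical rS) 1%:M.

Lemma head_projE q (A : 'M[F]_(q, n)) : A *m head_proj = in_factmod (radical rS) (A *m pinvmx J).
Proof. by rewrite /head_proj mulmxA -in_factmodE. Qed.

Lemma head_projJ q (A : 'M[F]_(q, n)) g : A *m ones = 0 ->
  A *m perm_mx g *m head_proj = A *m head_proj *m rD g.
Proof.
move=> A0; have AJ : A *m pinvmx J *m J = A by rewrite mulmxKpV // sum_zero_sub.
rewrite !head_projE.
have -> : A *m perm_mx g *m pinvmx J = A *m pinvmx J *m rS g.
  rewrite -{1}AJ -(mulmxA _ J (perm_mx g)) -specht_naturalJ.
  by rewrite -(mulmxA _ (rS g *m J) (pinvmx J)) -(mulmxA (rS g) J (pinvmx J)) mulmxVp ?specht_natural_free // mulmx1.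
exact: (in_factmodJ (proj1 (radicalP rS))).
Qed.

Lemma head_proj_one : one_row *m head_proj = 0.
Proof.
apply/eqP; rewrite head_projE in_factmod_eq0 radical_specht.
by apply/const_lineP; exists 1; rewrite one_row_natural scale1r.
Qed.

Lemma head_proj_eq0 (w : 'rV[F]_n) : w *m ones = 0 -> w *m head_proj = 0 ->
  exists kap, w = kap *: one_row.
Proof.
move=> w0 /eqP; rewrite head_projE in_factmod_eq0 radical_specht => /const_lineP[kap].
by rewrite mulmxKpV ?sum_zero_sub // => ->; exists kap.
Qed.

Lemma head_proj_surj (z : 'rV[F]_(\rank (cokermx (radical rS)))) :
  exists2 w : 'rV[F]_n, w *m ones = 0 & z = w *m head_proj.
Proof.
exists (val_factmod z *m J); first by rewrite -mulmxA specht_natural_sum mulmx0.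
by rewrite head_projE -mulmxA mulmxVp ?specht_natural_free // mulmx1 val_factmodK.
Qed.

End NaturalModule.

(** * Comparison of the shift model with the head *)

Section PascalBlocks.
Variables (F : fieldType) (p k : nat).
Hypotheses (p_prime : prime p) (p_char : p \in [pchar F]).
Local Notation n := (k * p)%N.

Let p_gt0 : (0 < p)%N := prime_gt0 p_prime.

Lemma binF_prime l : (0 < l < p)%N -> 'C(p, l)%:R = 0 :> F.
Proof. by move=> lp; apply/eqP; rewrite -(dvdn_pcharf p_char) prime_dvd_bin. Qed.

Lemma binF_modS j l : (j < p)%N -> (l < p)%N -> 'C(j.+1 %% p, l)%:R = 'C(j.+1, l)%:R :> F.
Proof.
move=> jp lp; case: (ltnP j.+1 p) => [lt|ge]; first by rewrite modn_small.
have -> : j.+1 = p by apply/eqP; rewrite eqn_leq jp ge.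
rewrite modnn bin0n; case: l lp => [|l] lp; first by rewrite bin0.
by rewrite binF_prime.
Qed.

(** The coordinates of the permutation basis in the basis of the w_(i,j):
    g_i^j w_(i,0) is the sum of the C(j, l) w_(i,l), because g_i = 1 +
    X_i. *)
Definition block_pascal : 'M[F]_n :=
  \matrix_(a, b) ((a %/ p == b %/ p)%N%:R * 'C(a %% p, b %% p)%:R).
Local Notation V := block_pascal.

Lemma block_pascal_unit : V \in unitmx.
Proof.
rewrite unitmxE det_trig.
  by rewrite big1 ?unitr1 // => a _; rewrite mxE eqxx binn mulr1.
apply/is_trig_mxP => a b ab; rewrite mxE.
case: eqP => [e|]; last by rewrite mul0r.
rewrite bin_small ?mulr0 //; move: ab.
by rewrite {1}(divn_eq a p) {1}(divn_eq b p) e ltn_add2l.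
Qed.

Lemma block_nilp_delta i :
  block_nilp F p i = \sum_(j < k) (j == i)%:R *: block_nilp F p j.
Proof.
rewrite (bigD1 i) //= eqxx scale1r big1 ?addr0 // => j ne.
by rewrite (negPf ne) scale0r.
Qed.

Lemma mul_block_nilp (A : 'M[F]_n) i a b : (A *m block_nilp F p i) a b =
  if (0 < b %% p)%N then (b %/ p == i)%N%:R * A a (back 1 b) else 0.
Proof.
have -> : (A *m block_nilp F p i) a b = (row a A *m block_nilp F p i) 0 b by rewrite -row_mul [RHS]mxE.
rewrite block_nilp_delta (mul_comb_entry p_prime); case: ifP => // _.
by rewrite [row a A _ _]mxE -val_eqE.
Qed.

(** Pascal's rule. At the end of a block, where the cycle closes up, it
    holds because the binomial coefficients C(p, l) with 0 < l < p vanish in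
    F. *)
Lemma block_pascal_pcycle i :
  perm_mx (pcycle p i) *m V = V *m (1%:M + block_nilp F p i).
Proof.
rewrite mulmxDr mulmx1 -row_permE; apply/matrixP => a b.
rewrite [RHS]mxE mul_block_nilp !mxE permE val_block_shift.
have bk : (0 < b %% p)%N -> (back 1 b %/ p = b %/ p)%N.
  by move=> b0; have := back_blk p_prime b0; move=> /(congr1 val).
case: ((a %/ p)%N =P i) => [ai|/eqP ai]; last first.
  case: ifP => b0; last by rewrite addr0.
  rewrite bk //; case: (eqVneq (a %/ p)%N (b %/ p)%N) => [e|ne].
    by rewrite -e (negPf ai) mul0r addr0.
  by rewrite !mul0r mulr0 addr0.
rewrite divnMDl // modnMDl modn_mod [X in (_ + X)%N]divn_small ?ltn_pmod // addn0.
rewrite -[a.+1]addn1 -modnDml addn1 binF_modS ?ltn_pmod // !ai.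
case: posnP => [-> |b0]; first by rewrite !bin0 addr0.
rewrite bk // back_mod // [(b %/ p)%N == i]eq_sym.
case: eqP => [_|]; last by rewrite !mul0r addr0.
by rewrite !mul1r subn1 -{1}(prednK b0) binS natrD prednK.
Qed.

Lemma block_pascal_eps : V *m eps F p k = const_mx 1.
Proof.
apply/colP=> a; rewrite !mxE (sum_points p_prime) (bigD1 (blk p_prime a)) //=.
rewrite (bigD1 (Ordinal p_gt0)) //= [X in _ + X + _]big1 ?addr0 => [|j ne].
  rewrite !mxE point_div // point_mod // !eqxx bin0 !mul1r big1 ?addr0 // => j ne.
  apply: big1 => l _; rewrite !mxE point_div //.
  by rewrite -val_eqE /= eq_sym in ne; rewrite (negPf ne) !mul0r.
by rewrite !mxE point_mod //; rewrite -val_eqE /= in ne; rewrite (negPf ne) mulr0.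
Qed.

Lemma sum_bin_column q l : \sum_(j < q) 'C(j, l) = 'C(q, l.+1).
Proof.
elim: q => [|q IH]; first by rewrite big_ord0 bin0n.
by rewrite big_ord_recr /= IH binS.
Qed.

(** The sum of the C(j, l) over j < p is C(p, l + 1), which vanishes in F
    unless l = p - 1. *)
Lemma ones_block_pascal : const_mx 1 *m V = erow F p k.
Proof.
apply/rowP=> b; rewrite !mxE (sum_points p_prime) (bigD1 (blk p_prime b)) //=.
rewrite [X in _ + X]big1 ?addr0 => [|i ne]; last first.
  apply: big1 => l _; rewrite !mxE point_div //.
  by rewrite -val_eqE /= in ne; rewrite (negPf ne) mul0r mulr0.
transitivity (\sum_(j < p) 'C(j, b %% p)%:R : F).
  by apply: eq_bigr => j _; rewrite !mxE point_div // point_mod // eqxx !mul1r.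
rewrite -natr_sum sum_bin_column.
have := ltn_pmod b p_gt0; case: eqP => [->|ne] lt; first by rewrite prednK // binn.
by rewrite binF_prime //; lia.
Qed.

End PascalBlocks.

Section HeadCoordinates.
Variables (F : fieldType) (p k : nat).
Hypotheses (p_prime : prime p) (p_char : p \in [pchar F]).
Hypotheses (p_gt2 : (2 < p)%N) (k_ge2 : (1 < k)%N).
Local Notation n := (k * p)%N.
Local Notation V := (block_pascal F p k).
Local Notation lift := (lift_D F p_prime k_ge2).
Local Notation proj := (proj_D F p_prime k_ge2).
Local Notation rD := (D1_repr p k F).

Let n_gt2 : (2 < n)%N.
Proof. by apply: leq_trans p_gt2 _; rewrite leq_pmull // ltnW. Qed.
Let n_char : n%:R = 0 :> F.
Proof. by rewrite natrM (pcharf0 p_char) mulr0. Qed.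
Let V_unit : V \in unitmx. Proof. exact: block_pascal_unit. Qed.

(** From coordinates in the shift model of S / e to coordinates in the head
    of the Specht module. *)
Definition head_coord := lift *m invmx V *m head_proj F n.
Local Notation B := head_coord.

Lemma lift_sum_zero : lift *m invmx V *m const_mx 1 = 0 :> 'cV[F]_#|D_index p_prime k_ge2|.
Proof.
by rewrite -(block_pascal_eps F k p_prime) -mulmxA mulKmx // lift_eps.
Qed.

Lemma erow_head : erow F p k *m invmx V *m head_proj F n = 0.
Proof.
by rewrite -(ones_block_pascal k p_prime p_char) mulmxK // head_proj_one.
Qed.

(** Two representatives in S of a vector of S / e have the same image, since
    the all-one vector is zero in the head. *)
Lemma proj_head_coord q (A : 'M_(q, n)) : A *m eps F p k = 0 ->
  A *m proj *m B = A *m invmx V *m head_proj F n.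
Proof.
move=> A0; have := erow_head; rewrite /head_coord -!mulmxA.
move: (invmx V *m head_proj F n) => H eH.
rewrite (mulmxA proj) proj_lift // !mulmxBl mul1mx -!(mulmxA _ _ H) eH mulmx0 subr0.
by rewrite mulmxBr (mulmxA A) A0 mul0mx subr0.
Qed.

Lemma head_coord_pcycle i :
  (1%:M + D_nilp F p_prime k_ge2 i) *m B = B *m rD (pcycle p i).
Proof.
rewrite -(head_projJ n_gt2 _ lift_sum_zero).
have -> : lift *m invmx V *m perm_mx (pcycle p i) =
          lift *m (1%:M + block_nilp F p i) *m invmx V.
  apply: (canRL (mulmxK V_unit)).
  by rewrite -!mulmxA block_pascal_pcycle // mulKmx.
rewrite mulmxDl mul1mx mulmxDr mulmx1 !mulmxDl; congr (_ + _).
by rewrite proj_head_coord // -mulmxA block_nilp_eps mulmx0.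
Qed.

Lemma head_coord_free : row_free B.
Proof.
rewrite -kermx_eq0 -submx0; apply/row_subP=> s; rewrite submx0.
have : row s (kermx B) *m B = 0 by rewrite -row_mul mulmx_ker row0.
move: (row s _) => u; rewrite /head_coord (mulmxA u) => uB.
have [|kap e] := head_proj_eq0 n_gt2 n_char _ uB.
  by rewrite -mulmxA lift_sum_zero mulmx0.
have e' : u *m lift = kap *: erow F p k.
  rewrite -(ones_block_pascal k p_prime p_char) scalemxAl -e mulmxA mulmxKV //.
by rewrite -[u]mulmx1 -(lift_proj F p_prime p_gt2 k_ge2) mulmxA e' -scalemxAl erow_proj scaler0.
Qed.

Lemma head_coord_full : row_full B.
Proof.
rewrite -sub1mx; apply/row_subP => s.
have [w w0 ->] := head_proj_surj n_gt2 (row s 1%:M).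
rewrite -(mulmxK V_unit w) -proj_head_coord ?submxMl //.
by rewrite -mulmxA block_pascal_eps.
Qed.

Lemma head_coord_inverse : exists2 B', B *m B' = 1%:M & B' *m B = 1%:M.
Proof.
exists (pinvmx B); first by rewrite mulmxVp ?head_coord_free.
by rewrite -[pinvmx B]mul1mx mulmxKpV // submx_full ?head_coord_full.
Qed.

End HeadCoordinates.

Section Transport.
Variables (F : fieldType) (N N' q : nat) (E : 'M[F]_(N, N')) (E' : 'M[F]_(N', N)).
Variables (x : 'M[F]_N) (y : 'M[F]_N').
Hypotheses (EK : E *m E' = 1%:M) (KE : E' *m E = 1%:M) (xE : x *m E = E *m y).

Lemma transport_exp j : x ^+ j *m E = E *m y ^+ j.
Proof.
elim: j => [|j IH]; first by rewrite !expr0 mulmx1 mul1mx.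
by rewrite -!expmxSr -mulmxA xE mulmxA IH mulmxA.
Qed.

Lemma transport_exact i j :
  (forall v : 'rV_N, v *m x ^+ i = 0 -> exists w, v = w *m x ^+ j) ->
  forall v : 'rV_N', v *m y ^+ i = 0 -> exists w, v = w *m y ^+ j.
Proof.
move=> ex v vy; have [|w e] := ex (v *m E').
  by rewrite -[LHS]mulmx1 -EK !mulmxA -(mulmxA _ _ E) transport_exp -!mulmxA
             (mulmxA E') KE mul1mx (mulmxA v) vy mul0mx.
by exists (w *m E); rewrite -mulmxA -transport_exp mulmxA -e -mulmxA KE mulmx1.
Qed.

Lemma transport_nilpotent j : x ^+ j = 0 -> y ^+ j = 0.
Proof.
by move=> x0; rewrite -[y ^+ j]mul1mx -KE -mulmxA -transport_exp x0 mul0mx mulmx0.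
Qed.

Lemma transport_sym : y *m E' = E' *m x.
Proof. by rewrite -[LHS]mul1mx -KE -mulmxA (mulmxA E) -xE -!mulmxA EK mulmx1. Qed.

End Transport.

(** Freeness for 1 + y, decided on an isomorphic model x by the two
    exactness criteria. *)
Lemma cyclic_free_transport (F : fieldType) (N N' p : nat) (x : 'M[F]_N) (y : 'M[F]_N')
    (E : 'M_(N, N')) (E' : 'M_(N', N)) (b : bool) :
  (0 < p)%N -> E *m E' = 1%:M -> E' *m E = 1%:M -> x *m E = E *m y -> x ^+ p = 0 ->
  (b -> forall v : 'rV_N, v *m x = 0 -> exists w, v = w *m x ^+ p.-1) ->
  (~~ b -> exists2 v : 'rV_N, v *m x ^+ p.-1 = 0 & forall w, v <> w *m x) ->
  cyclic_free p (1%:M + y) <-> b.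
Proof.
move=> p_gt0 EK KE xE xp0 ex nex.
have yp0 : y ^+ p = 0 by exact: transport_nilpotent KE xE _ xp0.
have yE := transport_sym EK KE xE.
split=> [free|/ex exx]; last first.
  apply: (cyclic_free_exact p_gt0 yp0).
  exact: (transport_exact (i := 1) (j := p.-1) EK KE xE exx).
case: (boolP b) => // /nex[v vx nw].
have exact_y := cyclic_freeP_exact p_gt0 yp0 free.
have [w e] := transport_exact (i := p.-1) (j := 1) KE EK yE exact_y vx.
by case: (nw w).
Qed.

(** * The rank variety *)

Section Evaluation.
Variables (F : fieldType) (p k : nat) (a : 'I_k -> F).

Lemma meval_p_poly : (p_poly p k F).@[a] = psum p a.
Proof.
rewrite /p_poly rmorph_sum; apply: eq_bigr => i _.
rewrite rmorphXn rmorph_prod; congr (_ ^+ _); apply: eq_bigr => j _; exact: mevalXU.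
Qed.

Lemma zero_expr_predn : (1 < p)%N -> 0 ^+ p.-1 = 0 :> F.
Proof. by case: p => [|[|q]] // _; rewrite expr0n. Qed.

(** Each term of p_k omits a single coordinate. *)
Lemma psum_two_zeros z1 z2 : (1 < p)%N -> z1 != z2 -> a z1 = 0 -> a z2 = 0 -> psum p a = 0.
Proof.
move=> p_gt1 ne a1 a2; apply: big1 => i _.
have [z zi az] : exists2 z, z != i & a z = 0.
  by case: (eqVneq z1 i) => [<-|ne1]; [exists z2; rewrite 1?eq_sym | exists z1].
by rewrite (bigD1 z) //= az mul0r zero_expr_predn.
Qed.

(** The term that omits the coordinate z is the only one that survives. *)
Lemma psum_one_zero z : (1 < p)%N -> a z = 0 -> (forall i, i != z -> a i != 0) -> psum p a != 0.
Proof.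
move=> p_gt1 az anz; rewrite /psum (bigD1 z) //= [X in _ + X]big1 ?addr0 => [|i iz].
  by rewrite expf_neq0 // prodf_seq_neq0; apply/allP => i _; apply/implyP => /anz.
by rewrite (bigD1 z) 1?eq_sym //= az mul0r zero_expr_predn.
Qed.

End Evaluation.

Lemma group_comb_transport (F : fieldType) (I : finType) d d' (B : 'M[F]_(d, d'))
    (X : I -> 'M[F]_d) (G : I -> 'M[F]_d') (a : I -> F) r :
    (forall i, (1%:M + X i) *m B = B *m G i) ->
  group_comb X a r *m exterior r B =
  exterior r B *m (\sum_i a i *: (exterior r (G i) - 1%:M)).
Proof.
move=> XB; rewrite mulmx_suml mulmx_sumr; apply: eq_bigr => i _.
rewrite -scalemxAl -scalemxAr mulmxBl mulmxBr mul1mx mulmx1.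
by rewrite -!exteriorM XB.
Qed.

Lemma exterior_inverse (F : fieldType) d d' (B : 'M[F]_(d, d')) (C : 'M[F]_(d', d)) r :
  B *m C = 1%:M -> exterior r B *m exterior r C = 1%:M.
Proof. by move=> BC; rewrite -exteriorM BC exterior1. Qed.

Section Reduction.
Variables (F : fieldType) (p k : nat).
Hypotheses (p_prime : prime p) (p_char : p \in [pchar F]).
Hypotheses (p_odd : odd p) (k_ge2 : (1 < k)%N).
Variable alpha : 'rV[F]_k.

Let p_gt2 : (2 < p)%N := odd_prime_gt2 p_odd p_prime.
Let p_gt0 : (0 < p)%N := prime_gt0 p_prime.

Local Notation a := (alpha 0).
Local Notation x := (group_comb (D_nilp F p_prime k_ge2) a p.-1).

(** Either no coordinate of alpha vanishes or at least two do, since exactly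
    one zero would make p_k(alpha) nonzero. *)
Lemma D_comb_nonexact : psum p a = 0 ->
  exists2 v : 'rV_#|increasing p.-1 #|D_index p_prime k_ge2| |, v *m x ^+ p.-1 = 0 & forall w, v <> w *m x.
Proof.
move=> ps0; case: (pickP (fun z => a z == 0)) => [z1 /eqP az1|anz]; last first.
  by apply: D_nonexact => // i; rewrite anz.
case: (pickP (fun z => (z != z1) && (a z == 0))) => [z2 /andP[ne /eqP az2]|anz].
  exact: D_nonexact_zeros ne az2 az1.
have := psum_one_zero (prime_gt1 p_prime) az1; rewrite ps0 eqxx => H.
by apply: False_ind; apply: notF; apply: H => i iz; have := anz i; rewrite iz /= => ->.
Qed.

Lemma cyclic_free_psum d' (B : 'M[F]_(#|D_index p_prime k_ge2|, d')) B' (G : 'I_k -> 'M[F]_d') :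
  B *m B' = 1%:M -> B' *m B = 1%:M ->
  (forall i, (1%:M + D_nilp F p_prime k_ge2 i) *m B = B *m G i) ->
  cyclic_free p (1%:M + \sum_i a i *: (exterior p.-1 (G i) - 1%:M)) <-> psum p a != 0.
Proof.
move=> BK KB DB.
have BrK := exterior_inverse p.-1 BK; have KBr := exterior_inverse p.-1 KB.
have xB := group_comb_transport a p.-1 DB.
apply: (cyclic_free_transport p_gt0 BrK KBr xB (D_comb_nilpotent p_prime p_gt2 k_ge2 a p_char p.-1)).
  by move=> nz v; exact: D_exact.
by rewrite negbK => /eqP; exact: D_comb_nonexact.
Qed.

End Reduction.

Unset Implicit Arguments.

Theorem theorem4p10 (p k : nat) (F : closedFieldType)
    (p_prime : prime p) (p_odd : odd p) (p_char : p \in [pchar F])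
    (k_ge2 : (2 <= k)%N) (alpha : 'rV[F]_k) :
  rank_variety (subg_repr (D_repr p k F p.-1) (subsetT (pcycle_group p k))) alpha
  <-> zero_locus (p_poly p k F) alpha.
Proof.
have p_gt2 := odd_prime_gt2 p_odd p_prime.
have [B' BK KB] := head_coord_inverse p_prime p_char p_gt2 k_ge2.
have free := cyclic_free_psum p_char p_odd alpha BK KB (head_coord_pcycle p_prime p_char p_gt2 k_ge2).
rewrite /zero_locus meval_p_poly; split=> [[->|[_ notfree]]|ps0].
- apply: (@psum_two_zeros _ p k _ (Ordinal (ltnW k_ge2)) (Ordinal k_ge2)) => //; rewrite ?mxE //.
  exact: prime_gt1.
- apply/eqP; apply: contra_notT notfree => nz; exact/free.
- case: (eqVneq alpha 0) => [->|nz]; [by left | right; split=> // /free].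
  by rewrite ps0 eqxx.
Qed.
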